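(* Snapshots in PaRiS are causal. That is, in every execution of the PaRiS protocol (described in the context), for every transaction $T$ and every admissible choice of the replicas (and serving times) used for the reads of $T$, the snapshot $S_T$ visible to $T$ is a causally consistent snapshot.
   Context: **System.** A multi-version key-value store is split into $N$ partitions; each key $k$ belongs to one partition $partition(k)$. There are $M$ data centers (DCs). Each partition is replicated at $R$ of the DCs. The server of partition $n$ in DC $m$ (if $m$ replicates $n$) is $p_n^m$; its replica index among the $R$ replicas of partition $n$ is denoted $r$. Servers communicate through lossless FIFO channels with arbitrary finite delays; each event handler executes atomically. Timestamps are nonnegative integers. An item version is $d=\langle k,v,ut,id_T,sr\rangle$: key, value, update timestamp, id of the creating transaction, id of the DC where it was created. Versions of one key are totally ordered lexicographically by $(ut,id_T,sr)$; ''freshest'' means largest in this order. **Server state.** $p_n^m$ has a physical clock $Clock_n^m$ (monotonically increasing: each reading is strictly larger than the previous ones), a hybrid logical clock $HLC_n^m$, a version vector $VV_n^m$ with $R$ entries, a scalar $ust_n^m$ (universal stable time), and sets $Prepared_n^m$, $Committed_n^m$. $HLC_n^m$, all entries of $VV_n^m$ and $ust_n^m$ are initially $0$; the sets are initially empty. **Client state.** A client $c$ issues operations sequentially. It keeps $ust_c$, $hwt_c$ (both initially $0$), a private write cache $WC_c$, and a read set $RS_c$ and write set $WS_c$ of the current transaction. **Start.** $c$ sends $ust_c$ to a coordinator server $p_n^m$ in its local DC; $p_n^m$ sets $ust_n^m\gets\max\{ust_n^m,ust_c\}$, generates a unique transaction id, and returns $ust_n^m$ as the snapshot timestamp $sn_T$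 of the transaction $T$. Then $c$ sets $ust_c\gets sn_T$, $RS_c,WS_c\gets\emptyset$, and removes from $WC_c$ all versions with timestamp $\le ust_c$. **Read.** For each key $k$, $c$ looks in $WS_c$, then $RS_c$, then $WC_c$, and returns a version found there. Otherwise the read is forwarded by the coordinator to some replica (in any DC) of the partition of $k$; this server sets its own universal stable time to the max of itself and $sn_T$, and returns the freshest version $d$ of $k$ that it has installed with $d.ut\le sn_T$. Versions read are added to $RS_c$. **Write.** Writes are buffered in $WS_c$ (at most one entry per key). **Commit** (only if $WS_c\ne\emptyset$). $c$ sends $hwt_c$ and $WS_c$ to the coordinator, which sets $ht=\max\{sn_T,hwt_c\}$ and, for each partition with at least one written key, picks one replica (a cohort) and sends it a prepare message with $sn_T$, $ht$ and its updates. On prepare, a cohort $p_n^m$ sets $HLC_n^m\gets\max(Clock_n^m,ht+1,HLC_n^m+1)$, $ust_n^m\gets\max\{ust_n^m,sn_T\}$, proposes $pt=\max\{HLC_n^m,ust_n^m\}$, adds $(id_T,pt,\text{updates})$ to $Prepared_n^m$, and replies $pt$. The coordinator sets the commit time $T.ct$ to the maximum of the proposed times and sends it to all cohorts and to $c$. On commit, a cohort sets $HLC_n^m\gets\max(HLC_n^m,ct,Clock_n^m)$ and moves the transaction from $Prepared_n^m$ to $Committed_n^m$ with timestamp $ct$. Upon the reply, $c$ sets $hwt_c\gets ct$, tags the entries of $WS_c$ with $ct$ and moves them to $WC_c$, overwriting older entries for the same key. All versions written by $T$ have $ut=T.ct$. **Applying and replicating.** Periodically, $p_n^m$ computes $ub=\min\{pt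 : pt \text{ in } Prepared_n^m\}-1$ if $Prepared_n^m\neq\emptyset$, else $ub=\max\{Clock_n^m,HLC_n^m\}$. If $Committed_n^m\ne\emptyset$, then for the transactions in $Committed_n^m$ with $ct\le ub$, grouped by $ct$ and in increasing order of $ct$: it installs (inserts in the version chain of the key) their versions with $ut=ct$, sends one Replicate message per group (all updates of the group, with $ct$) to the other replicas of partition $n$, and removes the group from $Committed_n^m$; then it sets $VV_n^m[r]\gets ub$. If $Committed_n^m=\emptyset$, it sets $VV_n^m[r]\gets ub$ and sends a Heartbeat with value $ub$ to the other replicas. On receipt of Replicate with timestamp $ct$ (resp. Heartbeat with value $t$) from the $i$-th replica, a server installs the contained versions and sets $VV_n^m[i]\gets ct$ (resp. sets $VV_n^m[i]\gets t$). **Stabilization (UST).** Periodically, the servers of each DC compute, from (possibly old) values of the version vectors of all servers of that DC, the minimum over all these servers and all $R$ entries (the DC's global stable time GST); the DCs exchange their GSTs; periodically each server sets $ust_n^m\gets\max\{ust_n^m, \min \text{ over all DCs of the (possibly old) received GSTs}\}$, where values not yet received count as $0$. **Causality.** For operations $a,b$: $a\leadsto b$ iff $a$ precedes $b$ in a single thread of execution (client), or $a$ is a write and $b$ is a read that returns the version written by $a$, or there is $c$ with $a\leadsto c$ and $c\leadsto b$. For versions, $X\leadsto Y$ ($Y$ depends on $X$) means the write of $X$ $\leadsto$ the write of $Y$; versions written by the same transaction are not regarded as causally related to each other. **Snapshot visible to $T$.** Let $T$ be a transaction of client $c$ with snapshot timestamp $sn_T$. An admissible choice selects for each partition one of its replicas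 and a time at or after the moment the coordinator assigned $sn_T$. For such a choice, $S_T$ is the set of all versions $d$ such that either $d.ut\le sn_T$ and $d$ has been installed by the selected replica of $partition(d.k)$ by the selected time, or $d$ was written by $c$ in an earlier committed transaction and $d.ut>sn_T$ (the client's own writes not yet in the stable snapshot, kept in its cache). The version of key $k$ *visible* in $S_T$ is the freshest version of $k$ in $S_T$. **Causally consistent snapshot.** $S_T$ is causally consistent if (1) whenever $Y\in S_T$ and $X\leadsto Y$, also $X\in S_T$; and (2) whenever $X$ and $Y$ are the versions of keys $x$ and $y$ visible in $S_T$ and $X\leadsto Y$, there is no other version $X'$ of $x$ with $X\leadsto X'\leadsto Y$. *)

(* Defs.v *)
From HB Require Import structures.
From mathcomp Require Import all_boot.

Set Implicit Arguments.
Unset Strict Implicit.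
Unset Printing Implicit Defensive.

(* [placement n r] is the data center of the [r]-th replica of partition [n]. *)
Record system := System {
  nparts : nat;
  ndcs : nat;
  nreps : nat;
  key : eqType;
  value : eqType;
  client : eqType;
  partition : key -> 'I_nparts;
  placement : 'I_nparts -> 'I_nreps -> 'I_ndcs;
  placement_inj : forall n, injective (placement n);
  home : client -> 'I_ndcs
}.

Definition txid := nat.

Section Versions.
Context (P : system).

Record version := Version {
  v_key : key P;
  v_val : value P;
  v_ut : nat;
  v_tx : txid;
  v_sr : 'I_(ndcs P)
}.

Definition version_tuple (d : version) :=
  (v_key d, v_val d, v_ut d, v_tx d, v_sr d).
Definition tuple_version (t : key P * value P * nat * txid * 'I_(ndcs P)) :=
  let: (k, v, ut, id, sr) := t in Version k v ut id sr.
Lemma version_tupleK : cancel version_tuple tuple_version.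
Proof. by case. Qed.
HB.instance Definition _ := Equality.copy version (can_type version_tupleK).

Definition version_le (d d' : version) : bool :=
  (v_ut d < v_ut d') ||
  (v_ut d == v_ut d') &&
    ((v_tx d < v_tx d') || (v_tx d == v_tx d') && (v_sr d <= v_sr d')).

(* The server (n, r) is p_n^m with m = placement n r, so that exactly the
   existing servers are represented. *)
Definition server := ('I_(nparts P) * 'I_(nreps P))%type.
Definition dc (p : server) : 'I_(ndcs P) := placement p.1 p.2.

Definition node := (server + client P)%type.

Definition update := (key P * value P)%type.

(* What a read returns: a value and the transaction that wrote it.  Together
   with the key this identifies the version, as a transaction creates at most
   one version per key; it is also all that is known of a version that is still
   in a write set. *)
Definition item := (value P * txid)%type.
Definition item_of (d : version) : item := (v_val d, v_tx d).

Definition vvector := {ffun 'I_(nreps P) -> nat}.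

Inductive msg :=
  | StartReq (ust : nat)
  | StartResp (id : txid) (sn : nat)
  | ReadReq (id : txid) (k : key P)
  | SliceReq (id : txid) (k : key P) (sn : nat)
  | SliceResp (id : txid) (k : key P) (res : option item)
  | ReadResp (id : txid) (k : key P) (res : option item)
  | CommitReq (id : txid) (hwt : nat) (ws : seq update)
  | Prepare (id : txid) (sn ht : nat) (ups : seq update)
  | PrepareResp (id : txid) (pt : nat)
  | Commit (id : txid) (ct : nat)
  | CommitResp (id : txid) (ct : nat)
  | Replicate (ct : nat) (ds : seq version)
  | Heartbeat (t : nat).

(* Observable events; every other step is labelled [Internal].  [Read] and
   [Write] are the operations of the clients, [Assign] is the moment at which
   the coordinator fixes the snapshot timestamp, [Decide] the one at which it
   fixes the commit time, hence the versions created by the transaction. *)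
Inductive label :=
  | Assign (id : txid) (c : client P) (sn : nat)
  | Read (id : txid) (c : client P) (k : key P) (res : option item)
  | Write (id : txid) (c : client P) (k : key P) (v : value P)
  | Decide (id : txid) (c : client P) (ds : seq version)
  | Internal.

(* Coordinator-side record of a transaction; [tx_votes] lists the proposed
   times received so far. *)
Record txrec := TxRec {
  tx_client : client P;
  tx_snap : nat;
  tx_cohorts : seq (server * seq update);
  tx_votes : seq nat
}.

(* Entry of Prepared (with its proposed time) or Committed (with its commit
   time). *)
Record pending := Pending {
  pd_tx : txid;
  pd_ts : nat;
  pd_ups : seq update
}.

(* [clk] is the least admissible next reading of the physical clock, i.e. one
   more than the last reading. *)
Record sstate := SState {
  clk : nat;
  hlc : nat;
  vv : vvector;
  ust : nat;
  prepared : seq pending;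
  committed : seq pending;
  store : seq version;
  coord : txid -> option txrec
}.

(* [Active p id ks]: transaction [id] is open at coordinator [p], and the
   replies to the reads of the keys [ks] are awaited. *)
Inductive phase :=
  | Idle
  | Starting (p : server)
  | Active (p : server) (id : txid) (ks : seq (key P))
  | Committing (p : server) (id : txid).

(* The entries of the write cache are ((key, item), commit timestamp). *)
Record cstate := CState {
  ust_c : nat;
  hwt_c : nat;
  wc : seq (key P * item * nat);
  rs : seq (key P * item);
  ws : seq update;
  ph : phase
}.

(* [reported q] and [gsts m] collect the version vectors that [q] has made known
   inside its data center and the stable times computed in data center [m]; the
   stabilization steps may use any of them, which renders the "possibly old"
   values. *)
Record state := State {
  srv : server -> sstate;
  cli : client P -> cstate;
  net : node -> node -> seq msg;
  reported : server -> seq vvector;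
  gsts : 'I_(ndcs P) -> seq nat
}.

Definition init : state := State
  (fun _ => SState 0 0 [ffun _ => 0] 0 [::] [::] [::] (fun _ => None))
  (fun _ => CState 0 0 [::] [::] [::] Idle)
  (fun _ _ => [::])
  (fun _ => [:: [ffun _ => 0]])
  (fun _ => [:: 0]).

Definition upd (A : eqType) (B : Type) (f : A -> B) (a : A) (b : B) : A -> B :=
  fun x => if x == a then b else f x.

Definition assoc (A : eqType) (B : Type) (a : A) (s : seq (A * B)) : option B :=
  omap snd (ohead [seq e <- s | e.1 == a]).

Definition is_min (s : seq nat) (x : nat) : bool := (x \in s) && all (leq x) s.

Definition set_ust (s : sstate) (u : nat) : sstate :=
  SState (clk s) (hlc s) (vv s) u (prepared s) (committed s) (store s) (coord s).
Definition set_coord (s : sstate) (id : txid) (x : txrec) : sstate :=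
  SState (clk s) (hlc s) (vv s) (ust s) (prepared s) (committed s) (store s)
    (upd (coord s) id (Some x)).
Definition set_clock (s : sstate) (t h : nat) : sstate :=
  SState t h (vv s) (ust s) (prepared s) (committed s) (store s) (coord s).
Definition set_pending (s : sstate) (pr co : seq pending) : sstate :=
  SState (clk s) (hlc s) (vv s) (ust s) pr co (store s) (coord s).
Definition set_vv (s : sstate) (i : 'I_(nreps P)) (t : nat) : sstate :=
  SState (clk s) (hlc s) [ffun j => if j == i then t else vv s j] (ust s)
    (prepared s) (committed s) (store s) (coord s).
Definition install (s : sstate) (ds : seq version) : sstate :=
  SState (clk s) (hlc s) (vv s) (ust s) (prepared s) (committed s)
    (ds ++ store s) (coord s).

(* Freshest version of [k] with timestamp at most [sn]; [None] if there is no
   such version. *)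
Definition freshest (st : seq version) (k : key P) (sn : nat)
    (o : option version) : Prop :=
  let cand d := [&& d \in st, v_key d == k & v_ut d <= sn] in
  if o is Some d then cand d /\ (forall d', cand d' -> version_le d' d)
  else forall d, ~~ cand d.

(* The data center recorded in a version is that of the cohort. *)
Definition versions_of (p : server) (id : txid) (ct : nat) (ups : seq update) :=
  [seq Version kv.1 kv.2 ct id (dc p) | kv <- ups].

Definition peers (p : server) : seq server :=
  [seq (p.1, i) | i <- enum 'I_(nreps P) & i != p.2].

(* Splits a write set among the cohorts, [rc n] being the replica picked for
   partition [n]. *)
Definition cohorts (ups : seq update) (rc : 'I_(nparts P) -> 'I_(nreps P)) :
    seq (server * seq update) :=
  [seq ((n, rc n), [seq kv <- ups | partition kv.1 == n])
     | n <- undup [seq partition kv.1 | kv <- ups]].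

(* [server_recv p fresh s a m l s' out]: on receipt of [m] from node [a], server
   [p] goes from [s] to [s'] and sends the messages [out]; [fresh] holds of the
   transaction ids that are still unused. *)
Inductive server_recv (p : server) (fresh : txid -> Prop) (s : sstate) :
    node -> msg -> label -> sstate -> seq (node * msg) -> Prop :=
  | recv_start (c : client P) (u : nat) (id : txid) :
      fresh id ->
      let sn := maxn (ust s) u in
      server_recv p fresh s (inr c) (StartReq u) (Assign id c sn)
        (set_coord (set_ust s sn) id (TxRec c sn [::] [::]))
        [:: (inr c, StartResp id sn)]
  | recv_read (c : client P) (id : txid) (k : key P) (x : txrec)
        (r : 'I_(nreps P)) :
      coord s id = Some x ->
      server_recv p fresh s (inr c) (ReadReq id k) Internal s
        [:: (inl (partition k, r), SliceReq id k (tx_snap x))]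
  | recv_slice (q : server) (id : txid) (k : key P) (sn : nat)
        (o : option version) :
      freshest (store s) k sn o ->
      server_recv p fresh s (inl q) (SliceReq id k sn) Internal
        (set_ust s (maxn (ust s) sn))
        [:: (inl q, SliceResp id k (omap item_of o))]
  | recv_slice_resp (q : server) (id : txid) (k : key P) (res : option item)
        (x : txrec) :
      coord s id = Some x ->
      server_recv p fresh s (inl q) (SliceResp id k res) Internal s
        [:: (inr (tx_client x), ReadResp id k res)]
  | recv_commit_req (c : client P) (id : txid) (hwt : nat) (ups : seq update)
        (x : txrec) (rc : 'I_(nparts P) -> 'I_(nreps P)) :
      coord s id = Some x ->
      let ht := maxn (tx_snap x) hwt in
      let co := cohorts ups rc in
      server_recv p fresh s (inr c) (CommitReq id hwt ups) Internal
        (set_coord s id (TxRec (tx_client x) (tx_snap x) co [::]))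
        [seq (inl g.1, Prepare id (tx_snap x) ht g.2) | g <- co]
  | recv_prepare (q : server) (id : txid) (sn ht : nat) (ups : seq update)
        (t : nat) :
      clk s <= t ->
      let h := maxn t (maxn ht.+1 (hlc s).+1) in
      let u := maxn (ust s) sn in
      let pt := maxn h u in
      server_recv p fresh s (inl q) (Prepare id sn ht ups) Internal
        (set_pending (set_ust (set_clock s t.+1 h) u)
           (Pending id pt ups :: prepared s) (committed s))
        [:: (inl q, PrepareResp id pt)]
  | recv_vote (q : server) (id : txid) (pt : nat) (x : txrec) :
      coord s id = Some x ->
      (size (tx_votes x)).+1 < size (tx_cohorts x) ->
      server_recv p fresh s (inl q) (PrepareResp id pt) Internal
        (set_coord s id (TxRec (tx_client x) (tx_snap x) (tx_cohorts x)
                           (pt :: tx_votes x)))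
        [::]
  | recv_last_vote (q : server) (id : txid) (pt : nat) (x : txrec) :
      coord s id = Some x ->
      (size (tx_votes x)).+1 = size (tx_cohorts x) ->
      let ct := \max_(t <- pt :: tx_votes x) t in
      server_recv p fresh s (inl q) (PrepareResp id pt)
        (Decide id (tx_client x)
           (flatten [seq versions_of g.1 id ct g.2 | g <- tx_cohorts x]))
        (set_coord s id (TxRec (tx_client x) (tx_snap x) (tx_cohorts x)
                           (pt :: tx_votes x)))
        ([seq (inl g.1, Commit id ct) | g <- tx_cohorts x]
           ++ [:: (inr (tx_client x), CommitResp id ct)])
  | recv_commit (q : server) (id : txid) (ct : nat) (t : nat) :
      clk s <= t ->
      server_recv p fresh s (inl q) (Commit id ct) Internal
        (set_pending (set_clock s t.+1 (maxn (hlc s) (maxn ct t)))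
           [seq e <- prepared s | pd_tx e != id]
           ([seq Pending id ct (pd_ups e) | e <- prepared s & pd_tx e == id]
              ++ committed s))
        [::]
  | recv_replicate (i : 'I_(nreps P)) (ct : nat) (ds : seq version) :
      server_recv p fresh s (inl (p.1, i)) (Replicate ct ds) Internal
        (set_vv (install s ds) i ct) [::]
  | recv_heartbeat (i : 'I_(nreps P)) (t : nat) :
      server_recv p fresh s (inl (p.1, i)) (Heartbeat t) Internal
        (set_vv s i t) [::].

(* [upper_bound s ub s']: the bound [ub] is computed in state [s]; [s'] differs
   from [s] only by the clock reading, if one is needed. *)
Inductive upper_bound (s : sstate) : nat -> sstate -> Prop :=
  | ub_prepared (x : nat) :
      is_min [seq pd_ts e | e <- prepared s] x -> upper_bound s x.-1 s
  | ub_clock (t : nat) :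
      prepared s = [::] -> clk s <= t ->
      upper_bound s (maxn t (hlc s)) (set_clock s t.+1 (hlc s)).

Definition ready_times (s : sstate) (ub : nat) : seq nat :=
  sort leq (undup [seq pd_ts e | e <- committed s & pd_ts e <= ub]).
Definition group (p : server) (s : sstate) (ct : nat) : seq version :=
  flatten [seq versions_of p (pd_tx e) ct (pd_ups e)
             | e <- committed s & pd_ts e == ct].

Inductive server_apply (p : server) (s : sstate) :
    sstate -> seq (node * msg) -> Prop :=
  | apply_committed (ub : nat) (s1 : sstate) :
      upper_bound s ub s1 -> committed s <> [::] ->
      let cts := ready_times s ub in
      server_apply p s
        (set_vv
           (set_pending (install s1 (flatten [seq group p s ct | ct <- cts]))
              (prepared s) [seq e <- committed s | ub < pd_ts e])
           p.2 ub)
        [seq (inl q, Replicate ct (group p s ct)) | ct <- cts, q <- peers p]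
  | apply_heartbeat (ub : nat) (s1 : sstate) :
      upper_bound s ub s1 -> committed s = [::] ->
      server_apply p s (set_vv s1 p.2 ub)
        [seq (inl q, Heartbeat ub) | q <- peers p].

Definition lookup (s : cstate) (id : txid) (k : key P) : option item :=
  if assoc k (ws s) is Some v then Some (v, id)
  else if assoc k (rs s) is Some x then Some x
  else assoc k [seq e.1 | e <- wc s].

(* A client may start a new transaction after an unfinished one only if it is
   not waiting for a reply. *)
Definition quiescent (f : phase) : bool :=
  match f with Idle => true | Active _ _ ks => nilp ks | _ => false end.

(* A read of several keys is rendered as [client_read_local] steps for the keys
   found locally and one [client_read_remote] step for all the other ones. *)
Inductive client_act (c : client P) (s : cstate) :
    label -> cstate -> seq (node * msg) -> Prop :=
  | client_start (p : server) :
      quiescent (ph s) -> dc p = home c ->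
      client_act c s Internal
        (CState (ust_c s) (hwt_c s) (wc s) (rs s) (ws s) (Starting p))
        [:: (inl p, StartReq (ust_c s))]
  | client_read_local (p : server) (id : txid) (k : key P) (x : item) :
      ph s = Active p id [::] -> lookup s id k = Some x ->
      client_act c s (Read id c k (Some x))
        (CState (ust_c s) (hwt_c s) (wc s) ((k, x) :: rs s) (ws s) (ph s))
        [::]
  | client_read_remote (p : server) (id : txid) (ks : seq (key P)) :
      ph s = Active p id [::] -> uniq ks ->
      (forall k, k \in ks -> lookup s id k = None) ->
      client_act c s Internal
        (CState (ust_c s) (hwt_c s) (wc s) (rs s) (ws s) (Active p id ks))
        [seq (inl p, ReadReq id k) | k <- ks]
  | client_write (p : server) (id : txid) (k : key P) (v : value P) :
      ph s = Active p id [::] ->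
      client_act c s (Write id c k v)
        (CState (ust_c s) (hwt_c s) (wc s) (rs s)
           ((k, v) :: [seq e <- ws s | e.1 != k]) (ph s))
        [::]
  | client_commit (p : server) (id : txid) :
      ph s = Active p id [::] -> ws s <> [::] ->
      client_act c s Internal
        (CState (ust_c s) (hwt_c s) (wc s) (rs s) (ws s) (Committing p id))
        [:: (inl p, CommitReq id (hwt_c s) (ws s))].

Inductive client_recv (c : client P) (s : cstate) :
    node -> msg -> label -> cstate -> Prop :=
  | client_started (p : server) (id : txid) (sn : nat) :
      ph s = Starting p ->
      client_recv c s (inl p) (StartResp id sn) Internal
        (CState sn (hwt_c s) [seq e <- wc s | sn < e.2] [::] [::]
           (Active p id [::]))
  | client_read_done (p : server) (id : txid) (ks : seq (key P)) (k : key P)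
        (res : option item) :
      ph s = Active p id ks -> k \in ks ->
      client_recv c s (inl p) (ReadResp id k res) (Read id c k res)
        (CState (ust_c s) (hwt_c s) (wc s)
           (if res is Some x then (k, x) :: rs s else rs s) (ws s)
           (Active p id (rem k ks)))
  | client_committed (p : server) (id : txid) (ct : nat) :
      ph s = Committing p id ->
      client_recv c s (inl p) (CommitResp id ct) Internal
        (CState (ust_c s) ct
           ([seq (kv.1, (kv.2, id), ct) | kv <- ws s]
              ++ [seq e <- wc s | e.1.1 \notin [seq kv.1 | kv <- ws s]])
           (rs s) [::] Idle).

Definition channels := node -> node -> seq msg.

Definition set_chan (w : channels) (a b : node) (ms : seq msg) : channels :=
  upd w a (upd (w a) b ms).
Definition send (a : node) (out : seq (node * msg)) (w : channels) : channels :=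
  foldl (fun w' bm => set_chan w' a bm.1 (rcons (w' a bm.1) bm.2)) w out.

Definition unused (s : state) (id : txid) : Prop :=
  forall q, coord (srv s q) id = None.

Inductive step (s : state) : label -> state -> Prop :=
  | step_idle : step s Internal s
  | step_server_recv (p : server) (a : node) (m : msg) (ms : seq msg)
        (l : label) (s' : sstate) (out : seq (node * msg)) :
      net s a (inl p) = m :: ms ->
      server_recv p (unused s) (srv s p) a m l s' out ->
      step s l
        (State (upd (srv s) p s') (cli s)
           (send (inl p) out (set_chan (net s) a (inl p) ms))
           (reported s) (gsts s))
  | step_server_apply (p : server) (s' : sstate) (out : seq (node * msg)) :
      server_apply p (srv s p) s' out ->
      step s Internal
        (State (upd (srv s) p s') (cli s) (send (inl p) out (net s))
           (reported s) (gsts s))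
  | step_client_act (c : client P) (l : label) (s' : cstate)
        (out : seq (node * msg)) :
      client_act c (cli s c) l s' out ->
      step s l
        (State (srv s) (upd (cli s) c s') (send (inr c) out (net s))
           (reported s) (gsts s))
  | step_client_recv (c : client P) (a : node) (m : msg) (ms : seq msg)
        (l : label) (s' : cstate) :
      net s a (inr c) = m :: ms ->
      client_recv c (cli s c) a m l s' ->
      step s l
        (State (srv s) (upd (cli s) c s') (set_chan (net s) a (inr c) ms)
           (reported s) (gsts s))
  | step_report (p : server) :
      step s Internal
        (State (srv s) (cli s) (net s)
           (upd (reported s) p (vv (srv s p) :: reported s p)) (gsts s))
  | step_gst (m : 'I_(ndcs P)) (w : server -> vvector) (g : nat) :
      (forall q, dc q = m -> w q \in reported s q) ->
      is_min [seq w q r | q <- [seq q <- enum [set: server] | dc q == m],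
                          r <- enum 'I_(nreps P)] g ->
      step s Internal
        (State (srv s) (cli s) (net s) (reported s)
           (upd (gsts s) m (g :: gsts s m)))
  | step_ust (p : server) (g : 'I_(ndcs P) -> nat) (u : nat) :
      (forall m, g m \in gsts s m) ->
      is_min [seq g m | m <- enum 'I_(ndcs P)] u ->
      step s Internal
        (State (upd (srv s) p (set_ust (srv s p) (maxn (ust (srv s p)) u)))
           (cli s) (net s) (reported s) (gsts s)).

(* Idle steps make finite executions a special case of infinite ones.  The event
   labelled [lb i] leads from state [st i] to state [st i.+1]. *)
Record execution := Execution {
  st : nat -> state;
  lb : nat -> label;
  st_init : st 0 = init;
  st_step : forall i, step (st i) (lb i) (st i.+1)
}.

Section Causality.
Context (e : execution).

(* An operation is represented by the index of its event. *)
Definition op_of (i : nat) (c : client P) : Prop :=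
  (exists id k res, lb e i = Read id c k res) \/
  (exists id k v, lb e i = Write id c k v).

Definition writes_key (i : nat) (id : txid) (k : key P) : Prop :=
  exists c v, lb e i = Write id c k v.

(* A transaction may write a key several times: a read returns the last of these
   writes that precedes it. *)
Definition reads_from (i j : nat) : Prop :=
  exists id c k v id' c',
    [/\ lb e i = Write id c k v, lb e j = Read id' c' k (Some (v, id)), i < j
      & forall l, i < l < j -> ~ writes_key l id k].

Inductive leadsto : nat -> nat -> Prop :=
  | leadsto_thread i j c : op_of i c -> op_of j c -> i < j -> leadsto i j
  | leadsto_read i j : reads_from i j -> leadsto i j
  | leadsto_trans i l j : leadsto i l -> leadsto l j -> leadsto i j.

(* At step [i], a transaction of client [c] commits and creates [d]. *)
Definition created_at (i : nat) (c : client P) (d : version) : Prop :=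
  exists id ds, lb e i = Decide id c ds /\ d \in ds.

(* Event [i] is the write of version [d]: the last write of the transaction to
   the key, the earlier ones being overwritten in the write set. *)
Definition write_of (d : version) (i : nat) : Prop :=
  (exists c, lb e i = Write (v_tx d) c (v_key d) (v_val d)) /\
  forall l, i < l -> ~ writes_key l (v_tx d) (v_key d).

Definition is_version (d : version) : Prop := exists i c, created_at i c d.

Definition depends (X Y : version) : Prop :=
  [/\ is_version X, is_version Y, v_tx X <> v_tx Y
    & exists i j, [/\ write_of X i, write_of Y j & leadsto i j]].

(* The snapshot visible to the transaction of client [c] whose snapshot timestamp
   [sn] is assigned by event [t0], when the reads from partition [n] are served
   by its [rep n]-th replica at time [tm n]. *)
Definition snapshot (c : client P) (sn t0 : nat)
    (rep : 'I_(nparts P) -> 'I_(nreps P)) (tm : 'I_(nparts P) -> nat)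
    (d : version) : Prop :=
  let n := partition (v_key d) in
  (v_ut d <= sn /\ d \in store (srv (st e (tm n)) (n, rep n))) \/
  (sn < v_ut d /\ exists2 i, i < t0 & created_at i c d).

Definition visible (S : version -> Prop) (X : version) : Prop :=
  S X /\ forall d, S d -> v_key d = v_key X -> version_le d X.

Definition causally_consistent (S : version -> Prop) : Prop :=
  (forall X Y, S Y -> depends X Y -> S X) /\
  (forall X Y, visible S X -> visible S Y -> depends X Y ->
     ~ exists X', [/\ v_key X' = v_key X, X' <> X, depends X X'
                    & depends X' Y]).

End Causality.
End Versions.

(* Main.v *)
(* A timestamp [u] is stable in a state if every replica of every partition has
   installed all versions with timestamp at most [u], and no such version can be
   created any more.  Snapshot times are stable: a server's own version vector
   entry stays below all its pending proposals and below those to come, channels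
   are FIFO, and the universal stable time is at most every entry of every version
   vector.  Hence a snapshot contains all versions up to its timestamp.

   Along a causal path from the write of a version [X], every operation either
   belongs to the client that wrote [X] or to a transaction whose snapshot time is
   at least the timestamp of [X]: a version read from another client comes from the
   stable snapshot, and commit times exceed both the snapshot time of their
   transaction and the previous commit time of their client.  So timestamps
   increase strictly along dependencies; and when a version of the client's own
   cache depends on one newer than the snapshot time, the latter is an earlier
   write of the same client. *)
From Stdlib Require List.
From mathcomp Require Import all_boot zify.
Require Import Defs.

Set Implicit Arguments.
Unset Strict Implicit.
Unset Printing Implicit Defensive.

(** The difficulty lies in what is in transit. Whether a proposal, a decision or a replicated group
    can still appear depends on messages under way, so many invariants are balance equations: for
    each transaction, the messages of each kind on a channel add up, with the phase of the client
    and the record of the coordinator, to a fixed amount. That two messages cannot coexist is then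
    linear arithmetic. A version counts as existing from the moment its commit time is fixed, when
    no cohort knows that time yet. At that moment every cohort still holds the transaction in
    Prepared, above its own version vector entry; this turns the local bound on proposals into a
    bound on all versions to come. Two features of the protocol shape the statements. A proposal can
    be lifted to the stable time of a server without lifting its hybrid clock, so [hlc] bounds the
    own entry only conditionally. And a client can read its own buffered write or abandon a
    transaction, so an item that is read may belong to no version at all, and an abandoned
    transaction has to be shown never to commit. *)

Local Notation In := List.In.

(** * Membership and counting in lists without decidable equality *)

Lemma In_cat (A : Type) (x : A) s1 s2 : In x (s1 ++ s2) <-> In x s1 \/ In x s2.
Proof. elim: s1 => [|y s1 IH] /=; [tauto | rewrite IH; tauto]. Qed.

Lemma In_map (A B : Type) (f : A -> B) y s :
  In y (map f s) <-> exists2 x, In x s & f x = y.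
Proof.
elim: s => [|x s IH] /=; first by split => // -[].
rewrite IH; split.
  by case=> [<-|[z sz <-]]; [exists x; [left|] | exists z; [right|]].
by case=> z [<- <-|sz <-]; [left | right; exists z].
Qed.

Lemma In_filter (A : Type) (a : pred A) x s :
  In x (filter a s) <-> In x s /\ a x.
Proof.
elim: s => [|y s IH] /=; first by tauto.
case: ifP => ay /=; rewrite IH; split; try tauto.
- by case=> [<-|]; tauto.
- by case=> -[<-|]; [rewrite ay | tauto].
Qed.

Lemma In_mem (T : eqType) (x : T) s : In x s <-> x \in s.
Proof.
elim: s => [|y s IH] //=; rewrite inE IH; split.
  by case=> [->|->]; rewrite ?eqxx ?orbT.
by case/orP => [/eqP->|->]; [left | right].
Qed.

Lemma In_flatten (A : Type) (x : A) ss :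
  In x (flatten ss) <-> exists2 s, In s ss & In x s.
Proof.
elim: ss => [|s ss IH] /=; first by split => // -[].
rewrite In_cat IH; split.
  by case=> [sx|[t st tx]]; [exists s; [left|] | exists t; [right|]].
by case=> t [<-|st] tx; [left | right; exists t].
Qed.

Lemma In_count (A : Type) (a : pred A) x s : In x s -> a x -> 0 < count a s.
Proof.
elim: s => [|y s IH] //= [-> ->|/IH h /h]; first by rewrite add1n.
by move=> ?; rewrite ltn_addl.
Qed.

Lemma count_In (A : Type) (a : pred A) s : 0 < count a s -> exists2 x, In x s & a x.
Proof.
elim: s => [|y s IH] //=; case ay: (a y) => /=; first by exists y; [left|].
by move/IH=> [x]; exists x; [right|].
Qed.

Ltac destruct_all :=
  repeat match goal with
  | H : exists _, _ |- _ => destruct H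
  | H : exists2 _, _ & _ |- _ => destruct H
  | H : _ /\ _ |- _ => destruct H
  | H : and3 _ _ _ |- _ => destruct H
  | H : and4 _ _ _ _ |- _ => destruct H
  | H : and5 _ _ _ _ _ |- _ => destruct H
  end.

Section Model.
Context (P : system).

Notation server := (server P).
Notation client := (client P).
Notation node := (node P).
Notation msg := (msg P).
Notation state := (state P).
Notation sstate := (sstate P).
Notation cstate := (cstate P).
Notation channels := (channels P).
Notation pending := (pending P).
Notation txrec := (txrec P).

(** * Channels and events *)

Lemma eq_inl (p q : server) : ((inl p : node) == inl q) = (p == q).
Proof. by apply/eqP/eqP => [[]|->]. Qed.
Lemma eq_inr (c d : client) : ((inr c : node) == inr d) = (c == d).
Proof. by apply/eqP/eqP => [[]|->]. Qed.
Lemma eq_inlr (p : server) (c : client) : ((inl p : node) == inr c) = false.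
Proof. by apply/eqP. Qed.
Lemma eq_inrl (p : server) (c : client) : ((inr c : node) == inl p) = false.
Proof. by apply/eqP. Qed.
Definition eq_node := (eq_inl, eq_inr, eq_inlr, eq_inrl).

Lemma sendE (a : node) out (w : channels) x y :
  send a out w x y =
  w x y ++ (if x == a then [seq bm.2 | bm <- out & bm.1 == y] else [::]).
Proof.
rewrite /send; elim: out w => [|[b m] out IH] w /=; first by case: ifP; rewrite cats0.
rewrite IH /set_chan /upd; case: eqP => [->|_] //=.
rewrite eq_sym; case: eqP => [->|_] //=.
by rewrite cat_rcons.
Qed.

(** Receipts and spontaneous events are treated alike: [r] is the message consumed from the head of
    a channel into [n], if there is one. *)
Definition net_effect (n : node) (r : option (node * msg)) (out : seq (node * msg))
    (w w' : channels) : Prop :=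
  if r is Some (a, m) then
    exists2 ms, w a n = m :: ms & w' = send n out (set_chan w a n ms)
  else w' = send n out w.

Definition cnt (f : pred msg) (y : node) (out : seq (node * msg)) :=
  count (fun bm => (y == bm.1) && f bm.2) out.

(** The consumed message is added on the left, so that no truncated subtraction occurs and [lia] can
    combine these equations with the invariants. *)
Lemma net_count f n r out w w' x y :
  net_effect n r out w w' ->
  count f (w' x y) +
    (if r is Some (a, m) then [&& x == a, y == n & f m] else false) =
  count f (w x y) + (x == n) * cnt f y out.
Proof.
have E : count f (if x == n then [seq bm.2 | bm <- out & bm.1 == y] else [::]) =
    (x == n) * cnt f y out.
  case: ifP => _ //=; rewrite count_map count_filter mul1n /cnt.
  by apply: eq_count => bm /=; rewrite andbC eq_sym.
case: r => [[a m]|] /=; last by move=> ->; rewrite sendE count_cat E addn0.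
case=> ms wan ->; rewrite sendE count_cat E /set_chan /upd.
case: eqP => [->|_] //=; last by rewrite addn0.
by case: eqP => [->|_] //=; [rewrite wan /=; lia | rewrite addn0].
Qed.

Lemma net_in n r out w w' x y m :
  net_effect n r out w w' -> In m (w' x y) -> In m (w x y) \/ x = n /\ In (y, m) out.
Proof.
have E : In m (if x == n then [seq bm.2 | bm <- out & bm.1 == y] else [::]) ->
    x = n /\ In (y, m) out.
  case: eqP => // -> /In_map [[b m'] /In_filter [] /= h /eqP <- <-] //.
case: r => [[a m']|] /=; last by move=> ->; rewrite sendE In_cat => -[|/E]; tauto.
case=> ms wan ->; rewrite sendE In_cat => -[|/E]; last tauto.
rewrite /set_chan /upd; case: eqP => [->|_]; last tauto.
by case: eqP => [->|_]; [rewrite wan /=; tauto | tauto].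
Qed.

Lemma net_in_old n r out w w' x y m :
  net_effect n r out w w' -> In m (w x y) ->
  In m (w' x y) \/ r = Some (x, m) /\ y = n.
Proof.
case: r => [[a m']|] /=; last by move=> ->; rewrite sendE In_cat; tauto.
case=> ms wan ->; rewrite sendE In_cat.
rewrite /set_chan /upd; case: eqP => [->|_]; last tauto.
case: eqP => [->|_]; last tauto.
rewrite wan /=; case=> [->|]; tauto.
Qed.

Lemma net_in_new n r out w w' y m :
  net_effect n r out w w' -> In (y, m) out -> In m (w' n y).
Proof.
move=> ne hm; have E : In m [seq bm.2 | bm <- out & bm.1 == y].
  by apply/In_map; exists (y, m) => //; apply/In_filter => /=.
case: r ne => [[a m']|] /=; last by move=> ->; rewrite sendE In_cat eqxx; right.
by case=> ms wan ->; rewrite sendE In_cat eqxx; right.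
Qed.

Lemma net_in_head n a m out w w' :
  net_effect n (Some (a, m)) out w w' -> In m (w a n).
Proof. by case=> ms -> _; left. Qed.

Global Arguments net_effect : simpl never.
Global Arguments cnt : simpl never.

Inductive server_event (p : server) (fresh : txid -> Prop) (s : sstate) :
    option (node * msg) -> label P -> sstate -> seq (node * msg) -> Prop :=
  | event_recv a m l s' out :
      server_recv p fresh s a m l s' out ->
      server_event p fresh s (Some (a, m)) l s' out
  | event_apply s' out :
      server_apply p s s' out -> server_event p fresh s None (Internal P) s' out.

Inductive client_event (c : client) (s : cstate) :
    option (node * msg) -> label P -> cstate -> seq (node * msg) -> Prop :=
  | event_act l s' out :
      client_act c s l s' out -> client_event c s None l s' out
  | event_crecv a m l s' :
      client_recv c s a m l s' -> client_event c s (Some (a, m)) l s' [::].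

(* The idle and stabilization steps are merged: as far as servers, clients and
   channels are concerned, they can only raise [ust]. *)
Inductive cstep (s : state) : label P -> state -> Prop :=
  | cstep_server p r l s1 out w :
      server_event p (unused s) (srv s p) r l s1 out ->
      net_effect (inl p) r out (net s) w ->
      cstep s l (State (upd (srv s) p s1) (cli s) w (reported s) (gsts s))
  | cstep_client c r l s1 out w :
      client_event c (cli s c) r l s1 out ->
      net_effect (inr c) r out (net s) w ->
      cstep s l (State (srv s) (upd (cli s) c s1) w (reported s) (gsts s))
  | cstep_stab sv rp gs :
      (forall p, exists2 u, ust (srv s p) <= u & sv p = set_ust (srv s p) u) ->
      cstep s (Internal P) (State sv (cli s) (net s) rp gs).

Lemma set_ust_id (s : sstate) : s = set_ust s (ust s).
Proof. by case: s. Qed.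

Lemma stepW s l s' : step s l s' -> cstep s l s'.
Proof.
have E p : exists2 u, ust (srv s p) <= u & srv s p = set_ust (srv s p) u.
  by exists (ust (srv s p)) => //; apply: set_ust_id.
case.
- by case: s E => *; constructor.
- move=> p a m ms l' s1 out wa h.
  by apply: cstep_server; [apply: (event_recv h) | exists ms].
- by move=> p s1 out h; apply: cstep_server; [apply: (event_apply _ h)|].
- by move=> c l' s1 out h; apply: cstep_client; [apply: (event_act h)|].
- move=> c a m ms l' s1 wa h.
  by apply: cstep_client; [apply: (event_crecv h) | exists ms].
- by move=> p; constructor.
- by move=> m w g _ _; constructor.
- move=> p g u _ _; constructor=> q; rewrite /upd; case: eqP => [->|_] //.
  by exists (maxn (ust (srv s p)) u); rewrite ?leq_maxl.
Qed.

(** * Coordinators and owners of transactions *)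

(** The client and the snapshot time are the two fields of a coordinator's record that never change;
    cohorts and votes do. Hence this part of the record persists. *)
Definition own (s : state) (p : server) (id : txid) (c : client) (sn : nat) : Prop :=
  omap (fun x => (tx_client x, tx_snap x)) (coord (srv s p) id) = Some (c, sn).

Lemma ownP s p id c sn :
  own s p id c sn <->
  exists x, [/\ coord (srv s p) id = Some x, tx_client x = c & tx_snap x = sn].
Proof.
rewrite /own; case: (coord _ _) => [x|] /=; last by split => // -[? []].
by split=> [[<- <-]|[? [[->] -> ->]]] //; exists x.
Qed.

Lemma own_inj s p id c sn c' sn' :
  own s p id c sn -> own s p id c' sn' -> c = c' /\ sn = sn'.
Proof. by rewrite /own => -> []. Qed.

Lemma coord_apply p (s s' : sstate) out :
  server_apply p s s' out -> coord s' = coord s.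
Proof. by case=> ub s1 [] * /=. Qed.

Lemma own_mono s l s' p id c sn : cstep s l s' -> own s p id c sn -> own s' p id c sn.
Proof.
case=> [q r l0 s1 out w ev _||sv rp gs h] //=; last first.
  by rewrite /own /=; case: (h p) => u _ ->.
rewrite /own /= /upd; case: eqP => [->|//].
case: ev => [a m l1 s2 out1 []|s2 out1 /coord_apply -> //] //=; rewrite /upd.
- move=> c0 u id0 fr; case: eqP => [->|//]; by rewrite fr.
- by move=> c0 id0 h0 ups x rc hc; case: eqP => [->|//]; rewrite hc.
- by move=> q0 id0 pt x hc _; case: eqP => [->|//]; rewrite hc.
- by move=> q0 id0 pt x hc _; case: eqP => [->|//]; rewrite hc.
Qed.

(* What a message says of the transaction it belongs to; [O p id c sn] stands for
   "[id] is a transaction of [c] with snapshot time [sn], coordinated by [p]". *)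
Definition msg_owner (O : server -> txid -> client -> nat -> Prop)
    (a b : node) (m : msg) : Prop :=
  match m with
  | StartReq _ => exists c p, a = inr c /\ b = inl p
  | StartResp id sn => exists p c, [/\ a = inl p, b = inr c & O p id c sn]
  | SliceReq id _ sn => exists p c, a = inl p /\ O p id c sn
  | SliceResp id _ _ => exists p c sn, b = inl p /\ O p id c sn
  | ReadResp id _ _ => exists p c sn, [/\ a = inl p, b = inr c & O p id c sn]
  | CommitReq id _ ups =>
      exists c p sn, [/\ a = inr c, b = inl p, O p id c sn & ups <> [::]]
  | Prepare id sn ht _ =>
      exists p g c, [/\ a = inl p, b = inl g, O p id c sn & sn <= ht]
  | PrepareResp id pt =>
      exists g p c sn, [/\ a = inl g, b = inl p, O p id c sn & sn < pt]
  | Commit id _ => exists p g c sn, [/\ a = inl p, b = inl g & O p id c sn]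
  | CommitResp id _ => exists p c sn, [/\ a = inl p, b = inr c & O p id c sn]
  | _ => True
  end.

Lemma msg_owner_mono (O O' : server -> txid -> client -> nat -> Prop) a b m :
  (forall p id c sn, O p id c sn -> O' p id c sn) ->
  msg_owner O a b m -> msg_owner O' a b m.
Proof.
move=> h; case: m => //= *; destruct_all; repeat eexists; eauto.
Qed.

Definition phase_owner (s : state) (c : client) : Prop :=
  match ph (cli s c) with
  | Active p id _ | Committing p id => own s p id c (ust_c (cli s c))
  | _ => True
  end.

Definition coord_ok (x : txrec) : Prop :=
  [/\ forall v, v \in tx_votes x -> tx_snap x < v,
      uniq (map fst (tx_cohorts x)),
      size (tx_votes x) <= size (tx_cohorts x)
    & forall g ups kv, (g, ups) \in tx_cohorts x -> kv \in ups ->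
        partition kv.1 = g.1].

(** A new id is unknown to the coordinators of all servers, whence [own_uniq]. Together with
    [own_msg] it lets the id in a message determine the coordinator, the client and the snapshot
    time. *)
Record owner_inv (s : state) : Prop := OwnerInv {
  own_uniq : forall p q id c sn c' sn',
    own s p id c sn -> own s q id c' sn' -> p = q;
  own_msg : forall a b m, In m (net s a b) -> msg_owner (own s) a b m;
  own_phase : forall c, phase_owner s c;
  own_coord : forall p id x, coord (srv s p) id = Some x -> coord_ok x }.

Lemma cohorts_uniq (ups : seq (update P)) rc : uniq (map fst (cohorts ups rc)).
Proof.
rewrite /cohorts -map_comp map_inj_uniq ?undup_uniq //.
by move=> n n' [].
Qed.

Lemma cohorts_nil (ups : seq (update P)) rc : cohorts ups rc = [::] -> ups = [::].
Proof.
case: ups => [|kv ups] // E.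
have: partition kv.1 \in undup [seq partition kv.1 | kv <- kv :: ups].
  by rewrite mem_undup /= mem_head.
by move: E; rewrite /cohorts; case: (undup _).
Qed.

Lemma owner_init : owner_inv (init P).
Proof. by split. Qed.

Lemma owner_step s l s' : cstep s l s' -> owner_inv s -> owner_inv s'.
Proof.
move=> st I; have M p id c sn := @own_mono s l s' p id c sn st.
split.
- case: st M I => [p0 r l0 s1 out w ev _ _||] /=; last first.
  + move=> sv rp gs h M I p q id c sn c' sn'; rewrite /own /=.
    case: (h p) => u _ ->; case: (h q) => v _ -> /= h1 h2; exact: (own_uniq I h1 h2).
  + by move=> c r l0 s1 out w _ _ _ I; apply: own_uniq I.
  move=> I.
  (* A record after the step continues an old one or has a fresh id at [p0]. Freshness concerns all
     servers, so the two cases cannot occur for the same id. *)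
  have K q c sn id : own (State (upd (srv s) p0 s1) (cli s) w (reported s) (gsts s)) q id c sn ->
      (exists c sn, own s q id c sn) \/ (q = p0 /\ unused s id).
    rewrite /own /= /upd; case: eqP => [->|_]; last by left; exists c, sn.
    case: ev => [a m l1 s2 out1 []|s2 out1 /coord_apply -> ]; 
      try (by left; exists c, sn); rewrite /= /upd.
    * by move=> c0 u id0 fr; case: eqP => [->|_]; [right | left; exists c, sn].
    * move=> c0 id0 h0 ups x rc hc; case: eqP => [->|_] h1; last by left; exists c, sn.
      by left; exists (tx_client x), (tx_snap x); rewrite hc.
    * move=> q0 id0 pt x hc _; case: eqP => [->|_] h1; last by left; exists c, sn.
      by left; exists (tx_client x), (tx_snap x); rewrite hc.
    * move=> q0 id0 pt x hc _; case: eqP => [->|_] h1; last by left; exists c, sn.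
      by left; exists (tx_client x), (tx_snap x); rewrite hc.
  move=> p q id c sn c' sn' /K [[c1 [sn1 h]]|[-> u]] /K [[c2 [sn2 h']]|[-> u']] //.
  + exact: (own_uniq I h h').
  + by move: h; rewrite /own u'.
  + by move: h'; rewrite /own u.
- move=> a b m.
  have N n r out w : net_effect n r out (net s) w ->
      (forall b m, In (b, m) out -> msg_owner (own s') n b m) ->
      In m (w a b) -> msg_owner (own s') a b m.
    move=> ne h /(net_in ne) [/(own_msg I)|[-> /h //]]; exact: msg_owner_mono M.
  case: st M N => [p0 r l0 s1 out w ev ne M N|c r l0 s1 out w ev ne M N|] /=; last first.
  + by move=> sv rp gs h M _ /(own_msg I); exact: msg_owner_mono M.
  + apply: (N _ _ _ _ ne) => {a b m N} b m.
    have := own_phase I c; rewrite /phase_owner.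
    case: ev => [l1 s2 out1 []|a m0 l1 s2 []] //=.
    * by move=> p _ _ _ [] // [<- <-]; exists c, p.
    * by move=> p id ks -> _ _ o /In_map [k _ [<- <-]].
    * by move=> p id -> ws0 o [] // [<- <-]; exists c, p, (ust_c (cli s c)).
  apply: (N _ _ _ _ ne) => {a b m N} b m.
  case: ev ne M => [a m0 l1 s2 out1 []|s2 out1 []] //=.
  + move=> c u id fr ne M [] // [<- <-]; exists p0, c; split=> //.
    by rewrite /own /= /upd eqxx /= /upd eqxx.
  + move=> c id k x r0 hx ne M [] // [<- <-]; exists p0, (tx_client x).
    by split=> //; apply: M; rewrite /own hx.
  + move=> q id k sn o hf ne M [] // [<- <-].
    have /= [p [c [[->] o1]]] := own_msg I (net_in_head ne).
    by exists p, c, sn; split=> //; apply: M.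
  + move=> q id k res x hx ne M [] // [<- <-]; exists p0, (tx_client x), (tx_snap x).
    by split=> //; apply: M; rewrite /own hx.
  + move=> c id h0 ups x rc hx ne M /In_map [g _ [<- <-]] /=.
    exists p0, g.1, (tx_client x); split => //; last exact: leq_maxl.
    by apply: M; rewrite /own hx.
  + move=> q id sn ht ups t ct ne M [] // [<- <-] /=.
    have /= [p [g [c [[->] [_] o1 le]]]] := own_msg I (net_in_head ne).
    (* [sn <= ht < ht.+1 <= pt]: the reason why every vote exceeds the snapshot time. *)
    exists p0, p, c, sn; split => //; [exact: M | lia].
  + move=> q id pt x hx hs ne M /In_cat [/In_map[g _ [<- <-]]|[] // [<- <-]] /=.
      exists p0, g.1, (tx_client x), (tx_snap x).
      by split=> //; apply: M; rewrite /own hx.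
    exists p0, (tx_client x), (tx_snap x).
    by split=> //; apply: M; rewrite /own hx.
  + by move=> ub s3 _ _ ne M /In_flatten [o /In_map [ct _ <-] /In_map [g _ [<- <-]]].
  + by move=> ub s3 _ _ ne M /In_map [g _ [<- <-]].
- move=> c; have := own_phase I c; rewrite /phase_owner.
  case: st M => [p0 r l0 s1 out w ev ne M|c0 r l0 s1 out w ev ne M|] /=; last first.
  + by move=> sv rp gs h M; case: ph => // *; apply: M.
  + rewrite /upd; case: eqP => [->|_] //.
    case: ev ne M => [l1 s2 out1 []|a m0 l1 s2 []] //=.
    * by move=> p id ks -> _ _.
    * by move=> p id ->.
    * move=> p id sn hp ne M _.
      by have /= [q [c1 [[<-] [<-] o]]] := own_msg I (net_in_head ne).
    * by move=> p id ks k res -> _.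
  by case: ph => // *; apply: M.
- move=> p id x.
  case: st M => [p0 r l0 s1 out w ev ne M|c0 r l0 s1 out w ev ne M|] /=; last first.
  + by move=> sv rp gs h M; case: (h p) => u _ -> /=; exact: (own_coord I).
  + exact: (own_coord I).
  rewrite /upd; case: eqP => [_|_]; last exact: (own_coord I).
  case: ev ne M => [a m0 l1 s2 out1 []|s2 out1 /coord_apply ->] //=;
    try (by move=> *; eapply (own_coord I); eassumption); rewrite /upd.
  + by move=> c u id0 fr ne M; case: (id =P id0) => [_ [<-]|_]; [| exact: (own_coord I)].
  + move=> c id0 h ups y rc hy ne M; case: (id =P id0) => [_ [<-]|_]; last exact: (own_coord I).
    split=> //; first exact: cohorts_uniq.
    by move=> g us kv /mapP [n _ [-> ->]]; rewrite mem_filter => /andP [/eqP].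
  + move=> q id0 pt y hy hs ne M; case: (id =P id0) => [_ [<-]|_]; last exact: (own_coord I).
    have [h1 h2 h3 h4] := own_coord I hy; split=> //=; last exact: ltnW.
    have /= [g [q1 [c [sn [_ [<-] /ownP [z [hz _ <-]] le]]]]] := own_msg I (net_in_head ne).
    by move=> v; rewrite inE => /orP [/eqP ->|/h1 //]; move: hz le; rewrite hy => -[->].
  + move=> q id0 pt y hy hs ne M; case: (id =P id0) => [_ [<-]|_]; last exact: (own_coord I).
    have [h1 h2 h3 h4] := own_coord I hy; split=> //=; last by rewrite hs.
    have /= [g [q1 [c [sn [_ [<-] /ownP [z [hz _ <-]] le]]]]] := own_msg I (net_in_head ne).
    by move=> v; rewrite inE => /orP [/eqP ->|/h1 //]; move: hz le; rewrite hy => -[->].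
Qed.

(** * Counting messages *)

Lemma cnt_nil (f : pred msg) (y : node) : cnt f y [::] = 0.
Proof. by []. Qed.

Lemma cnt_cons (f : pred msg) (y b : node) m out :
  cnt f y ((b, m) :: out) = ((y == b) && f m) + cnt f y out.
Proof. by []. Qed.

Lemma cnt_cat (f : pred msg) (y : node) out out' :
  cnt f y (out ++ out') = cnt f y out + cnt f y out'.
Proof. exact: count_cat. Qed.

Lemma In_cnt (f : pred msg) (y : node) m out : In (y, m) out -> f m -> 0 < cnt f y out.
Proof. by move=> h fm; apply: (In_count h); rewrite /= eqxx. Qed.

Lemma cnt_out0 (f : pred msg) (y : node) out :
  (forall bm, In bm out -> f bm.2 = false) -> cnt f y out = 0.
Proof.
rewrite /cnt; elim: out => [|bm out IH] //= h; rewrite h; last by left.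
by rewrite andbF IH // => bm' ?; apply: h; right.
Qed.

Definition apply_msg (m : msg) : bool :=
  match m with Replicate _ _ | Heartbeat _ => true | _ => false end.

Lemma apply_out p (s s' : sstate) out bm :
  server_apply p s s' out -> In bm out -> apply_msg bm.2.
Proof.
case=> ub s1 _ _; first by move=> cts /In_flatten [o /In_map [ct _ <-] /In_map [g _ <-]].
by move=> /In_map [g _ <-].
Qed.

Lemma cnt_apply p (s s' : sstate) out (f : pred msg) (y : node) :
  server_apply p s s' out -> (forall m, apply_msg m -> f m = false) ->
  cnt f y out = 0.
Proof. by move=> h hf; apply: cnt_out0 => bm /(apply_out h)/hf. Qed.

Lemma cnt_map0 (T : Type) (b : node) (h : T -> msg) (f : pred msg) (y : node) s :
  (forall x, f (h x) = false) -> cnt f y [seq (b, h x) | x <- s] = 0.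
Proof. by move=> hf; apply: cnt_out0 => bm /In_map [x _ <-]; apply: hf. Qed.

(** A multiplicity instead of a membership test, so that it can stand in one equation with message
    counts. *)
Definition copies (U : Type) (g : server) (co : seq (server * U)) : nat :=
  count (fun x => g == x.1) co.

Lemma copies_nil (U : Type) g : copies g (@nil (server * U)) = 0.
Proof. by []. Qed.

Lemma copies_mem (U : eqType) g (co : seq (server * U)) :
  uniq (map fst co) -> copies g co = (g \in map fst co).
Proof.
move=> u; rewrite -(count_uniq_mem g u) /copies count_map.
by apply: eq_count => x /=; rewrite eq_sym.
Qed.

Lemma cnt_bcast (U : Type) (co : seq (server * U)) (f : pred msg)
    (h : server * U -> msg) (y : node) (b : bool) :
  (forall g, f (h g) = b) ->
  cnt f y [seq (inl g.1, h g) | g <- co] = b * (if y is inl g then copies g co else 0).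
Proof.
move=> hb; rewrite /cnt count_map; case: y => [g|c].
  case: b hb => hb; rewrite ?mul1n ?mul0n.
    by apply: eq_count => x /=; rewrite eq_inl hb andbT.
  by rewrite -[RHS](count_pred0 co); apply: eq_count => x /=; rewrite hb andbF.
by rewrite muln0 -[RHS](count_pred0 co); apply: eq_count => x /=.
Qed.

(** Evaluates the counts on the output of a handler and resolves which channels it touches; what
    remains is linear arithmetic. *)
Ltac node_counts :=
  intros;
  repeat match goal with
  | H : context [cnt _ _ (_ :: _)] |- _ => rewrite cnt_cons /= in H
  | H : context [cnt _ _ (_ ++ _)] |- _ => rewrite cnt_cat in H
  | H : context [cnt _ _ [::]] |- _ => rewrite cnt_nil in H
  | H : context [cnt _ _ (map _ (tx_cohorts _))] |- _ =>
      erewrite cnt_bcast in H by (intro; simpl; reflexivity)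
  | H : context [cnt _ _ (map _ (cohorts _ _))] |- _ =>
      erewrite cnt_bcast in H by (intro; simpl; reflexivity)
  | H : context [cnt _ _ (map _ _)] |- _ =>
      rewrite cnt_map0 in H; [|by []]
  | H : context [cnt _ _ _], A : server_apply _ _ _ _ |- _ =>
      rewrite (cnt_apply _ A) in H; [|by case]
  end;
  repeat match goal with
  | H : context [@eq_op _ ?x ?x] |- _ => rewrite (eqxx x) in H
  | H : context [@eq_op _ (inl _) _] |- _ => progress rewrite /= ?eq_node in H
  | H : context [@eq_op _ (inr _) _] |- _ => progress rewrite /= ?eq_node in H
  end.
Ltac counts := node_counts; try lia.

(** * Starting transactions *)

Definition is_start_req (m : msg) : bool :=
  if m is StartReq _ then true else false.
Definition is_start_resp (m : msg) : bool :=
  if m is StartResp _ _ then true else false.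
Definition starting (f : phase P) (p : server) : bool :=
  if f is Starting q then p == q else false.

(** By [start_count] a request and a reply never coexist, and each exists only while the client
    waits. So [ust_c] does not change between the two, which keeps the value in the request current
    and the value in the reply an upper bound. *)
Record start_inv (s : state) : Prop := StartInv {
  start_count : forall c p,
    count is_start_req (net s (inr c) (inl p)) +
    count is_start_resp (net s (inl p) (inr c)) = starting (ph (cli s c)) p;
  start_req : forall c p u,
    In (StartReq P u) (net s (inr c) (inl p)) -> u = ust_c (cli s c);
  start_resp : forall c p id sn,
    In (StartResp P id sn) (net s (inl p) (inr c)) -> ust_c (cli s c) <= sn }.

Lemma start_init : start_inv (init P).
Proof. by split. Qed.

Lemma start_step s l s' :
  cstep s l s' -> owner_inv s -> start_inv s -> start_inv s'.
Proof.
move=> st O I; split.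
- move=> c p; have C := start_count I c p.
  case: st => [p0 r l0 s1 out w ev ne|c0 r l0 s1 out w ev ne|] //=.
  + move: (net_count is_start_req (inr c) (inl p) ne).
    move: (net_count is_start_resp (inl p) (inr c) ne).
    by case: ev => [a m l1 s2 out1 []|s2 out1 ha] /=; counts.
  + move: (net_count is_start_req (inr c) (inl p) ne).
    move: (net_count is_start_resp (inl p) (inr c) ne).
    rewrite /upd; case: (c =P c0) C => [->|/eqP/negPf n] C.
    * case: ev => [l1 s2 out1 []|a m l1 s2 []] /=; counts;
        try (rewrite e /= in C; lia).
      by move: C i; case: (ph _) => //=; lia.
    * by case: ev => [l1 s2 out1 []|a m l1 s2 []] /=; counts.
- move=> c p u.
  have C := start_count I c p.
  case: st => [p0 r l0 s1 out w ev ne|c0 r l0 s1 out w ev ne|] //=; last first.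
  + by move=> _ _ _ _; apply: start_req.
  + rewrite /upd; case: (c =P c0) => [e0|n].
    * move/(net_in ne) => [h|[_ h]].
        (* [ust_c] changes only on receipt of a start reply, which would have to be in transit
           beside the request. *)
        move: (start_req I h) (In_count (a:=is_start_req) h isT); rewrite e0.
        move: C; rewrite e0.
        case: ev ne => [l1 s2 out1 []|a m l1 s2 []] //= p1 id sn hp ne.
        rewrite hp /=.
        have := In_count (a:=is_start_resp) (net_in_head ne) isT.
        by case: eqP => [->|_]; lia.
      case: ev h => [l1 s2 out1 []|a m l1 s2 []] //=.
      - by move=> p1 _ _ [] // [].
      - by move=> p1 id ks _ _ _ /In_map [].
      - by move=> p1 id _ _ [].
    * by move/(net_in ne) => [h|[[]//]]; apply: (start_req I h).
  + by move/(net_in ne) => [h|[]//]; apply: (start_req I h).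
- move=> c p id sn.
  have C := start_count I c p.
  case: st => [p0 r l0 s1 out w ev ne|c0 r l0 s1 out w ev ne|] //=; last first.
  + by move=> _ _ _ _; apply: start_resp.
  + move=> hw; have cw := In_count (a := is_start_resp) hw isT.
    move: hw => /(net_in ne) [h|[]//].
    rewrite /upd; case: (c =P c0) => [e0|n]; last exact: start_resp h.
    move: (start_resp I h) cw C; rewrite e0.
    move: (net_count is_start_resp (inl p) (inr c0) ne).
    case: ev ne => [l1 s2 out1 []|a m l1 s2 []] //= p1 id1 sn1 hp ne; rewrite hp /=.
    by counts.
  + move/(net_in ne) => [h|[[e0] h]]; first exact: start_resp h.
    have k := In_cnt (f := is_start_resp) h isT; move: k h.
    case: ev ne => [a m l1 s2 out1 []|s2 out1 ha] //=; try by counts.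
    move=> c1 u id1 fr ne _ [] // [<- _ <-].
    rewrite (start_req I (net_in_head ne)); exact: leq_maxr.
Qed.

Lemma ust_c_mono s l s' c :
  cstep s l s' -> start_inv s -> ust_c (cli s c) <= ust_c (cli s' c).
Proof.
move=> st I; case: st => [p0 r l0 s1 out w ev ne|c0 r l0 s1 out w ev ne|] //=.
rewrite /upd; case: (c =P c0) => [->|//].
case: ev ne => [l1 s2 out1 []|a m l1 s2 []] //= p1 id1 sn1 hp ne.
exact: start_resp (net_in_head ne).
Qed.

(** * The commit protocol *)

Definition is_commit_req id (m : msg) : bool :=
  if m is CommitReq i _ _ then id == i else false.
Definition is_commit_resp id (m : msg) : bool :=
  if m is CommitResp i _ then id == i else false.
Definition is_prepare id (m : msg) : bool :=
  if m is Prepare i _ _ _ then id == i else false.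
Definition is_prepare_resp id (m : msg) : bool :=
  if m is PrepareResp i _ then id == i else false.
Definition is_commit id (m : msg) : bool :=
  if m is Commit i _ then id == i else false.

(** A record without cohorts, before any commit request has been handled, is neither [undecided] nor
    [decided]. *)
Definition undecided (x : txrec) : bool := size (tx_votes x) < size (tx_cohorts x).
Definition decided (x : txrec) : bool :=
  (0 < size (tx_cohorts x)) && (size (tx_votes x) == size (tx_cohorts x)).
Definition ctime (x : txrec) : nat := \max_(t <- tx_votes x) t.

Definition committing (f : phase P) (p : server) (id : txid) : bool :=
  if f is Committing q i then (p == q) && (id == i) else false.

(** In [commit_count] a single token travels from the request through the voting to the reply, and
    exists exactly while the client waits. In [vote_count] the list [L] restores the voter of each
    vote, which the record forgets: for each cohort the prepare message is in transit, or its vote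
    is, or the vote has been counted. *)
Record commit_inv (s : state) : Prop := CommitInv {
  commit_count : forall p id x, coord (srv s p) id = Some x ->
    count (is_commit_req id) (net s (inr (tx_client x)) (inl p)) + undecided x +
    count (is_commit_resp id) (net s (inl p) (inr (tx_client x))) =
    committing (ph (cli s (tx_client x))) p id;
  commit_req : forall p id x c h ups, coord (srv s p) id = Some x ->
    In (CommitReq id h ups) (net s (inr c) (inl p)) -> tx_cohorts x = [::];
  active_tx : forall p id x c ks, coord (srv s p) id = Some x ->
    ph (cli s c) = Active p id ks -> tx_cohorts x = [::];
  start_resp_tx : forall p id x a c sn, coord (srv s p) id = Some x ->
    In (StartResp P id sn) (net s a (inr c)) -> tx_cohorts x = [::];
  commit_resp : forall p id x a c ct, coord (srv s p) id = Some x ->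
    In (CommitResp P id ct) (net s a (inr c)) -> decided x /\ ct = ctime x;
  vote_count : forall p id x, coord (srv s p) id = Some x ->
    exists2 L : seq (server * nat), tx_votes x = map snd L &
    forall g, count (is_prepare id) (net s (inl p) (inl g)) +
      count (is_prepare_resp id) (net s (inl g) (inl p)) + copies g L =
      copies g (tx_cohorts x) }.

Lemma commit_init : commit_inv (init P).
Proof. by split. Qed.

Definition msg_tx (m : msg) : option txid :=
  match m with
  | StartResp id _ | CommitReq id _ _ | Prepare id _ _ _ | PrepareResp id _
  | Commit id _ | CommitResp id _ => Some id
  | _ => None
  end.

Lemma unused_msg s id m a b :
  owner_inv s -> unused s id -> In m (net s a b) -> msg_tx m <> Some id.
Proof.
move=> O u /(own_msg O); case: m => //= *; destruct_all; move=> [e]; subst;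
  match goal with H : own _ _ _ _ _ |- _ => by move: H; rewrite /own u end.
Qed.

Lemma unused_count s id (f : pred msg) a b :
  owner_inv s -> unused s id -> (forall m, f m -> msg_tx m = Some id) ->
  count f (net s a b) = 0.
Proof.
move=> O u hf; apply/eqP; rewrite -leqn0 leqNgt; apply/negP => /count_In [m h fm].
exact: (unused_msg O u h (hf _ fm)).
Qed.

Lemma committing_own s p id c :
  owner_inv s -> committing (ph (cli s c)) p id -> own s p id c (ust_c (cli s c)).
Proof.
move=> O; have := own_phase O c; rewrite /phase_owner.
by case: (ph _) => //= q j o /andP [/eqP -> /eqP ->].
Qed.

Lemma unused_own (s : state) p id c sn : unused s id -> own s p id c sn -> False.
Proof. by rewrite /own => ->. Qed.

Lemma unused_committing s p id c :
  owner_inv s -> unused s id -> committing (ph (cli s c)) p id = false.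
Proof. by move=> O u; apply/negP => /(committing_own O)/(unused_own u). Qed.

Lemma commit_count_step s l s' : cstep s l s' ->
  owner_inv s -> start_inv s -> commit_inv s ->
  forall p id x, coord (srv s' p) id = Some x ->
    count (is_commit_req id) (net s' (inr (tx_client x)) (inl p)) + undecided x +
    count (is_commit_resp id) (net s' (inl p) (inr (tx_client x))) =
    committing (ph (cli s' (tx_client x))) p id.
Proof.
move=> st O S I p id x.
have C := @commit_count s I p id.
case: st => [p0 r l0 s1 out w ev ne|c0 r l0 s1 out w ev ne|sv rp gs h] /=; last first.
- by case: (h p) => u _ ->; apply: C.
- move=> hx; move: (C _ hx) => {}C.
  move: (net_count (is_commit_req id) (inr (tx_client x)) (inl p) ne).
  move: (net_count (is_commit_resp id) (inl p) (inr (tx_client x)) ne).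
  rewrite /upd; case: (_ =P c0) => [e|/eqP/negPf n].
  + move: (own_phase O c0) C; rewrite /phase_owner e.
    case: ev ne => [l1 s2 out1 []|a m l1 s2 []] /=; counts;
      try (match goal with E : ph _ = _ |- _ => rewrite E /= in C end; lia).
    * by move: i C; case: (ph _) => //= *; lia.
  + case: ev ne => [l1 s2 out1 []|a m l1 s2 []] /=; counts.
- rewrite /upd; case: (p =P p0) => [e|/eqP/negPf n] hx.
  + move: (net_count (is_commit_req id) (inr (tx_client x)) (inl p) ne).
    move: (net_count (is_commit_resp id) (inl p) (inr (tx_client x)) ne).
    move: hx C; rewrite e => hx C; move: hx.
    case: ev ne => [a m l1 s2 out1 []|s2 out1 ha] /=; rewrite /upd;
      try (intros; match goal with h : coord _ id = Some x |- _ => move: (C _ h) => {}C end;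
           counts; fail).
    * move=> c u id0 fr ne; case: (id =P id0) => [-> [<-]|n hx] /=; last first.
        by move: (C _ hx) => {}C; counts.
      have f1 := unused_count (f := is_commit_req id0) (inr c) (inl p0) O fr.
      have f2 := unused_count (f := is_commit_resp id0) (inl p0) (inr c) O fr.
      rewrite (unused_committing _ _ O fr).
      have {}f1 : count (is_commit_req id0) (net s (inr c) (inl p0)) = 0.
        by apply: f1; case=> //= ? ? ? /eqP ->.
      have {}f2 : count (is_commit_resp id0) (net s (inl p0) (inr c)) = 0.
        by apply: f2; case=> //= ? ? /eqP ->.
      by counts.
    * move=> c id0 h ups y rc hy ne; case: (id =P id0) => [-> [<-]|n hx] /=; last first.
        by move: (C _ hx) => {}C; counts.
      have /= [c1 [p1 [sn [[ec] [ep] o ups0]]]] := own_msg O (net_in_head ne).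
      have [y' [hy' ecl _]] := (ownP _ _ _ _ _).1 o.
      move: (commit_count I hy) (In_count (a := is_commit_req id0) (net_in_head ne)).
      move: hy'; rewrite -ep hy => -[ey]; rewrite ec -ecl ey /= eqxx => k /(_ isT).
      (* The consumed request hands its token to the voting: the write set is nonempty, so there is
         a cohort and the new record is undecided. *)
      have z : 0 < size (cohorts ups rc).
        by rewrite lt0n size_eq0; apply/eqP => /cohorts_nil.
      have u : undecided (TxRec (tx_client y) (tx_snap y) (cohorts ups rc) [::]) = true by [].
      rewrite -ey u.
      by move=> k'; move: k k'; rewrite -ey => k k'; counts.
    * move=> q id0 pt y hy hs ne; case: (id =P id0) => [-> [<-]|n hx] /=; last first.
        by move: (C _ hx) => {}C; counts.
      by move: (commit_count I hy); rewrite /undecided /=; counts.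
    * move=> q id0 pt y hy hs ne; case: (id =P id0) => [-> [<-]|n hx] /=; last first.
        by move: (C _ hx) => {}C; counts.
      by move: (commit_count I hy); rewrite /undecided /= hs ltnn; counts.
    * move=> ne; rewrite (coord_apply ha) => hx; move: (C _ hx) => {}C.
      by counts.
  + move: (net_count (is_commit_req id) (inr (tx_client x)) (inl p) ne).
    move: (net_count (is_commit_resp id) (inl p) (inr (tx_client x)) ne).
    move: (C _ hx) => {}C.
    case: ev ne => [a m l1 s2 out1 []|s2 out1 ha] /=; counts.
Qed.
(** How a record can have come about in one step. Case analysis on this replaces the one over all
    handlers in the proofs below. *)
Inductive tx_change (s : state) p id (x : txrec) : Prop :=
  | tx_same : coord (srv s p) id = Some x -> tx_change s p id x
  | tx_new c sn : unused s id -> x = TxRec c sn [::] [::] -> tx_change s p id x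
  | tx_request y h ups rc :
      coord (srv s p) id = Some y ->
      In (CommitReq id h ups) (net s (inr (tx_client y)) (inl p)) ->
      0 < size (cohorts ups rc) ->
      x = TxRec (tx_client y) (tx_snap y) (cohorts ups rc) [::] ->
      tx_change s p id x
  | tx_vote q y pt :
      coord (srv s p) id = Some y -> undecided y ->
      In (PrepareResp P id pt) (net s (inl q) (inl p)) ->
      x = TxRec (tx_client y) (tx_snap y) (tx_cohorts y) (pt :: tx_votes y) ->
      tx_change s p id x.

Lemma tx_step s l s' p id x :
  cstep s l s' -> owner_inv s -> coord (srv s' p) id = Some x -> tx_change s p id x.
Proof.
move=> st O.
case: st => [p0 r l0 s1 out w ev ne|c0 r l0 s1 out w ev ne|sv rp gs h] /=; last first.
- by case: (h p) => u _ -> /=; apply: tx_same.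
- exact: tx_same.
rewrite /upd; case: (p =P p0) => [->|_]; last exact: tx_same.
case: ev ne => [a m l1 s2 out1 []|s2 out1 /coord_apply ->] /=;
  try (by intros; apply: tx_same); rewrite /upd.
- move=> c u id0 fr ne; case: (id =P id0) => [-> [<-]|_]; last exact: tx_same.
  exact: (tx_new _ fr).
- move=> c id0 h ups y rc hy ne; case: (id =P id0) => [-> [<-]|_]; last exact: tx_same.
  have hi := net_in_head ne.
  have /= [c1 [p1 [sn [[ec] [ep] o ups0]]]] := own_msg O hi.
  have [y' [hy' ecl _]] := (ownP _ _ _ _ _).1 o.
  move: hy'; rewrite -ep hy => -[ey].
  apply: (tx_request hy) => //; first by rewrite ey ecl -ec; exact: hi.
  by rewrite lt0n size_eq0; apply/eqP => /cohorts_nil.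
- move=> q id0 pt y hy hs ne; case: (id =P id0) => [-> [<-]|_]; last exact: tx_same.
  by apply: (tx_vote hy _ (net_in_head ne)) => //; rewrite /undecided ltnW.
- move=> q id0 pt y hy hs ne; case: (id =P id0) => [-> [<-]|_]; last exact: tx_same.
  by apply: (tx_vote hy _ (net_in_head ne)) => //; rewrite /undecided -hs.
Qed.

Lemma coord_own (s : state) p id x :
  coord (srv s p) id = Some x -> own s p id (tx_client x) (tx_snap x).
Proof. by rewrite /own => ->. Qed.

Lemma owner_client (s : state) p q id c sn x :
  owner_inv s -> own s p id c sn -> coord (srv s q) id = Some x ->
  [/\ p = q, c = tx_client x & sn = tx_snap x].
Proof.
move=> O o /coord_own h; have e := own_uniq O o h; subst.
by have [-> ->] := own_inj o h.
Qed.

Lemma undecided_nil (x : txrec) : tx_cohorts x = [::] -> undecided x = false.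
Proof. by rewrite /undecided => ->. Qed.

Lemma commit_req_committing s p id x h ups :
  commit_inv s -> coord (srv s p) id = Some x ->
  In (CommitReq id h ups) (net s (inr (tx_client x)) (inl p)) ->
  committing (ph (cli s (tx_client x))) p id.
Proof.
move=> I hx hm; move: (commit_count I hx) (In_count (a := is_commit_req id) hm).
by rewrite /= eqxx => h1 /(_ isT); case: committing h1 => //; lia.
Qed.

Lemma commit_req_step s l s' : cstep s l s' ->
  owner_inv s -> owner_inv s' -> start_inv s -> commit_inv s ->
  forall p id x c h ups, coord (srv s' p) id = Some x ->
    In (CommitReq id h ups) (net s' (inr c) (inl p)) -> tx_cohorts x = [::].
Proof.
move=> st O O' S I p id x c h ups hx hm.
have /= [c1 [p1 [sn [[ec] [ep] o _]]]] := own_msg O' hm; subst c1 p1.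
have [_ ec _] := owner_client O' o hx.
have C := commit_count_step st O S I hx.
have hc := In_count (a := is_commit_req id) hm.
(* The request in transit already holds the token of [commit_count], so no voting is under way. *)
have {hc} und : undecided x = false.
  by move: hc C; rewrite /= eqxx ec => /(_ isT); case: committing; case: undecided; lia.
have old : In (CommitReq id h ups) (net s (inr c) (inl p)) -> tx_cohorts x = [::].
  move=> hm0; case: (tx_step st O hx) => [|c1 sn1 u _|y h1 ups1 rc hy _ z e|q y pt hy u _ _].
  + by move=> hx0; apply: (commit_req I hx0 hm0).
  + by case: (unused_msg O u hm0).
  + by move: und; rewrite e /undecided /= z.
  + by move: u; rewrite (undecided_nil (commit_req I hy hm0)).
case: st hx hm old O' {o C} => [p0 r l0 s1 out w ev ne|c0 r l0 s1 out w ev ne|sv rp gs hh] /=; last first.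
- by move=> _ hm /(_ hm).
- move=> hx /(net_in ne) [hm /(_ hm) //|[[e0] hm] _ O'].
  case: ev hm ne => [l1 s2 out1 []|a m l1 s2 []] //=.
  + by move=> p1 _ _ [].
  + by move=> p1 id1 ks _ _ _ /In_map [].
  + move=> p1 id1 hp _ [] // [e1 e2 _ _] _; subst p1 id1; exact: (active_tx I hx hp).
- by move=> hx /(net_in ne) [hm /(_ hm) //|[]].
Qed.

(** An active client does not wait for a commit, so by [commit_count] no commit request is in
    transit from which the record could receive cohorts. *)
Lemma active_tx_step s l s' : cstep s l s' ->
  owner_inv s -> start_inv s -> commit_inv s ->
  forall p id x c ks, coord (srv s' p) id = Some x ->
    ph (cli s' c) = Active p id ks -> tx_cohorts x = [::].
Proof.
move=> st O S I p id x c ks hx.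
have old ks' : ph (cli s c) = Active p id ks' -> tx_cohorts x = [::].
  move=> hp; have := own_phase O c; rewrite /phase_owner hp => o.
  case: (tx_step st O hx) => [|c1 sn1 u _|y h1 ups1 rc hy hm z e|q y pt hy u _ _].
  + by move=> hx0; apply: (active_tx I hx0 hp).
  + by case: (unused_own u o).
  + have [_ ec _] := owner_client O o hy.
    by move: (commit_req_committing I hy hm); rewrite -ec hp.
  + by move: u; rewrite (undecided_nil (active_tx I hy hp)).
case: st hx old => [p0 r l0 s1 out w ev ne|c0 r l0 s1 out w ev ne|sv rp gs hh] /=; last first.
- by move=> _ old /old.
- rewrite /upd; case: (c =P c0) => [->|_]; last by move=> _ old /old.
  case: ev ne => [l1 s2 out1 []|a m l1 s2 []] //=;
    try (by intros; match goal with h : forall ks', _ -> tx_cohorts x = _ |- _ => apply: h; eassumption end).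
  + by move=> p1 id1 ks1 hp _ _ _ hx old [e1 e2 _]; subst p1 id1; apply: old hp.
  + move=> p1 id1 sn hp ne hx _ [e1 e2 _]; subst p1 id1.
    exact: (start_resp_tx I hx (net_in_head ne)).
  + by move=> p1 id1 ks1 k res hp _ _ hx old [e1 e2 _]; subst p1 id1; apply: old hp.
- by move=> _ old /old.
Qed.

Lemma start_resp_tx_step s l s' : cstep s l s' ->
  owner_inv s -> owner_inv s' -> start_inv s -> commit_inv s ->
  forall p id x a c sn, coord (srv s' p) id = Some x ->
    In (StartResp P id sn) (net s' a (inr c)) -> tx_cohorts x = [::].
Proof.
move=> st O O' S I p id x a c sn hx hm.
have old : In (StartResp P id sn) (net s a (inr c)) -> tx_cohorts x = [::].
  move=> hm0; case: (tx_step st O hx) => [|c1 sn1 u _|y h1 ups1 rc hy hm1 z e|q y pt hy u _ _].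
  + by move=> hx0; apply: (start_resp_tx I hx0 hm0).
  + by case: (unused_msg O u hm0).
  + have /= [p1 [c1 [ea [ec] o]]] := own_msg O hm0; subst a c1.
    have [ep ec _] := owner_client O o hy; subst p1.
    (* With a start reply in transit the client is in phase [Starting], which excludes
       [Committing]. *)
    move: (commit_req_committing I hy hm1) (start_count S c p).
    move: (In_count (a := is_start_resp) hm0 isT); rewrite -ec.
    by case: (ph _) => //=; lia.
  + by move: u; rewrite (undecided_nil (start_resp_tx I hy hm0)).
have new : unused s id -> tx_cohorts x = [::].
  move=> u; case: (tx_step st O hx) => [|c1 sn1 _ -> //|y h1 ups1 rc|q y pt]; by rewrite u.
case: st hx hm old new {O'} => [p0 r l0 s1 out w ev ne|c0 r l0 s1 out w ev ne|sv rp gs hh] /=; last first.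
- by move=> _ hm /(_ hm).
- move=> hx /(net_in ne) [hm /(_ hm) //|[_ hm] _ _].
  case: ev hm ne => [l1 s2 out1 []|a0 m l1 s2 []] //=.
  + by move=> p1 _ _ [].
  + by move=> p1 id1 ks _ _ _ /In_map [].
  + by move=> p1 id1 hp _ [].
- move=> hx /(net_in ne) [hm /(_ hm) //|[_ hm] _ new].
  have k := In_cnt (f := is_start_resp) hm isT; move: k hm.
  case: ev ne => [a0 m l1 s2 out1 []|s2 out1 ha] //=; try by counts.
  by move=> c1 u id1 fr ne _ [] // [_ e _]; apply: new; rewrite -e.
Qed.

Lemma commit_resp_step s l s' : cstep s l s' ->
  owner_inv s -> owner_inv s' -> start_inv s -> commit_inv s ->
  forall p id x a c ct, coord (srv s' p) id = Some x ->
    In (CommitResp P id ct) (net s' a (inr c)) -> decided x /\ ct = ctime x.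
Proof.
move=> st O O' S I p id x a c ct hx hm.
have old : In (CommitResp P id ct) (net s a (inr c)) -> decided x /\ ct = ctime x.
  move=> hm0; case: (tx_step st O hx) => [|c1 sn1 u _|y h1 ups1 rc hy hm1 z e|q y pt hy u _ _].
  + by move=> hx0; apply: (commit_resp I hx0 hm0).
  + by case: (unused_msg O u hm0).
  + by have [] := commit_resp I hy hm0; rewrite /decided (commit_req I hy hm1).
  + have [] := commit_resp I hy hm0; move: u; rewrite /decided /undecided; lia.
case: st hx hm old O' => [p0 r l0 s1 out w ev ne|c0 r l0 s1 out w ev ne|sv rp gs hh] /=; last first.
- by move=> _ hm /(_ hm).
- move=> hx /(net_in ne) [hm /(_ hm) //|[_ hm] _ _].
  case: ev hm ne => [l1 s2 out1 []|a0 m l1 s2 []] //=.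
  + by move=> p1 _ _ [].
  + by move=> p1 id1 ks _ _ _ /In_map [].
  + by move=> p1 id1 hp _ [].
- move=> hx /(net_in ne) [hm /(_ hm) //|[_ hm] _ O'].
  have k := In_cnt (f := is_commit_resp id) hm (eqxx id); move: k hm.
  case: ev ne hx O' => [a0 m l1 s2 out1 []|s2 out1 ha] //=; try by counts.
  move=> q id1 pt y hy hs ne hx O' _ /In_cat [/In_map []//|[] // [_ ei <-]]; subst id1.
  have h2 : coord (upd (srv s) p0 (set_coord (srv s p0) id (TxRec (tx_client y) (tx_snap y)
      (tx_cohorts y) (pt :: tx_votes y))) p0) id =
      Some (TxRec (tx_client y) (tx_snap y) (tx_cohorts y) (pt :: tx_votes y)).
    by rewrite /upd eqxx /= /upd eqxx.
  have o2 := coord_own (s := State (upd (srv s) p0 _) _ _ _ _) h2.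
  have [e _ _] := owner_client O' (o2 _ _ _ _) hx; subst p0.
  move: hx; rewrite h2 => -[<-].
  by rewrite /decided /ctime /= -hs eqxx.
Qed.
Lemma vote_count_step s l s' : cstep s l s' ->
  owner_inv s -> commit_inv s ->
  forall p id x, coord (srv s' p) id = Some x ->
    exists2 L : seq (server * nat), tx_votes x = map snd L &
    forall g, count (is_prepare id) (net s' (inl p) (inl g)) +
      count (is_prepare_resp id) (net s' (inl g) (inl p)) + copies g L =
      copies g (tx_cohorts x).
Proof.
move=> st O I p id x.
case: st => [p0 r l0 s1 out w ev ne|c0 r l0 s1 out w ev ne|sv rp gs h] /=; last first.
- by case: (h p) => u _ ->; apply: vote_count.
- move=> hx; have [L eL hL] := vote_count I hx.
  exists L => // g; move: (hL g).
  move: (net_count (is_prepare id) (inl p) (inl g) ne).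
  move: (net_count (is_prepare_resp id) (inl g) (inl p) ne).
  by case: ev ne => [l1 s2 out1 []|a m l1 s2 []] /=; counts.
(* For steps that leave the record of [id] alone. A cohort that handles a prepare message trades it
   for a vote, so the sum in [K] is preserved there too. *)
have same (K : forall g,
    count (is_prepare id) (w (inl p) (inl g)) +
    count (is_prepare_resp id) (w (inl g) (inl p)) =
    count (is_prepare id) (net s (inl p) (inl g)) +
    count (is_prepare_resp id) (net s (inl g) (inl p))) :
    coord (srv s p) id = Some x ->
    exists2 L : seq (server * nat), tx_votes x = map snd L &
    forall g, count (is_prepare id) (w (inl p) (inl g)) +
      count (is_prepare_resp id) (w (inl g) (inl p)) + copies g L =
      copies g (tx_cohorts x).
  move=> hx; have [L eL hL] := vote_count I hx.
  by exists L => // g; rewrite K; apply: hL.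
have A g := net_count (is_prepare id) (inl p) (inl g) ne.
have B g := net_count (is_prepare_resp id) (inl g) (inl p) ne.
rewrite /upd; case: (p =P p0) => [e|/eqP/negPf n] hx; last first.
  apply: same hx => g; move: (A g) (B g) => {A B}.
  by case: ev ne => [a m l1 s2 out1 []|s2 out1 ha] /=; counts.
case: ev ne A B same hx => [a m l1 s2 out1 []|s2 out1 ha] /=; rewrite /upd;
  try (intros; match goal with
       | S : _ -> coord _ _ = Some x -> _, h : coord _ _ = Some x |- _ =>
           apply: S; [| by rewrite e; exact h] end;
       let g := fresh in move=> g;
       match goal with A : forall g, _, B : forall g, _, S : _ -> _ |- _ => move: (A g) (B g) => {A B S} end;
       counts; fail).
- move=> c u id0 fr ne A B same; case: (id =P id0) => [ei [<-]|/eqP/negPf n] /=; last first.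
    by rewrite -e; apply: same => g; move: (A g) (B g) => {A B}; counts.
  exists [::] => // g; subst id0; move: (A g) (B g).
  rewrite (unused_count (f := is_prepare id) _ _ O fr); last by case=> //= ? ? ? ? /eqP ->.
  rewrite (unused_count (f := is_prepare_resp id) _ _ O fr); last by case=> //= ? ? /eqP ->.
  by move=> {A B same} /=; counts.
- move=> c id0 h ups y rc hy ne A B same; case: (id =P id0) => [ei [<-]|/eqP/negPf n] /=; last first.
    by rewrite -e; apply: same => g; move: (A g) (B g) => {A B}; counts.
  exists [::] => // g; subst id0 p0; move: (A g) (B g).
  have c0 := commit_req I hy (net_in_head ne).
  have [L eL /(_ g)] := vote_count I hy; rewrite c0 !copies_nil.
  by move=> {A B same eL} ?; counts.
- move=> q id0 pt y hy hs ne A B same; case: (id =P id0) => [ei [<-]|/eqP/negPf n] /=; last first.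
    by rewrite -e; apply: same => g; move: (A g) (B g) => {A B}; counts.
  subst id0 p0; have [L eL hL] := vote_count I hy.
  exists ((q, pt) :: L); first by rewrite /= eL.
  by move=> g; move: (A g) (B g) (hL g) => {A B same hL} /=; rewrite /copies /=; counts.
- move=> q id0 pt y hy hs ne A B same; case: (id =P id0) => [ei [<-]|/eqP/negPf n] /=; last first.
    by rewrite -e; apply: same => g; move: (A g) (B g) => {A B}; counts.
  subst id0 p0; have [L eL hL] := vote_count I hy.
  exists ((q, pt) :: L); first by rewrite /= eL.
  by move=> g; move: (A g) (B g) (hL g) => {A B same hL} /=; rewrite /copies /=; counts.
- move=> ne A B same; rewrite (coord_apply ha) => hx.
  by rewrite -e in hx; apply: same hx => g; move: (A g) (B g) => {A B}; counts.
Qed.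

Lemma commit_step s l s' : cstep s l s' ->
  owner_inv s -> owner_inv s' -> start_inv s -> commit_inv s -> commit_inv s'.
Proof.
move=> st O O' S I; split.
- exact: commit_count_step st O S I.
- exact: commit_req_step st O O' S I.
- exact: active_tx_step st O S I.
- exact: start_resp_tx_step st O O' S I.
- exact: commit_resp_step st O O' S I.
- exact: vote_count_step st O I.
Qed.

Lemma copies_uniq (U : eqType) (L : seq (server * U)) :
  (forall g, copies g L <= 1) -> uniq (map fst L).
Proof.
move=> h; apply: count_mem_uniq => g.
have := h g; rewrite -has_pred1 has_count count_map /copies.
rewrite (@eq_count _ (preim _ _) (fun x => g == x.1)); first by case: count => [|[]].
by move=> x /=; rewrite eq_sym.
Qed.

Lemma copies_gt0 (U : eqType) g (L : seq (server * U)) :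
  (0 < copies g L) = (g \in map fst L).
Proof.
rewrite -has_pred1 has_count count_map /copies.
by rewrite (@eq_count _ (preim _ _) (fun x => g == x.1)) // => x /=; rewrite eq_sym.
Qed.

(** Pigeonhole: each cohort occurs at most once in [L], and there are as many votes as cohorts. So
    every cohort has voted, and [vote_count] leaves room for no further message of the vote. *)
Lemma decided_counts s p id x g :
  owner_inv s -> commit_inv s -> coord (srv s p) id = Some x -> decided x ->
  count (is_prepare id) (net s (inl p) (inl g)) = 0 /\
  count (is_prepare_resp id) (net s (inl g) (inl p)) = 0.
Proof.
move=> O I hx /andP [_ /eqP sz]; have [_ uc _ _] := own_coord O hx.
have [L eL hL] := vote_count I hx.
have le g' : copies g' (tx_cohorts x) <= 1 by rewrite copies_mem //; case: (_ \in _).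
have uL : uniq (map fst L) by apply: copies_uniq => g'; apply: leq_trans (le g'); rewrite -hL leq_addl.
have sub : {subset map fst L <= map fst (tx_cohorts x)}.
  by move=> g'; rewrite -!copies_gt0 -hL => h; rewrite addn_gt0 h orbT.
have : map fst L =i map fst (tx_cohorts x).
  by apply: (uniq_min_size uL sub _).2; rewrite !size_map -sz eL size_map.
move=> /(_ g) e; have /eqP := hL g.
rewrite !copies_mem // e -[X in _ == X]add0n eqn_add2r addn_eq0.
by case/andP => /eqP -> /eqP ->.
Qed.

(** * Prepared entries and the messages that create and remove them *)

Definition nprep (s : state) (g : server) id :=
  count (fun e => id == pd_tx e) (prepared (srv s g)).

(** Before the decision each cohort has either the prepare message under way or an entry; from then
    on an entry and the commit message that will remove it exist together or not at all. *)
Record prep_inv (s : state) : Prop := PrepInv {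
  prep_own : forall g e, In e (prepared (srv s g)) ->
    exists p c sn, own s p (pd_tx e) c sn;
  prep_count : forall p id x g, coord (srv s p) id = Some x ->
    if decided x
    then nprep s g id = count (is_commit id) (net s (inl p) (inl g)) /\ nprep s g id <= 1
    else count (is_prepare id) (net s (inl p) (inl g)) + nprep s g id =
           copies g (tx_cohorts x) /\
         count (is_commit id) (net s (inl p) (inl g)) = 0 }.

Lemma prep_init : prep_inv (init P).
Proof. by split. Qed.

Lemma prepared_apply p (s s' : sstate) out :
  server_apply p s s' out -> prepared s' = prepared s.
Proof. by case=> ub s1 [] * /=. Qed.

Lemma count_undecided (x : txrec) : undecided x -> decided x = false.
Proof. by rewrite /undecided /decided; lia. Qed.

Lemma upd_coordP (s : state) p0 s1 p id0 y id x :
  coord (upd (srv s) p0 s1 p) id = Some x ->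
  coord s1 = upd (coord (srv s p0)) id0 (Some y) ->
  [/\ p = p0, id = id0 & x = y] \/
  coord (srv s p) id = Some x /\ (p == p0) && (id == id0) = false.
Proof.
rewrite /upd; case: (p =P p0) => [->|] hx; last by right.
move=> e; move: hx; rewrite e; case: (id =P id0) => [->|]; last by right.
by move=> [->]; left.
Qed.

Lemma prep_step s l s' : cstep s l s' ->
  owner_inv s -> owner_inv s' -> commit_inv s -> commit_inv s' ->
  prep_inv s -> prep_inv s'.
Proof.
move=> st O O' C C' I; split.
  move=> g e.
  have M p id c sn := @own_mono s l s' p id c sn st.
  have old : In e (prepared (srv s g)) -> exists p c sn, own s' p (pd_tx e) c sn.
    by move=> /(prep_own I) [p [c [sn /M o]]]; exists p, c, sn.
  case: st M old {O' C'} => [p0 r l0 s1 out w ev ne|c0 r l0 s1 out w ev ne|sv rp gs h] M //=; last first.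
    by case: (h g) => u _ ->.
  rewrite [upd _ _ _ g]/upd; case: (g =P p0) => [->|//] old.
  case: ev ne M old => [a m l1 s2 out1 []|s2 out1 /prepared_apply ->] //=.
    move=> q id sn ht ups t ct ne M old [<-|] //=.
    have /= [p [g' [c [_ _ o _]]]] := own_msg O (net_in_head ne).
    by exists p, c, sn; apply: M.
  by move=> q id ct t clk ne M old /In_filter [] h _; apply: old.
move=> p id x g hx.
have K : (decided x -> count (is_prepare id) (net s' (inl p) (inl g)) = 0).
  by move=> d; have [] := decided_counts g O' C' hx d.
have U : uniq (map fst (tx_cohorts x)) by have [] := own_coord O' hx.
have {U} : copies g (tx_cohorts x) <= 1 by rewrite copies_mem //; case: (_ \in _).
have Q q c sn : own s q id c sn -> p = q.
  by move=> /(own_mono st) o; have [-> _ _] := owner_client O' o hx.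
case: st hx K Q {O' C'} => [p0 r l0 s1 out w ev ne|c0 r l0 s1 out w ev ne|sv rp gs h] /=; last first.
- rewrite /nprep /=; case: (h p) => u _ ->; case: (h g) => v _ -> /= hx _ _ _.
  exact: prep_count.
- move=> hx _ _ _; have := prep_count I g hx; rewrite /nprep /=.
  move: (net_count (is_prepare id) (inl p) (inl g) ne).
  move: (net_count (is_commit id) (inl p) (inl g) ne).
  by case: decided; case: ev ne => [l1 s2 out1 []|a m l1 s2 []] /=; counts.
move: (net_count (is_prepare id) (inl p) (inl g) ne).
move: (net_count (is_commit id) (inl p) (inl g) ne).
move=> A B hx K Q U.
have hx0 : coord s1 = coord (srv s p0) -> coord (srv s p) id = Some x.
  by move: hx; rewrite /upd; case: eqP => [->|_] // h e; rewrite -e.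
have np f : count (fun e => id == pd_tx e) (prepared s1) =
      f (count (fun e => id == pd_tx e) (prepared (srv s p0))) ->
    count (fun e => id == pd_tx e) (prepared (upd (srv s) p0 s1 g)) =
      if g == p0 then f (nprep s g id) else nprep s g id.
  by rewrite /nprep /upd; case: eqP => [->|].
have np0 : prepared s1 = prepared (srv s p0) ->
    count (fun e => id == pd_tx e) (prepared (upd (srv s) p0 s1 g)) = nprep s g id.
  by rewrite /nprep /upd; case: eqP => [->|//] ->.
rewrite /nprep /=; move: hx hx0 np np0 A B K.
case: ev ne Q U => [a m l1 s2 out1 []|s2 out1 ha] /=;
  try (by intros; match goal with
    | N : (_ = _) -> _ = nprep s g id, H : (_ = _) -> coord (srv s p) id = _ |- _ =>
       rewrite (N erefl); move: (prep_count I g (H erefl));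
       clear N H end; case: decided; counts).
- move=> c u id0 fr ne Q U hx _ _ np A B K; rewrite (np erefl).
  have [[ep ei ex]|[hx' n]] := upd_coordP hx erefl; last first.
    by move: (prep_count I g hx'); case: decided K => K; counts.
  subst p id x; rewrite /=.
  move: A B; rewrite (unused_count (f := is_prepare id0) _ _ O fr);
    last by case=> //= ? ? ? ? /eqP ->.
  rewrite (unused_count (f := is_commit id0) _ _ O fr); last by case=> //= ? ? /eqP ->.
  have -> : nprep s g id0 = 0.
    apply/eqP; rewrite -leqn0 leqNgt; apply/negP => /count_In [e he /eqP e0].
    by have [q [c1 [sn]]] := prep_own I he; rewrite -e0; apply: unused_own fr.
  by clear; counts.
- move=> c id0 h ups y rc hy ne Q U hx _ _ np A B K; rewrite (np erefl).
  have [[ep ei ex]|[hx' n]] := upd_coordP hx erefl; last first.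
    by move: (prep_count I g hx'); case: decided K => K; counts.
  subst p id x; have c0 := commit_req C hy (net_in_head ne).
  move: (prep_count I g hy); rewrite /decided c0 /=.
  have -> : (0 == size (cohorts ups rc)) = false.
    apply/negP; rewrite eq_sym size_eq0 => /eqP /cohorts_nil.
    by have /= [? [? [? []]]] := own_msg O (net_in_head ne).
  by rewrite andbF; move: A B => {np K}; counts.
- move=> q id0 sn ht ups t ct ne Q U _ hx0 np _ A B K.
  have hx := hx0 erefl; rewrite (np (addn (id == id0))) //.
  have K0 : decided x -> count (is_prepare id) (net s (inl p) (inl g)) = 0.
    by move=> d; have [] := decided_counts g O C hx d.
  have e : (id == id0) ==> (p == q).
    case: eqP => //= ei; have /= [p1 [g1 [c [[<-] _ o _]]]] := own_msg O (net_in_head ne).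
    by apply/eqP; apply: (Q _ c sn); rewrite ei.
  by move: (prep_count I g hx); clear np hx0; case: decided K K0 => K K0; case: (boolP (g == p0)) => gp; counts.
- move=> q id0 pt y hy hs ne Q U hx _ _ np A B K; rewrite (np erefl).
  have [[ep ei ex]|[hx' n]] := upd_coordP hx erefl; last first.
    by move: (prep_count I g hx'); case: decided K => K; counts.
  subst p id x; move: (prep_count I g hy); rewrite count_undecided; last by rewrite /undecided; lia.
  by rewrite count_undecided //= {K np}; counts.
- move=> q id0 pt y hy hs ne Q U hx _ _ np A B K; rewrite (np erefl).
  have [[ep ei ex]|[hx' n]] := upd_coordP hx erefl; last first.
    by move: (prep_count I g hx'); case: decided K => K; counts.
  subst p id x; move: (prep_count I g hy); rewrite count_undecided; last by rewrite /undecided; lia.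
  have d : decided (TxRec (tx_client y) (tx_snap y) (tx_cohorts y) (pt :: tx_votes y)).
    by rewrite /decided /= -hs eqxx.
  (* By [K] no prepare message is left, so each cohort holds exactly its entry, and the decision
     sends exactly one commit message to it. *)
  move: (K d) U; rewrite d /= => {}K U {np hx}; by counts.
- move=> q id0 ct t le ne Q U _ hx0 np _ A B K.
  have hx := hx0 erefl; rewrite (np (fun k => (id != id0) * k)); last first.
    rewrite count_filter; case: (id =P id0) => [->|n]; rewrite ?mul0n ?mul1n.
      rewrite -[RHS](count_pred0 (prepared (srv s p0))); apply: eq_count => z /=.
      by rewrite eq_sym andbN.
    apply: eq_count => z /=; case: (id =P _) => //= <-; exact/eqP.
  have e : (id == id0) ==> (p == q).
    case: eqP => //= ei; have /= [p1 [g1 [c [sn [[<-] _ o]]]]] := own_msg O (net_in_head ne).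
    by apply/eqP; apply: (Q _ c sn); rewrite ei.
  by move: (prep_count I g hx); clear np hx0; case: decided K => K; case: (boolP (g == p0)) => gp; counts.
- move=> ne Q U _ hx0 _ np A B K; rewrite (np (prepared_apply ha)).
  move: (prep_count I g (hx0 (coord_apply ha))); clear np hx0.
  by case: decided K => K; counts.
Qed.

Implicit Types s : state.
Lemma ctime_ge (x : txrec) v : v \in tx_votes x -> v <= ctime x.
Proof. by move=> h; apply: (leq_bigmax_seq (F := id)). Qed.

(** * Highest write timestamps of the clients *)

Lemma hwt_step s l s' c :
  cstep s l s' -> hwt_c (cli s' c) = hwt_c (cli s c) \/
  exists p id ct, [/\ ph (cli s c) = Committing p id,
    In (CommitResp P id ct) (net s (inl p) (inr c)),
    ph (cli s' c) = Idle P & hwt_c (cli s' c) = ct].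
Proof.
case=> [p0 r l0 s1 out w ev ne|c0 r l0 s1 out w ev ne|sv rp gs h] /=; try by left.
rewrite /upd; case: (c =P c0) => [->|]; last by left.
case: ev ne => [l1 s2 out1 []|a m l1 s2 []] /=; try by left.
by move=> p id ct hp ne; right; exists p, id, ct; split=> //; exact: net_in_head ne.
Qed.

Lemma undecided_committing s p id x :
  commit_inv s -> coord (srv s p) id = Some x -> undecided x ->
  committing (ph (cli s (tx_client x))) p id /\
  count (is_commit_resp id) (net s (inl p) (inr (tx_client x))) = 0.
Proof.
move=> I hx u; have := commit_count I hx; rewrite u.
by case: committing => /=; [split|]; lia.
Qed.

Lemma prepare_undecided s p id x g :
  owner_inv s -> commit_inv s -> coord (srv s p) id = Some x ->
  0 < count (is_prepare id) (net s (inl p) (inl g)) +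
      count (is_prepare_resp id) (net s (inl g) (inl p)) -> undecided x.
Proof.
move=> O I hx h; have [_ _ sz _] := own_coord O hx.
have [L _ /(_ g) e] := vote_count I hx.
rewrite /undecided ltn_neqAle sz andbT; apply/eqP => ez.
have c0 : tx_cohorts x <> [::] by move=> z; move: e; rewrite z copies_nil; lia.
have := decided_counts g O I hx; rewrite /decided ez eqxx andbT lt0n size_eq0.
by move/eqP: c0 => -> /(_ isT) []; lia.
Qed.

(* While a message about the voting of [id] is in transit, its client waits. *)
Lemma hwt_frozen s l s' p id x :
  cstep s l s' -> commit_inv s -> coord (srv s p) id = Some x -> undecided x ->
  hwt_c (cli s' (tx_client x)) = hwt_c (cli s (tx_client x)).
Proof.
move=> st I hx u; have [] := undecided_committing I hx u.
case: (hwt_step (tx_client x) st) => [//|[q [j [ct [-> hm _ _]]]]] /= /andP [/eqP -> /eqP ->].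
by have := In_count (a := is_commit_resp j) hm (eqxx j); lia.
Qed.

(** While a vote is under way [hwt_c] is frozen, so bounds fixed by the request can be stated with
    the current value. After the reply [hwt_c] is the commit time itself and is no longer below the
    votes; hence the phase in [hwt_votes] and the two alternatives in [hwt_decided]. *)
Record hwt_inv (s : state) : Prop := HwtInv {
  hwt_req : forall p c id h ups, In (CommitReq id h ups) (net s (inr c) (inl p)) ->
    h = hwt_c (cli s c);
  hwt_prep : forall p id x g sn ht ups, coord (srv s p) id = Some x ->
    In (Prepare id sn ht ups) (net s (inl p) (inl g)) ->
    hwt_c (cli s (tx_client x)) <= ht /\ (g, ups) \in tx_cohorts x;
  hwt_resp : forall p id x g pt, coord (srv s p) id = Some x ->
    In (PrepareResp P id pt) (net s (inl g) (inl p)) ->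
    hwt_c (cli s (tx_client x)) < pt;
  hwt_votes : forall p id x v, coord (srv s p) id = Some x ->
    committing (ph (cli s (tx_client x))) p id -> v \in tx_votes x ->
    hwt_c (cli s (tx_client x)) < v;
  hwt_decided : forall p id x, coord (srv s p) id = Some x -> decided x ->
    committing (ph (cli s (tx_client x))) p id \/
    ctime x <= hwt_c (cli s (tx_client x)) }.

Lemma hwt_init : hwt_inv (init P).
Proof. by split. Qed.

Lemma hwt_lt_ctime s p id x :
  hwt_inv s -> coord (srv s p) id = Some x -> decided x ->
  committing (ph (cli s (tx_client x))) p id ->
  hwt_c (cli s (tx_client x)) < ctime x.
Proof.
move=> I hx /andP [z /eqP e] hc; move: z; rewrite -e => z.
have [v hv] : exists v, v \in tx_votes x.
  by case: (tx_votes x) z => // v vs _; exists v; rewrite mem_head.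
exact: leq_trans (hwt_votes I hx hc hv) (ctime_ge hv).
Qed.

Lemma hwt_mono s l s' c :
  cstep s l s' -> owner_inv s -> commit_inv s -> hwt_inv s ->
  hwt_c (cli s c) <= hwt_c (cli s' c).
Proof.
move=> st O C I; case: (hwt_step c st) => [->//|[p [id [ct [hp hm _ ->]]]]].
have := own_phase O c; rewrite /phase_owner hp => /ownP [x [hx ec _]].
have [d ->] := commit_resp C hx hm.
have hc : committing (ph (cli s (tx_client x))) p id by rewrite ec hp /= !eqxx.
by rewrite -ec; apply: ltnW; apply: hwt_lt_ctime hc.
Qed.

Lemma votes_nil (x : txrec) : coord_ok x -> tx_cohorts x = [::] -> tx_votes x = [::].
Proof. by case=> _ _ sz _ e; move: sz; rewrite e leqn0 size_eq0 => /eqP. Qed.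

Lemma hwt_inv_step s l s' :
  cstep s l s' -> owner_inv s -> owner_inv s' -> commit_inv s -> hwt_inv s -> hwt_inv s'.
Proof.
move=> st O O' C I; split.
- move=> p c id h ups.
  have hw := hwt_step c st.
  case: st hw {O'} => [p0 r l0 s1 out w ev ne|c0 r l0 s1 out w ev ne|sv rp gs hh] hw /=; last first.
  + exact: hwt_req.
  + move/(net_in ne) => [hm|[e hm]].
      (* A change of [hwt_c] would require a commit reply in transit beside this request, against
         [commit_count]. *)
      rewrite (hwt_req I hm); case: hw => [-> //|[q [j [ct [hp hr _ _]]]]].
      have /= [c1 [p1 [sn [[ec] [ep] o _]]]] := own_msg O hm; subst c1 p1.
      have [x [hx ec _]] := (ownP _ _ _ _ _).1 o; subst c.
      move: (commit_count C hx) (In_count (a := is_commit_req id) hm (eqxx id)).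
      rewrite hp /=; case: (p =P q) => [->|_]; last by rewrite andFb; lia.
      case: (id =P j) => [->|_]; last by lia.
      by move: (In_count (a := is_commit_resp j) hr (eqxx j)); lia.
    case: e => ->; rewrite /upd eqxx.
    case: ev ne hm {hw} => [l1 s2 out1 []|a m l1 s2 []] //=.
    * by move=> ? ? ? _ [].
    * by move=> ? ? ? ? ? ? _ /In_map [].
    * by move=> p1 id1 hp ws0 _ [] // [_ _ ->].
  + by move/(net_in ne) => [hm|[]//]; apply: hwt_req hm.
- move=> p id x g sn ht ups hx hm.
  have old y : coord (srv s p) id = Some y -> tx_client y = tx_client x ->
      tx_cohorts y = tx_cohorts x -> In (Prepare id sn ht ups) (net s (inl p) (inl g)) ->
      hwt_c (cli s' (tx_client x)) <= ht /\ (g, ups) \in tx_cohorts x.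
    move=> hy ec eco hm0.
    have u : undecided y.
      apply: (prepare_undecided (g := g) O C hy).
      by rewrite ltn_addr // (In_count hm0) /=.
    by rewrite -ec -eco (hwt_frozen st C hy u); apply: hwt_prep hm0.
  have T := tx_step st O hx.
  case: (st) hx hm old O' => [p0 r l0 s1 out w ev ne|c0 r l0 s1 out w ev ne|sv rp gs hh] hx hm old O'.
  + move/(net_in ne): hm => [hm|[[ep] hm]].
      case: T => [hy|c1 sn1 u _|y h1 ups1 rc hy hm1 z e|q y pt hy u _ e].
      * exact: old hy _ _ hm.
      * by case: (unused_msg O u hm).
      * have [L _ /(_ g)] := vote_count C hy; rewrite (commit_req C hy hm1) copies_nil.
        by move: (In_count (a := is_prepare id) hm (eqxx id)); lia.
      * by apply: old hy _ _ hm; rewrite e.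
    have k := In_cnt (f := is_prepare id) hm (eqxx id).
    have ep' : p = p0 by case: ep.
    subst p0; move: k hm; case: ev ne O' hx {old st} =>
      [a m l1 s2 out1 []|s2 out1 ha] /=; try by counts.
    move=> c id0 h0 ups0 y rc hy ne O' hx _ /In_map [gu hg [eg ei _ <- <-]].
    move: hx; rewrite /upd eqxx /= /upd ei eqxx => -[<-] /=; split; last first.
      by apply/In_mem; rewrite -eg -surjective_pairing.
    rewrite (hwt_req I (net_in_head ne)).
    have /= [c1 [p1 [sn1 [[ec] [ep1] o _]]]] := own_msg O (net_in_head ne).
    by subst c1 p1; have [_ -> _] := owner_client O o hy; exact: leq_maxr.
  + by move/(net_in ne): hm => [hm|[]//]; apply: old hx _ _ hm.
  + move: hx; rewrite /=; case: (hh p) => u _ e hx; apply: old hm => //.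
    by move: hx; rewrite e.
- move=> p id x g pt hx hm.
  have old y : coord (srv s p) id = Some y -> tx_client y = tx_client x ->
      In (PrepareResp P id pt) (net s (inl g) (inl p)) ->
      hwt_c (cli s' (tx_client x)) < pt.
    move=> hy ec hm0.
    have u : undecided y.
      apply: (prepare_undecided (g := g) O C hy).
      by rewrite ltn_addl // (In_count hm0) /=.
    by rewrite -ec (hwt_frozen st C hy u); apply: hwt_resp hm0.
  have T := tx_step st O hx.
  case: (st) hx hm old O' => [p0 r l0 s1 out w ev ne|c0 r l0 s1 out w ev ne|sv rp gs hh] hx hm old O'.
  + move/(net_in ne): hm => [hm|[[ep] hm]].
      case: T => [hy|c1 sn1 u _|y h1 ups1 rc hy hm1 z e|q y pt1 hy u _ e].
      * exact: old hy _ hm.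
      * by case: (unused_msg O u hm).
      * by apply: old hy _ hm; rewrite e.
      * by apply: old hy _ hm; rewrite e.
    have k := In_cnt (f := is_prepare_resp id) hm (eqxx id).
    subst p0; move: k hm; case: ev ne O' hx {old st} =>
      [a m l1 s2 out1 []|s2 out1 ha] /=; try by counts.
    move=> q id0 sn ht ups t ct ne O' hx _ [] // [eq ei <-]; subst q id0.
    have hx' : coord (srv s p) id = Some x.
      by move: hx; rewrite /upd; case: eqP => [->|].
    have [h _] := hwt_prep I hx' (net_in_head ne).
    by lia.
  + by move/(net_in ne): hm => [hm|[]//]; apply: old hx _ hm.
  + move: hx; rewrite /=; case: (hh p) => u _ e hx; apply: old hm => //.
    by move: hx; rewrite e.
- move=> p id x v hx.
  have T := tx_step st O hx.
  case: (st) hx O' => [p0 r l0 s1 out w ev ne|c0 r l0 s1 out w ev ne|sv rp gs hh] hx O'.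
  + case: T => [hy|c1 sn1 u ->|y h1 ups1 rc hy hm1 z ->|q y pt1 hy u hm ->] //=.
    * exact: hwt_votes.
    * by rewrite inE => hc /orP [/eqP ->|]; [apply: hwt_resp hm | apply: hwt_votes hc].
  + move=> /=; rewrite /upd; case: (_ =P c0) => [e|_]; last exact: hwt_votes.
    have := @hwt_votes _ I p id x v hx; rewrite e.
    have A := active_tx C hx; have ok := own_coord O hx.
    case: ev ne A ok {st O' hx e} =>
      [l1 s2 out1 []|a m l1 s2 []] //=.
    move=> q j hp _ _ A ok _ /andP [/eqP ep /eqP ei]; subst q j.
    by rewrite (votes_nil ok (A _ _ hp)).
  + by move: hx => /=; case: (hh p) => u _ -> /=; apply: hwt_votes.
- move=> p id x hx d; have le := hwt_mono (tx_client x) st O C I.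
  have T := tx_step st O hx.
  case: (st) hx le O' => [p0 r l0 s1 out w ev ne|c0 r l0 s1 out w ev ne|sv rp gs hh] hx le O'.
  + case: T d => [hy|c1 sn1 u ->|y h1 ups1 rc hy hm1 z ->|q y pt1 hy u hm ->] //=.
    * exact: hwt_decided.
    * by rewrite /decided /= z /= eq_sym => /eqP z0; move: z; rewrite z0.
    * by move=> _; have [-> _] := undecided_committing C hy u; left.
  + have [hc|h] := hwt_decided I hx d; last by right; apply: leq_trans h le.
    move: hc le; rewrite /= /upd; case: (_ =P c0) => [e|_]; last by left.
    rewrite e; move: (ev) ne; case=> [l1 s2 out1 []|a m l1 s2 []] //=;
      try (by intros; match goal with E : ph _ = _, H : is_true (committing _ _ _) |- _ => rewrite E in H end);
      try (by left).
    * by move=> q; case: (ph _).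
    * move=> q j ct hp ne; rewrite hp /= => /andP [/eqP ep /eqP ei] _; subst q j.
      by have [_ ->] := commit_resp C hx (net_in_head ne); right.
  + by move: hx => /=; case: (hh p) => u _ -> /= hx; apply: hwt_decided.
Qed.

(** * Contents of stores, messages and caches *)

Lemma versions_ofP g id ct ups (d : version P) :
  d \in versions_of g id ct ups ->
  [/\ v_tx d = id, v_ut d = ct & (v_key d, v_val d) \in ups].
Proof. by case/mapP => -[k v] h -> /=. Qed.

(** Existence begins with the decision, before the cohort [g] that will install [d] learns the
    commit time. *)
Definition created s (g : server) (d : version P) : Prop :=
  exists p x ups, [/\ coord (srv s p) (v_tx d) = Some x, decided x,
    (g, ups) \in tx_cohorts x & d \in versions_of g (v_tx d) (ctime x) ups].

Lemma coord_mono s l s' p id x :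
  cstep s l s' -> coord (srv s p) id = Some x -> exists x', coord (srv s' p) id = Some x'.
Proof.
move=> st /coord_own /(own_mono st) /ownP [x' [h _ _]]; by exists x'.
Qed.

Lemma decided_undecided (x : txrec) : decided x -> undecided x = false.
Proof. by rewrite /decided /undecided; lia. Qed.

Lemma decided_mono s l s' p id x :
  cstep s l s' -> owner_inv s -> commit_inv s ->
  coord (srv s p) id = Some x -> decided x -> coord (srv s' p) id = Some x.
Proof.
move=> st O C hx d; have [x' hx'] := coord_mono st hx.
case: (tx_step st O hx') => [|c sn u _|y h ups rc hy hm _ _|q y pt hy u _ _].
- by rewrite hx hx' => -[->].
- by move: hx; rewrite u.
- move: (commit_req C hy hm) d; move: hy; rewrite hx => -[->] c0.
  by rewrite /decided c0.
- by move: hy u; rewrite hx => -[<-]; rewrite decided_undecided.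
Qed.

Lemma created_mono s l s' g d :
  cstep s l s' -> owner_inv s -> commit_inv s -> created s g d -> created s' g d.
Proof.
move=> st O C [p [x [ups [hx dx hg hd]]]]; exists p, x, ups; split=> //.
exact: decided_mono st O C hx dx.
Qed.

(** The first alternative names a transaction and not a version: an item read from a write set has
    no timestamp yet and may never get one. *)
Definition readable s (c : client) (sn : nat) (x : item P) : Prop :=
  (exists p sn', own s p x.2 c sn') \/
  exists g d, [/\ created s g d, v_tx d = x.2 & v_ut d <= sn].

Lemma readable_mono s l s' c sn x :
  cstep s l s' -> owner_inv s -> commit_inv s ->
  readable s c sn x -> readable s' c sn x.
Proof.
move=> st O C [[p [sn' o]]|[g [d [h e le]]]]; [left|right].
  by exists p, sn'; exact: own_mono st o.
by exists g, d; split=> //; exact: created_mono st O C h.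
Qed.

(** By [prepared_ok] a proposal is a vote in transit or a counted one, which bounds it by the commit
    time once the decision is made. The fields on stores and messages trace the items that a client
    reads to existing versions within its snapshot time; [wc_ok] traces cached ones to its own
    transactions. *)
Record content_inv s : Prop := ContentInv {
  prepared_ok : forall g e p x, In e (prepared (srv s g)) ->
    coord (srv s p) (pd_tx e) = Some x ->
    (g, pd_ups e) \in tx_cohorts x /\
    (In (PrepareResp P (pd_tx e) (pd_ts e)) (net s (inl g) (inl p)) \/
     pd_ts e \in tx_votes x);
  commit_ok : forall p g id ct x, In (Commit P id ct) (net s (inl p) (inl g)) ->
    coord (srv s p) id = Some x -> decided x /\ ct = ctime x;
  committed_ok : forall g e, In e (committed (srv s g)) ->
    exists p x, [/\ coord (srv s p) (pd_tx e) = Some x, decided x,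
      pd_ts e = ctime x & (g, pd_ups e) \in tx_cohorts x];
  store_ok : forall q d, d \in store (srv s q) -> exists g, created s g d;
  replicate_ok : forall a b ct ds d, In (Replicate ct ds) (net s a b) ->
    d \in ds -> exists g, created s g d;
  slice_ok : forall a b id k x p c sn, In (SliceResp id k (Some x)) (net s a b) ->
    own s p id c sn -> readable s c sn x;
  read_ok : forall a b id k x p c sn, In (ReadResp id k (Some x)) (net s a b) ->
    own s p id c sn -> readable s c sn x;
  rs_ok : forall c kx, In kx (rs (cli s c)) -> readable s c (ust_c (cli s c)) kx.2;
  wc_ok : forall c e, In e (wc (cli s c)) -> exists p sn, own s p e.1.2.2 c sn }.

Lemma content_init : content_inv (init P).
Proof. by split. Qed.

Lemma committed_created s g e d :
  content_inv s -> In e (committed (srv s g)) ->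
  d \in versions_of g (pd_tx e) (pd_ts e) (pd_ups e) -> created s g d.
Proof.
move=> I /(committed_ok I) [p [x [hx dx et hg]]] hd.
have [e1 e2 e3] := versions_ofP hd.
by exists p, x, (pd_ups e); rewrite e1 -et; split.
Qed.

Lemma groupP g (s0 : sstate) ct d :
  d \in group g s0 ct <->
  exists e, [/\ In e (committed s0), pd_ts e = ct & d \in versions_of g (pd_tx e) ct (pd_ups e)].
Proof.
rewrite /group -In_mem; split.
  case/In_flatten => _ /In_map [e /In_filter [he /eqP et] <-] /In_mem hd.
  by exists e.
case=> e [he et hd]; apply/In_flatten; exists (versions_of g (pd_tx e) ct (pd_ups e)).
  by apply/In_map; exists e => //; apply/In_filter; rewrite et.
exact/In_mem.
Qed.

Lemma assocP (A : eqType) (B : Type) (a : A) (l : seq (A * B)) b :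
  assoc a l = Some b -> In (a, b) l.
Proof.
rewrite /assoc; case e: [seq z <- l | z.1 == a] => [|z zs] //= [<-].
have : In z [seq z <- l | z.1 == a] by rewrite e; left.
by case/In_filter => h /eqP <-; case: z h {e}.
Qed.

Lemma lookup_ok s c p id k x :
  owner_inv s -> content_inv s -> ph (cli s c) = Active p id [::] ->
  lookup (cli s c) id k = Some x -> readable s c (ust_c (cli s c)) x.
Proof.
move=> O I hp; rewrite /lookup.
case: (assoc k (ws _)) => [v [<-]|].
  by have := own_phase O c; rewrite /phase_owner hp => o; left; exists p, (ust_c (cli s c)).
case e: (assoc k (rs _)) => [y|]; first by move=> [<-]; exact: rs_ok I _ _ (assocP e).
move=> ha; have /In_map [e0 he ex] := assocP ha.
have <- : e0.1.2 = x by rewrite ex.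
by have [q [sn o]] := wc_ok I he; left; exists q, sn.
Qed.

Lemma read_label s l s' id c k x :
  cstep s l s' -> owner_inv s -> content_inv s ->
  l = Read id c k (Some x) -> readable s c (ust_c (cli s c)) x.
Proof.
move=> st O I; case: st => [p0 r l0 s1 out w ev ne|c0 r l0 s1 out w ev ne|sv rp gs hh] //.
  by case: ev ne => [a m l1 s2 out1 h|s2 out1 ha] ne //; case: h.
case: ev ne => [l1 s2 out1 h|a m l1 s2 h] ne; move: ne; case: h => //.
  by move=> p j k0 y hp hl ne [_ <- _ <-]; exact: lookup_ok O I hp hl.
move=> p j ks k0 res hp hk ne [_ <- _ er]; subst res.
have := own_phase O c0; rewrite /phase_owner hp => o.
exact: read_ok I _ _ _ _ _ _ _ _ (net_in_head ne) o.
Qed.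
Lemma server_coord (s : state) p0 (s1 : sstate) p id x :
  coord s1 = coord (srv s p0) -> coord (upd (srv s) p0 s1 p) id = Some x ->
  coord (srv s p) id = Some x.
Proof. by rewrite /upd; case: eqP => [->|//] ->. Qed.

Lemma resp_step s l s' g p id ts x :
  cstep s l s' -> coord (srv s' p) id = Some x ->
  In (PrepareResp P id ts) (net s (inl g) (inl p)) ->
  In (PrepareResp P id ts) (net s' (inl g) (inl p)) \/ ts \in tx_votes x.
Proof.
case=> [p0 r l0 s1 out w ev ne|c0 r l0 s1 out w ev ne|sv rp gs h] /=; last by left.
  move=> hx /(net_in_old ne) [|[er [ep]]]; first by left.
  subst r p0; inversion ev as [a m l1 s2 out1 h e1 e2 e3 e4|]; subst.
  inversion h; subst; move: hx; rewrite /upd eqxx /= /upd eqxx => -[<-];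
    by right; rewrite mem_head.
by move=> _ /(net_in_old ne) [|[]]; [left|].
Qed.

Lemma own_back s l s' p id c sn p' c' sn' :
  cstep s l s' -> owner_inv s' -> own s p id c sn -> own s' p' id c' sn' ->
  own s p' id c' sn'.
Proof.
move=> st O' o o'; have e := own_uniq O' (own_mono st o) o'; subst p'.
by have [<- <-] := own_inj (own_mono st o) o'.
Qed.

Lemma prepared_step s l s' :
  cstep s l s' -> owner_inv s -> owner_inv s' -> commit_inv s -> prep_inv s ->
  hwt_inv s -> content_inv s ->
  forall g e p x, In e (prepared (srv s' g)) -> coord (srv s' p) (pd_tx e) = Some x ->
    (g, pd_ups e) \in tx_cohorts x /\
    (In (PrepareResp P (pd_tx e) (pd_ts e)) (net s' (inl g) (inl p)) \/
     pd_ts e \in tx_votes x).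
Proof.
move=> st O O' C R H I g e p x he hx.
have old : In e (prepared (srv s g)) -> (g, pd_ups e) \in tx_cohorts x /\
    (In (PrepareResp P (pd_tx e) (pd_ts e)) (net s' (inl g) (inl p)) \/
     pd_ts e \in tx_votes x).
  move=> he0; have W := resp_step (g := g) (ts := pd_ts e) st hx.
  case: (tx_step st O hx) => [hy|c sn u _|y h ups rc hy hm _ _|q y pt hy _ _ ex].
  - have [h1 [/W|h2]] := prepared_ok I he0 hy; split; tauto.
  - by have [p1 [c1 [sn1 o]]] := prep_own R he0; case: (unused_own u o).
  (* With a commit request in transit no cohort has been addressed yet, so [prep_count] excludes the
     entry. *)
  - have := prep_count R g hy; rewrite /decided (commit_req C hy hm) /= ?copies_nil.
    have := In_count (a := fun e' => pd_tx e == pd_tx e') he0 (eqxx _).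
    by rewrite /nprep; lia.
  - have [h1 h2] := prepared_ok I he0 hy; split; first by rewrite ex.
    by case: h2 => [/W //|h2]; right; rewrite ex /= inE h2 orbT.
case: (st) he hx old O' => [p0 r l0 s1 out w ev ne|c0 r l0 s1 out w ev ne|sv rp gs h];
  rewrite /=; last first.
- by move=> + _ old _; case: (h g) => u _ -> /old.
- by move=> + _ old _; exact: old.
rewrite [upd _ _ _ g]/upd; case: (g =P p0) => [eg|_]; last by move=> + _ old _; exact: old.
case: ev ne => [a m l1 s2 out1 []|s2 out1 /prepared_apply ->] /=; rewrite eg;
  try (by intros; match goal with H : In e _ -> _ |- _ => apply: H end).
- move=> q id sn ht ups t ct ne [<-|he] //= hx old O'; last exact: old.
  have /= [p1 [g1 [c [[e1] _ o _]]]] := own_msg O (net_in_head ne); subst p1.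
  have hx0 : coord (srv s p) id = Some x by exact: server_coord hx.
  have [e1 _ _] := owner_client O o hx0; subst q.
  have [_ hg] := hwt_prep H hx0 (net_in_head ne); split=> //.
  by left; apply: (net_in_new ne); left.
- by move=> q id ct t clk ne /In_filter [he _] hx old _; apply: old.
Qed.

Lemma commit_ok_step s l s' :
  cstep s l s' -> owner_inv s -> owner_inv s' -> commit_inv s -> content_inv s ->
  forall p g id ct x, In (Commit P id ct) (net s' (inl p) (inl g)) ->
    coord (srv s' p) id = Some x -> decided x /\ ct = ctime x.
Proof.
move=> st O O' C I p g id ct x hm hx.
have old : In (Commit P id ct) (net s (inl p) (inl g)) -> decided x /\ ct = ctime x.
  move=> hm0; case: (tx_step st O hx) => [hy|c sn u _|y h ups rc hy hq _ _|q y pt hy u _ _].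
  - exact: commit_ok hm0 hy.
  - by case: (unused_msg O u hm0).
  - by have [] := commit_ok I hm0 hy; rewrite /decided (commit_req C hy hq).
  - by have [d _] := commit_ok I hm0 hy; move: u; rewrite decided_undecided.
case: st hm hx old {O'} => [p0 r l0 s1 out w ev ne|c0 r l0 s1 out w ev ne|sv rp gs h] /=; last first.
- by move=> hm _; apply.
- by move=> /(net_in ne) [hm _|[]//]; apply.
move=> /(net_in ne) [hm _|[[ep] hm] hx _]; first by apply.
subst p0; have k := In_cnt (f := is_commit id) hm (eqxx id); move: k hm hx.
case: ev ne => [a m l1 s2 out1 []|s2 out1 ha] /=; try by counts.
move=> q id0 pt y hy hs ne _ /In_cat [/In_map [g0 _ [_ ei <-]]|[]//] hx; subst id0.
move: hx; rewrite /upd eqxx /= /upd eqxx => -[<-].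
by rewrite /decided /ctime /= -hs eqxx.
Qed.
Lemma upper_bound_store (s0 s1 : sstate) ub :
  upper_bound s0 ub s1 -> store s1 = store s0 /\ committed s1 = committed s0.
Proof. by case. Qed.

Lemma committed_step s l s' :
  cstep s l s' -> owner_inv s -> commit_inv s -> content_inv s ->
  forall g e, In e (committed (srv s' g)) ->
    exists p x, [/\ coord (srv s' p) (pd_tx e) = Some x, decided x,
      pd_ts e = ctime x & (g, pd_ups e) \in tx_cohorts x].
Proof.
move=> st O C I g e.
have M p x id := @decided_mono s l s' p id x st O C.
have old : In e (committed (srv s g)) -> exists p x,
    [/\ coord (srv s' p) (pd_tx e) = Some x, decided x,
      pd_ts e = ctime x & (g, pd_ups e) \in tx_cohorts x].
  move=> /(committed_ok I) [p [x [hx dx et hg]]]; exists p, x; split=> //; exact: M.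
case: st M old => [p0 r l0 s1 out w ev ne|c0 r l0 s1 out w ev ne|sv rp gs h] //=; last first.
  by move=> _; case: (h g) => u _ ->.
move=> M; rewrite [upd _ _ _ g]/upd; case: (g =P p0) => [eg|//]; subst g.
case: ev ne M => [a m l1 s2 out1 []|s2 out1 [ub s3 hub|ub s3 hub]] //=.
- move=> q id ct t clk ne M old /In_cat [|//] /In_map [e0 /In_filter [he /eqP et] ee].
  have /= [p1 [g1 [c [sn [[e1] _ o]]]]] := own_msg O (net_in_head ne); subst p1.
  have [x [hx _ _]] := (ownP _ _ _ _ _).1 o.
  have [dx ec] := commit_ok I (net_in_head ne) hx.
  have hx2 : coord (srv s q) (pd_tx e0) = Some x by rewrite et.
  have [hg _] := prepared_ok I he hx2.
  by exists q, x; rewrite -ee /=; split=> //; apply: M.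
- by move=> _ ne M old /In_filter [he _]; exact: old.
- by have [_ ->] := upper_bound_store hub.
Qed.

Lemma store_step s l s' :
  cstep s l s' -> owner_inv s -> commit_inv s -> content_inv s ->
  forall q d, d \in store (srv s' q) -> exists g, created s' g d.
Proof.
move=> st O C I q d.
have M g := @created_mono s l s' g d st O C.
have old : d \in store (srv s q) -> exists g, created s' g d.
  by move=> /(store_ok I) [g /M]; exists g.
case: st M old => [p0 r l0 s1 out w ev ne|c0 r l0 s1 out w ev ne|sv rp gs h] //=; last first.
  by move=> _; case: (h q) => u _ ->.
move=> M; rewrite [upd _ _ _ q]/upd; case: (q =P p0) => [eg|//]; subst q.
case: ev ne M => [a m l1 s2 out1 []|s2 out1 [ub s3 hub|ub s3 hub]] //=.
- move=> i ct ds ne M old; rewrite mem_cat => /orP [hd|]; last exact: old.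
  by have [g /M] := replicate_ok I (net_in_head ne) hd; exists g.
- move=> _ ne M old; rewrite mem_cat => /orP [/In_mem/In_flatten|hd].
    case=> _ /In_map [ct _ <-] /In_mem /groupP [e [he et hd]].
    by exists p0; apply: M; apply: (committed_created I he); rewrite et.
  by apply: old; have [<- _] := upper_bound_store hub.
- by have [-> _] := upper_bound_store hub.
Qed.

Lemma replicate_step s l s' :
  cstep s l s' -> owner_inv s -> commit_inv s -> content_inv s ->
  forall a b ct ds d, In (Replicate ct ds) (net s' a b) ->
    d \in ds -> exists g, created s' g d.
Proof.
move=> st O C I a b ct ds d hm hd.
have M g := @created_mono s l s' g d st O C.
have old : In (Replicate ct ds) (net s a b) -> exists g, created s' g d.
  by move=> /(replicate_ok I) /(_ hd) [g /M]; exists g.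
pose f (m : msg) := if m is Replicate _ _ then true else false.
case: st hm M old => [p0 r l0 s1 out w ev ne|c0 r l0 s1 out w ev ne|sv rp gs h] hm M old;
  [ | |exact: old hm].
- move: hm => /(net_in ne) [/old //|[ea hm]].
  have k := In_cnt (f := f) hm isT; move: k hm.
  case: ev ne M {old} => [a0 m l1 s2 out1 []|s2 out1 ha] /=; try by counts.
  case: ha => [ub s3 hub _ cts|ub s3 hub _] ne M _; last by case/In_map.
  case/In_flatten => o /In_map [ct1 _ <-] /In_map [q _ [_ _ e2]].
  move: hd; rewrite -e2 => /groupP [e [he et hd]].
  by exists p0; apply: M; apply: (committed_created I he); rewrite et.
- move: hm => /(net_in ne) [/old //|[ea hm]].
  have k := In_cnt (f := f) hm isT; move: k hm.
  by case: ev ne M {old} => [l1 s2 out1 []|a0 m l1 s2 []] /=; counts.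
Qed.

Lemma slice_step s l s' :
  cstep s l s' -> owner_inv s -> owner_inv s' -> commit_inv s -> content_inv s ->
  forall a b id k x p c sn, In (SliceResp id k (Some x)) (net s' a b) ->
    own s' p id c sn -> readable s' c sn x.
Proof.
move=> st O O' C I a b id k x p c sn hm o'.
have M sn0 := @readable_mono s l s' c sn0 x st O C.
have B q c0 sn0 (o : own s q id c0 sn0) := own_back st O' o o'.
have old : In (SliceResp id k (Some x)) (net s a b) -> readable s' c sn x.
  move=> hm0; have /= [p1 [c1 [sn1 [_ o]]]] := own_msg O hm0.
  exact: M (slice_ok I hm0 (B _ _ _ o)).
pose f (m : msg) := if m is SliceResp _ _ _ then true else false.
case: st hm M B old {O' o'} => [p0 r l0 s1 out w ev ne|c0 r l0 s1 out w ev ne|sv rp gs h] hm M B old;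
  [ | |exact: old hm].
- move: hm => /(net_in ne) [/old //|[ea hm]].
  have h := In_cnt (f := f) hm isT; move: h hm.
  case: ev ne M {old} => [a0 m l1 s2 out1 []|s2 out1 ha] /=; try by counts.
  move=> q id0 k0 sn0 o hf ne M _ [] // [_ ei _ eo]; subst id0.
  case: o hf eo {ne} (net_in_head ne) => [v|//] [/and3P [hv _ le] _] [eo] hs.
  have /= [p1 [c1 [_ o]]] := own_msg O hs.
  have [_ es] := own_inj (B _ _ _ o) (B _ _ _ o).
  have [g hg] := store_ok I hv.
  apply: M; right; exists g, v; split=> //; first by rewrite -eo.
  have o2 := B _ _ _ o; have ep := own_uniq O o o2; subst p1.
  by have [_ <-] := own_inj o o2.
- move: hm => /(net_in ne) [/old //|[ea hm]].
  have h := In_cnt (f := f) hm isT; move: h hm.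
  by case: ev ne M {old} => [l1 s2 out1 []|a0 m l1 s2 []] /=; counts.
Qed.

Lemma read_step s l s' :
  cstep s l s' -> owner_inv s -> owner_inv s' -> commit_inv s -> content_inv s ->
  forall a b id k x p c sn, In (ReadResp id k (Some x)) (net s' a b) ->
    own s' p id c sn -> readable s' c sn x.
Proof.
move=> st O O' C I a b id k x p c sn hm o'.
have M sn0 := @readable_mono s l s' c sn0 x st O C.
have B q c0 sn0 (o : own s q id c0 sn0) := own_back st O' o o'.
have old : In (ReadResp id k (Some x)) (net s a b) -> readable s' c sn x.
  move=> hm0; have /= [p1 [c1 [sn1 [_ _ o]]]] := own_msg O hm0.
  exact: M (read_ok I hm0 (B _ _ _ o)).
pose f (m : msg) := if m is ReadResp _ _ _ then true else false.
case: st hm M B old {O' o'} => [p0 r l0 s1 out w ev ne|c0 r l0 s1 out w ev ne|sv rp gs h] hm M B old;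
  [ | |exact: old hm].
- move: hm => /(net_in ne) [/old //|[ea hm]].
  have h := In_cnt (f := f) hm isT; move: h hm.
  case: ev ne M {old} => [a0 m l1 s2 out1 []|s2 out1 ha] /=; try by counts.
  move=> q id0 k0 res y hy ne M _ [] // [_ ei _ er]; subst id0 res.
  by apply: M; apply: slice_ok (net_in_head ne) (B _ _ _ (coord_own hy)).
- move: hm => /(net_in ne) [/old //|[ea hm]].
  have h := In_cnt (f := f) hm isT; move: h hm.
  by case: ev ne M {old} => [l1 s2 out1 []|a0 m l1 s2 []] /=; counts.
Qed.

Lemma content_step s l s' :
  cstep s l s' -> owner_inv s -> owner_inv s' -> commit_inv s -> prep_inv s ->
  hwt_inv s -> content_inv s -> content_inv s'.
Proof.
move=> st O O' C R H I; split.
- exact: prepared_step st O O' C R H I.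
- exact: commit_ok_step st O O' C I.
- exact: committed_step st O C I.
- exact: store_step st O C I.
- exact: replicate_step st O C I.
- exact: slice_step st O O' C I.
- exact: read_step st O O' C I.
- move=> c kx.
  have M sn x := @readable_mono s l s' c sn x st O C.
  have old : In kx (rs (cli s c)) -> readable s' c (ust_c (cli s c)) kx.2.
    by move/(rs_ok I); exact: M.
  case: st M old {O'} => [p0 r l0 s1 out w ev ne|c0 r l0 s1 out w ev ne|sv rp gs h] //= M.
  rewrite /upd; case: (c =P c0) => [e|_] //; subst c0.
  case: ev ne M => [l1 s2 out1 []|a m l1 s2 []] //=.
  + move=> p id k x hp hl ne M old [<-|] //=; apply: M; exact: lookup_ok O I hp hl.
  + move=> p id ks k [x|] //= hp hk ne M old [<-|] //=; apply: M.
    have := own_phase O c; rewrite /phase_owner hp => o.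
    exact: (read_ok I (net_in_head ne) o).
- move=> c e.
  have old : In e (wc (cli s c)) -> exists p sn, own s' p e.1.2.2 c sn.
    by move/(wc_ok I) => [p [sn /(own_mono st)]]; exists p, sn.
  have M p id sn := @own_mono s l s' p id c sn st.
  case: st M old {O'} => [p0 r l0 s1 out w ev ne|c0 r l0 s1 out w ev ne|sv rp gs h] //= M.
  rewrite /upd; case: (c =P c0) => [ec|_] //; subst c0.
  case: ev ne M => [l1 s2 out1 []|a m l1 s2 []] //=.
  + by move=> p id sn hp ne M old /In_filter [h _]; apply: old.
  + move=> p id ct hp ne M old /In_cat [/In_map [kv _ <-]|/In_filter [h _]]; last exact: old.
    have := own_phase O c; rewrite /phase_owner hp => o.
    by exists p, (ust_c (cli s c)); apply: M.
Qed.

(** * Clocks and version vectors *)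

Definition own_vv (g : server) (s0 : sstate) : nat := vv s0 g.2.

(* A transaction may be prepared above [hlc], at the server's [ust]; the stable
   time then bounds the proposals to come. *)
Record clock_ok (g : server) (s0 : sstate) : Prop := ClockOk {
  clock_prepared : forall e, In e (prepared s0) ->
    own_vv g s0 < pd_ts e /\ pd_ts e <= maxn (hlc s0) (ust s0);
  clock_committed : forall e, In e (committed s0) -> own_vv g s0 < pd_ts e;
  clock_next : [|| own_vv g s0 < clk s0, own_vv g s0 <= hlc s0 | own_vv g s0 < ust s0];
  clock_idle : prepared s0 = [::] -> (own_vv g s0 < clk s0) || (own_vv g s0 <= hlc s0) }.

Lemma clock_ok_mono g (s0 s1 : sstate) :
  clock_ok g s0 -> prepared s1 = prepared s0 -> committed s1 = committed s0 ->
  own_vv g s1 = own_vv g s0 -> clk s0 <= clk s1 -> hlc s0 <= hlc s1 ->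
  ust s0 <= ust s1 -> clock_ok g s1.
Proof.
case=> h1 h2 h3 h4 ep ec ev lc lh lu; split; rewrite ?ep ?ec ?ev.
- by move=> e /h1 []; split; lia.
- exact: h2.
- by lia.
- by move/h4; lia.
Qed.

Definition stamp (m : msg) : option nat :=
  match m with Replicate t _ | Heartbeat t => Some t | _ => None end.

(** The entries of other servers and the timestamps under way lag behind the sender's own entry. The
    clause [r != g.2] ensures that a receipt never overwrites the receiver's own entry. *)
Record clock_inv s : Prop := ClockInv {
  clock_server : forall g, clock_ok g (srv s g);
  clock_msg : forall a b m t, In m (net s a b) -> stamp m = Some t ->
    exists g r, [/\ a = inl g, b = inl (g.1, r), r != g.2 & t <= own_vv g (srv s g)];
  clock_vv : forall q r, vv (srv s q) r <= own_vv (q.1, r) (srv s (q.1, r)) }.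

Lemma clock_init : clock_inv (init P).
Proof.
by split=> // g; split=> //; rewrite /own_vv /= ?ffunE.
Qed.

(** With entries in Prepared, [ub] is one less than a proposal above the own entry, so it does not
    fall, and all proposals stay above it. With none, [clock_idle] gives the comparison, and the
    clock reading just taken lets the next one exceed [ub] or leaves [ub] equal to [hlc]. *)
Lemma upper_boundP g (s0 s1 : sstate) ub :
  clock_ok g s0 -> upper_bound s0 ub s1 ->
  own_vv g s0 <= ub /\
  clock_ok g (set_vv (set_pending s1 (prepared s0)
     [seq e <- committed s0 | ub < pd_ts e]) g.2 ub).
Proof.
case=> h1 h2 h3 h4 [x /andP [hx /allP hm]|t hp le]; rewrite /own_vv in h1 h2 h3 h4 *.
- have /In_mem/In_map [e he ex] := hx.
  have [k1 k2] := h1 e he.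
  split; first by lia.
  split; rewrite /own_vv /= ffunE eqxx.
  + move=> e1 he1; have [k3 k4] := h1 e1 he1; split=> //.
    have : x <= pd_ts e1 by apply: hm; apply/In_mem/In_map; exists e1.
    lia.
  + by move=> e1 /In_filter [].
  + by lia.
  + by move=> e0; move: he; rewrite e0.
- split; first by move: (h4 hp); lia.
  split; rewrite /own_vv /= ?ffunE ?eqxx.
  + by rewrite hp.
  + by move=> e1 /In_filter [].
  + by lia.
  + by lia.
Qed.

Lemma set_vv_other g (s0 : sstate) i t : i != g.2 -> own_vv g (set_vv s0 i t) = own_vv g s0.
Proof. by rewrite /own_vv /= ffunE eq_sym => /negPf ->. Qed.

(** Once the decision is made no vote is in transit, so the proposal is one of the votes whose
    maximum was taken. *)
Lemma prepared_le s g e p x :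
  owner_inv s -> commit_inv s -> content_inv s ->
  In e (prepared (srv s g)) -> coord (srv s p) (pd_tx e) = Some x -> decided x ->
  pd_ts e <= ctime x.
Proof.
move=> O C I he hx d; have [_ [hm|]] := prepared_ok I he hx; last exact: ctime_ge.
have [_] := decided_counts g O C hx d.
by have := In_count (a := is_prepare_resp (pd_tx e)) hm (eqxx _); lia.
Qed.

Lemma clock_server_step s l s' :
  cstep s l s' -> owner_inv s -> commit_inv s -> content_inv s -> clock_inv s ->
  forall g, clock_ok g (srv s' g) /\ own_vv g (srv s g) <= own_vv g (srv s' g).
Proof.
move=> st O C I V g; have K := clock_server V g.
case: st => [p0 r l0 s1 out w ev ne|c0 r l0 s1 out w ev ne|sv rp gs h] //=; last first.
  by case: (h g) => u le ->; split=> //; apply: clock_ok_mono K _ _ _ _ _ _.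
rewrite /upd; case: (g =P p0) => [eg|//]; subst p0.
case: ev ne => [a m l1 s2 out1 []|s2 out1 [ub s3 hub|ub s3 hub]] /=; intros;
  try (by split; [apply: clock_ok_mono K _ _ _ _ _ _ => //=; lia |]).
- split=> //; case: K => h1 h2 h3 h4; rewrite /own_vv in h1 h2 h3 h4.
  split; rewrite /own_vv /=.
  (* The three cases of [clock_next]: the new proposal is at least [clk], greater than [hlc], and at
     least [ust]. *)
  + move=> e [<-|he] /=; first by lia.
    by have := h1 e he; lia.
  + exact: h2.
  + by lia.
  + by [].
- split=> //; case: K => h1 h2 h3 h4; rewrite /own_vv in h1 h2 h3 h4.
  have /= [p1 [g1 [c [sn [[e1] _ o]]]]] := own_msg O (net_in_head ne); subst p1.
  have [x [hx _ _]] := (ownP _ _ _ _ _).1 o.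
  have [dx ec] := commit_ok I (net_in_head ne) hx.
  have le e : In e (prepared (srv s g)) -> pd_tx e = id -> pd_ts e <= ct.
    by move=> he et; rewrite ec; apply: (prepared_le O C I he _ dx); rewrite et; exact: hx.
  split; rewrite /own_vv /=.
  + by move=> e /In_filter [he _]; have := h1 e he; lia.
  + move=> e /In_cat [/In_map [e0 /In_filter [he /eqP et] <-]|he] /=; last exact: h2.
    by have := le e0 he et; have := h1 e0 he; lia.
  + by lia.
  (* If this commit empties Prepared, the proposal of a removed entry lay above the own entry and is
     at most [ct], which [hlc] now reaches. *)
  + move=> ef; case E: (prepared (srv s g)) => [|e es]; first by have := h4 E; lia.
    have he : In e (prepared (srv s g)) by rewrite E; left.
    move: ef; rewrite E /=; case: eqP => //= et _.
    by have := le e he et; have := h1 e he; lia.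
- have [g1 [r1 [ea eb nr _]]] := clock_msg V (net_in_head ne) (erefl _).
  case: ea eb nr => <- /= [eb] nr.
  have nr' : i != g.2 by rewrite eq_sym eb.
  by split; [apply: clock_ok_mono K _ _ _ _ _ _ => //=|]; rewrite set_vv_other.
- have [g1 [r1 [ea eb nr _]]] := clock_msg V (net_in_head ne) (erefl _).
  case: ea eb nr => <- /= [eb] nr.
  have nr' : i != g.2 by rewrite eq_sym eb.
  by split; [apply: clock_ok_mono K _ _ _ _ _ _ => //=|]; rewrite set_vv_other.
- have [le K'] := upper_boundP K hub; split; last by rewrite /own_vv /= ffunE eqxx.
  exact: clock_ok_mono K' _ _ _ _ _ _.
- have [le K'] := upper_boundP K hub; split; last by rewrite /own_vv /= ffunE eqxx.
  apply: clock_ok_mono K' _ _ _ _ _ _ => //=; first by case: hub.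
  by have [_ ->] := upper_bound_store hub; match goal with E : committed _ = _ |- _ => rewrite E end.
Qed.

Lemma own_vv_mono s l s' g :
  cstep s l s' -> owner_inv s -> commit_inv s -> content_inv s -> clock_inv s ->
  own_vv g (srv s g) <= own_vv g (srv s' g).
Proof. by move=> st O C I V; have [] := clock_server_step st O C I V g. Qed.

Lemma ready_le (s0 : sstate) ub t : t \in ready_times s0 ub -> t <= ub.
Proof.
by rewrite /ready_times mem_sort mem_undup => /In_mem/In_map [e /In_filter [_ h] <-].
Qed.

Lemma mem_peers (g q : server) : q \in peers g -> q = (g.1, q.2) /\ q.2 != g.2.
Proof. by case/mapP => i; rewrite mem_filter => /andP [h _] ->. Qed.

Lemma clock_step s l s' :
  cstep s l s' -> owner_inv s -> commit_inv s -> content_inv s -> clock_inv s ->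
  clock_inv s'.
Proof.
move=> st O C I V; have M g := own_vv_mono g st O C I V.
split; first by move=> g; have [] := clock_server_step st O C I V g.
- move=> a b m t hm et.
  have old : In m (net s a b) -> exists g r,
      [/\ a = inl g, b = inl (g.1, r), r != g.2 & t <= own_vv g (srv s' g)].
    move=> h; have [g [r [ea eb nr le]]] := clock_msg V h et.
    by exists g, r; split=> //; exact: leq_trans le (M g).
  case: st M hm old => [p0 r l0 s1 out w ev ne|c0 r l0 s1 out w ev ne|sv rp gs h] M hm old;
    [ | |exact: old hm].
  + move: hm => /(net_in ne) [/old //|[ea hm]].
    have k := In_cnt (f := isSome \o stamp) hm; move: k hm; rewrite /= et => /(_ isT).
    case: ev ne {M old} => [a0 m0 l1 s2 out1 []|s2 out1 [ub s3 hub _ cts|ub s3 hub _]] /=;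
      try by counts.
      move=> ne _ /In_flatten [o /In_map [ct hct <-]] /In_map [q /In_mem hq [eb em]].
      have [eq nq] := mem_peers hq; exists p0, q.2; split=> //; first by rewrite -eb -eq.
      move: et; rewrite -em => -[<-]; rewrite /upd eqxx /own_vv /= ffunE eqxx.
      by apply: (ready_le (s0 := srv s p0)); apply/In_mem.
    move=> ne _ /In_map [q /In_mem hq [eb em]].
    have [eq nq] := mem_peers hq; exists p0, q.2; split=> //; first by rewrite -eb -eq.
    by move: et; rewrite -em => -[<-]; rewrite /upd eqxx /own_vv /= ffunE eqxx.
  + move: hm => /(net_in ne) [/old //|[ea hm]].
    have k := In_cnt (f := isSome \o stamp) hm; move: k hm; rewrite /= et => /(_ isT).
    by case: ev ne {M old} => [l1 s2 out1 []|a0 m0 l1 s2 []] /=; counts.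
- move=> q r.
  have old : vv (srv s q) r <= own_vv (q.1, r) (srv s' (q.1, r)).
    exact: leq_trans (clock_vv V q r) (M _).
  case: st M old => [p0 x l0 s1 out w ev ne|c0 x l0 s1 out w ev ne|sv rp gs h] //= M old; last first.
    by case: (h q) => u _ ->.
  rewrite [upd _ _ _ q]/upd; case: (q =P p0) => [eq|//]; subst p0.
  have self : r = q.2 -> vv s1 r <= own_vv (q.1, r) (upd (srv s) q s1 (q.1, r)).
    by move=> ->; rewrite -surjective_pairing /upd eqxx.
  case: ev ne M old self => [a m l1 s2 out1 []|s2 out1 [ub s3 hub _ cts|ub s3 hub _]] //=.
  + move=> i ct ds ne M old self; rewrite ffunE; case: (r =P i) => [e|//]; subst i.
    have [g [r1 [ea _ _ le]]] := clock_msg V (net_in_head ne) (erefl _).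
    by case: ea le => <- le; exact: leq_trans le (M _).
  + move=> i t ne M old self; rewrite ffunE; case: (r =P i) => [e|//]; subst i.
    have [g [r1 [ea _ _ le]]] := clock_msg V (net_in_head ne) (erefl _).
    by case: ea le => <- le; exact: leq_trans le (M _).
  + move=> ne M old self; rewrite ffunE; case: (r =P q.2) => [e|n].
      by move: (self e); rewrite ffunE e eqxx.
    by move: old; case: hub.
  + move=> ne M old self; rewrite ffunE; case: (r =P q.2) => [e|n].
      by move: (self e); rewrite ffunE e eqxx.
    by move: old; case: hub.
Qed.

(** * Replication *)

(* [d] is about to be replicated through the channel [ms], and no message before
   it carries a timestamp that reaches [v_ut d]. *)
Fixpoint arrives (d : version P) (ms : seq msg) : Prop :=
  if ms is m :: ms' then
    match m with
    | Replicate ct ds => ct = v_ut d /\ d \in ds \/ ct < v_ut d /\ arrives d ms'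
    | Heartbeat t => t < v_ut d /\ arrives d ms'
    | _ => arrives d ms'
    end
  else False.

Lemma arrives_catl d ms ms' : arrives d ms -> arrives d (ms ++ ms').
Proof. by elim: ms => [|m ms IH] //; case: m => //=; tauto. Qed.

Lemma arrives_catr d ms ms' :
  (forall m t, In m ms -> stamp m = Some t -> t < v_ut d) ->
  arrives d ms' -> arrives d (ms ++ ms').
Proof.
elim: ms => [|m ms IH] //= h h'.
have {}IH : arrives d (ms ++ ms') by apply: IH => // m0 t hm; apply: h; right.
by case: m h => //= [ct ds|t] h; [right|]; split=> //; exact: (h _ _ (or_introl erefl) erefl).
Qed.

(** [arrives] depends on the order of messages, so membership and counts are too coarse: FIFO enters
    here, through consumption at the head and sending at the end. *)
Lemma net_shape n r out (w w' : channels) x y :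
  net_effect n r out w w' ->
  exists tl, (tl = if x == n then [seq bm.2 | bm <- out & bm.1 == y] else [::]) /\
    (w' x y = w x y ++ tl \/
     exists m ms, [/\ r = Some (x, m), y = n, w x y = m :: ms & w' x y = ms ++ tl]) /\
    (forall m, r = Some (x, m) -> y = n -> exists2 ms, w x y = m :: ms & w' x y = ms ++ tl).
Proof.
case: r => [[a m]|] /=; last first.
  by move=> ->; rewrite sendE; eexists; split; [reflexivity|]; split=> //; left.
case=> ms wan ->; rewrite sendE; eexists; split; [reflexivity|].
rewrite /set_chan /upd; case: eqP => [->|nx]; last first.
  by split; [left | move=> m0 [e]; case: nx].
case: eqP => [->|ny]; last by split; [left | move=> m0 _ e; case: ny].
split; first by right; exists m, ms.
by move=> m0 [<-] _; exists ms.
Qed.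

(** The bound on the receiver's entry makes the converse available: an entry that has reached
    [v_ut d] proves that [d] is no longer in transit. *)
Definition intransit s (g q : server) (d : version P) : Prop :=
  vv (srv s q) g.2 < v_ut d /\ arrives d (net s (inl g) (inl q)).

Definition replicated s (g : server) (d : version P) : Prop :=
  d \in store (srv s g) /\
  forall r, r != g.2 ->
    d \in store (srv s (g.1, r)) \/ intransit s g (g.1, r) d.

Lemma store_mono s l s' q d :
  cstep s l s' -> d \in store (srv s q) -> d \in store (srv s' q).
Proof.
case=> [p0 r l0 s1 out w ev ne|c0 r l0 s1 out w ev ne|sv rp gs h] //=; last first.
  by case: (h q) => u _ ->.
rewrite /upd; case: (q =P p0) => [->|//].
case: ev ne => [a m l1 s2 out1 []|s2 out1 [ub s3 hub|ub s3 hub]] //=.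
- by move=> i ct ds ne hd; rewrite mem_cat hd orbT.
- by move=> _ ne hd; have [-> _] := upper_bound_store hub; rewrite mem_cat hd orbT.
- by have [-> _] := upper_bound_store hub.
Qed.

Lemma replicated_step s l s' g d :
  cstep s l s' -> clock_inv s -> replicated s g d -> replicated s' g d.
Proof.
move=> st V [h1 h2]; split; first exact: store_mono st h1.
move=> r nr; have [|[hv ha]] := h2 r nr; first by left; exact: store_mono st _.
case: st {h1 h2} => [p0 x l0 s1 out w ev ne|c0 x l0 s1 out w ev ne|sv rp gs h] /=; last first.
- by right; split=> //=; case: (h (g.1, r)) => u _ ->.
- have [tl [_ [[e|[m [ms [_ e]]]] _]]] := net_shape (inl g) (inl (g.1, r)) ne => //.
  by right; split=> //=; rewrite e; exact: arrives_catl.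
have [tl [_ [he hx]]] := net_shape (inl g) (inl (g.1, r)) ne.
rewrite /intransit /= ![upd _ _ _ (g.1, r)]/upd.
case: ((g.1, r) =P p0) => [ep|np]; last first.
  right; split=> //; case: he => [->|[m [ms [_ [e] _ _]]]]; last by case: np.
  exact: arrives_catl.
subst p0.
(* Covers the events of the receiver that neither change its entry for [g] nor consume a timestamped
   message from [g]. *)
have next : vv s1 g.2 = vv (srv s (g.1, r)) g.2 ->
    (forall m, x = Some (inl g, m) -> stamp m = None) ->
    vv s1 g.2 < v_ut d /\ arrives d (w (inl g) (inl (g.1, r))).
  move=> -> hs; split=> //; case: he => [->|[m [ms [e1 _ e2 ->]]]]; first exact: arrives_catl.
  move: (hs _ e1) ha; rewrite e2; case: m {e1 e2} => //= *; exact: arrives_catl.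
case: ev ne he hx next => [a m l1 s2 out1 []|s2 out1 [ub s3 hub|ub s3 hub]] /=; intros;
  try (by right; match goal with N : _ -> _ -> _ |- _ => apply: N => // m0 [_ <-] end).
- case: (g.2 =P i) => [e|n].
    subst i; have eg : ((g.1, g.2) : server) = g by case: (g).
    have [ms e1 e2] := hx (Replicate ct ds) (congr1 (fun z => Some (inl z, _)) eg) erefl.
    (* The entry for [g] becomes [ct]; by [arrives] the message either contains [d] or its timestamp
       is still below that of [d]. *)
    rewrite ffunE eqxx mem_cat e2; move: ha; rewrite e1 /= => -[[_ ->]|[lt ha]].
      by left.
    by right; split=> //; exact: arrives_catl.
  right; apply: next; first by rewrite ffunE; case: eqP.
  by move=> m0 [eg]; case: n; rewrite -eg.
- case: (g.2 =P i) => [e|n].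
    subst i; have eg : ((g.1, g.2) : server) = g by case: (g).
    have [ms e1 e2] := hx (Heartbeat P t) (congr1 (fun z => Some (inl z, _)) eg) erefl.
    rewrite ffunE eqxx e2; move: ha; rewrite e1 /= => -[lt ha].
    by right; split=> //; exact: arrives_catl.
  right; apply: next; first by rewrite ffunE; case: eqP.
  by move=> m0 [eg]; case: n; rewrite -eg.
- right; apply: next => //; rewrite ffunE /= eq_sym (negPf nr).
  by case: hub.
- right; apply: next => //; rewrite ffunE /= eq_sym (negPf nr).
  by case: hub.
Qed.
(** The stations of a decided transaction at a cohort. The first says nothing about the contents of
    the entry, because [prepared_ok] recovers them from the coordinator's record. *)
Definition progress s (g : server) id ct ups : Prop :=
  (exists2 e, In e (prepared (srv s g)) & pd_tx e = id) \/
  In (Pending id ct ups) (committed (srv s g)) \/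
  (forall d, d \in versions_of g id ct ups -> replicated s g d).

Definition repl_inv s : Prop :=
  forall p id x g ups, coord (srv s p) id = Some x -> decided x ->
    (g, ups) \in tx_cohorts x -> progress s g id (ctime x) ups.

Lemma repl_init : repl_inv (init P).
Proof. by []. Qed.

(** The deciding step sends a commit message to [g], and [prep_count] in the new state matches it
    with an entry in Prepared. *)
Lemma decision_prepared s l s' p id x y g ups :
  cstep s l s' -> owner_inv s -> prep_inv s' ->
  coord (srv s' p) id = Some x -> decided x ->
  coord (srv s p) id = Some y -> undecided y -> (g, ups) \in tx_cohorts x ->
  exists2 e, In e (prepared (srv s' g)) & pd_tx e = id.
Proof.
move=> st O R' hx d hy u hg.
suff [ct hm] : exists ct, In (Commit P id ct) (net s' (inl p) (inl g)).
  have := prep_count R' g hx; rewrite d => -[en _].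
  have := In_count (a := is_commit id) hm (eqxx id); rewrite -en => /count_In [e he /eqP et].
  by exists e.
have same : coord (srv s p) id <> Some x.
  by rewrite hy => -[e]; move: u; rewrite e decided_undecided.
case: st hx hg {R'} => [p0 r l0 s1 out w ev ne|c0 r l0 s1 out w ev ne|sv rp gs h] /= hx hg.
- case: ev ne hx => [a m l1 s2 out1 []|s2 out1 ha] ne /=; intros;
    try (by case: same; apply: server_coord hx).
  + have [[ep ei ex]|[] //] := upd_coordP hx erefl; subst.
    match goal with F : unused _ _ |- _ => by move: hy; rewrite F end.
  + have [[ep ei ex]|[] //] := upd_coordP hx erefl; subst.
    by move: d; rewrite /decided /= eq_sym; case: size.
  + have [[ep ei ex]|[] //] := upd_coordP hx erefl; subst.
    by move: d; rewrite /decided /=; lia.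
  + have [[ep ei ex]|[] //] := upd_coordP hx erefl; subst.
    eexists; apply: (net_in_new ne0); apply/In_cat; left; apply/In_map.
    by exists (g, ups); [exact/In_mem | reflexivity].
  + by case: same; apply: server_coord hx; exact: coord_apply ha.
- by case: same.
- by case: same; move: hx; case: (h p) => v _ ->.
Qed.

Lemma uniq_fst (A B : eqType) (co : seq (A * B)) a b b' :
  uniq (map fst co) -> (a, b) \in co -> (a, b') \in co -> b = b'.
Proof.
elim: co => [|[a0 b0] co IH] //= /andP [nin u].
rewrite !inE => /orP [/eqP h|h] /orP [/eqP h'|h'].
- by rewrite -h in h'; case: h' => ->.
- by case: h => e _; case/negP: nin; apply/mapP; exists (a, b').
- by case: h' => e _; case/negP: nin; apply/mapP; exists (a, b).
- exact: IH u h h'.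
Qed.

(** Groups leave in increasing order of timestamps, so everything sent to [q] ahead of the group of
    [d] has a smaller one. *)
Lemma arrives_sent d (p q : server) (grp : nat -> seq (version P)) cts :
  sorted ltn cts -> v_ut d \in cts -> d \in grp (v_ut d) -> q \in peers p ->
  arrives d [seq bm.2 | bm <- [seq ((inl q' : node), Replicate ct (grp ct))
                               | ct <- cts, q' <- peers p] & bm.1 == inl q].
Proof.
move=> + + hd hq; elim: cts => [|ct cts IH] // srt.
rewrite inE allpairs_cons filter_cat map_cat.
set L := map _ (filter _ [seq _ | q' <- peers p]).
have hL m : In m L -> m = Replicate ct (grp ct).
  by case/In_map => bm /In_filter [/In_map [q' _ <-] _] <-.
have nL : exists m L', L = m :: L'.
  have : In (Replicate ct (grp ct)) L.
    apply/In_map; exists (inl q, Replicate ct (grp ct)) => //.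
    by apply/In_filter => /=; split=> //; apply/In_map; exists q => //; exact/In_mem.
  by case: (L) => [|m L'] // _; exists m, L'.
case/orP => [/eqP e|h].
  case: nL => m [L' eL]; rewrite eL /=.
  by have -> := hL m; rewrite ?eL; [left; rewrite -e|left].
apply: arrives_catr; last by apply: IH => //; exact: path_sorted srt.
move=> m t /hL -> [<-].
by have /allP := order_path_min ltn_trans srt; apply.
Qed.

Lemma mem_ready (s0 : sstate) ub e :
  In e (committed s0) -> pd_ts e <= ub -> pd_ts e \in ready_times s0 ub.
Proof.
move=> he le; rewrite /ready_times mem_sort mem_undup; apply/In_mem/In_map.
by exists e => //; apply/In_filter.
Qed.

Lemma ready_sorted (s0 : sstate) ub : sorted ltn (ready_times s0 ub).
Proof.
rewrite ltn_sorted_uniq_leq /ready_times sort_uniq undup_uniq /=.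
by apply: sort_sorted; exact: leq_total.
Qed.

Lemma progress_step s l s' p id x g ups :
  cstep s l s' -> owner_inv s -> commit_inv s -> content_inv s -> clock_inv s ->
  coord (srv s p) id = Some x -> decided x -> (g, ups) \in tx_cohorts x ->
  progress s g id (ctime x) ups -> progress s' g id (ctime x) ups.
Proof.
move=> st O C I V hx dx hg [[e he et]|[hc|hr]]; last first.
- by right; right=> d /hr; exact: replicated_step st V.
- have K := clock_committed (clock_server V g) hc.
  case: st => [p0 r l0 s1 out w ev ne|c0 r l0 s1 out w ev ne|sv rp gs h]; last first.
  + by right; left=> /=; case: (h g) => u _ ->.
  + by right; left.
  rewrite /progress /= ![upd _ _ _ g]/upd; case: (g =P p0) => [eg|//]; last by right; left.
  subst p0; case: ev ne => [a m l1 s2 out1 []|s2 out1 [ub s3 hub _ cts|ub s3 hub e0]] /=; intros;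
  match goal with N : net_effect _ _ _ _ _ |- _ => rename N into ne0 end;
    try (by right; left).
  + by right; left; apply/In_cat; right.
  + case: (ltnP ub (ctime x)) => [lt|le]; first by right; left; apply/In_filter.
    have hcts : ctime x \in cts by exact: (mem_ready hc).
    right; right=> d hd; have [e1 e2 _] := versions_ofP hd.
    have hgr : d \in group g (srv s g) (ctime x).
      by apply/groupP; exists (Pending id (ctime x) ups).
    split.
      rewrite /= /upd eqxx /= mem_cat; apply/orP; left.
      apply/In_mem/In_flatten; exists (group g (srv s g) (ctime x)); last exact/In_mem.
      by apply/In_map; exists (ctime x) => //; exact/In_mem.
    (* Before this step the own entry of [g] was below the commit time. It bounds the receiver's
       entry for [g] and every timestamp still in the channel, so nothing announces the commit time
       ahead of the group. *)
    move=> r1 nr; right; split=> /=.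
      rewrite /upd; case: eqP => [eg|_]; first by move: nr; rewrite -eg eqxx.
      rewrite e2; apply: leq_ltn_trans K.
      by have := clock_vv V (g.1, r1) g.2; rewrite /= -surjective_pairing.
    have [tl [etl [[->|[m [ms [] //]]] _]]] := net_shape (inl g) (inl (g.1, r1)) ne0.
    rewrite etl eqxx; apply: arrives_catr.
      move=> m t hm ht; have [g1 [r2 [[<-] _ _ le']]] := clock_msg V hm ht.
      by rewrite e2; exact: leq_ltn_trans le' K.
    apply: arrives_sent; rewrite ?e2 //; first exact: ready_sorted.
    by apply/mapP; exists r1 => //; rewrite mem_filter nr mem_enum.
  + by move: hc; rewrite e0.
case: st => [p0 r l0 s1 out w ev ne|c0 r l0 s1 out w ev ne|sv rp gs h]; last first.
- by left; exists e => //=; case: (h g) => u _ ->.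
- by left; exists e.
rewrite /progress /= ![upd _ _ _ g]/upd; case: (g =P p0) => [eg|_]; last by left; exists e.
subst p0; case: ev ne => [a m l1 s2 out1 []|s2 out1 ha] /=; intros;
  match goal with N : net_effect _ _ _ _ _ |- _ => rename N into ne0 end;
  try (by left; exists e).
- by left; exists e => //; right.
- case: (pd_tx e =P id0) => [ei|n]; last first.
    by left; exists e => //; apply/In_filter; split=> //; apply/eqP.
  right; left; apply/In_cat; left; apply/In_map; exists e.
    by apply/In_filter; rewrite ei eqxx.
  have /= [p1 [g1 [c [sn [[e1] _ o]]]]] := own_msg O (net_in_head ne0); subst p1.
  rewrite -ei et in o; have [eq _ _] := owner_client O o hx; subst q.
  rewrite -ei et in ne0; have [_ ->] := commit_ok I (net_in_head ne0) hx.
  have hx2 : coord (srv s p) (pd_tx e) = Some x by rewrite et.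
  have [hg2 _] := prepared_ok I he hx2; have [_ uc _ _] := own_coord O hx.
  (* The entry carries exactly [ups], since a server occurs only once among the cohorts. *)
  by rewrite (uniq_fst uc hg hg2) -ei et.
- by left; exists e => //; rewrite (prepared_apply ha).
Qed.

Lemma repl_step s l s' :
  cstep s l s' -> owner_inv s -> commit_inv s -> prep_inv s' ->
  content_inv s -> clock_inv s -> repl_inv s -> repl_inv s'.
Proof.
move=> st O C R' I V J p id x g ups hx d hg.
case: (tx_step st O hx) => [hy|c sn u ex|y h us rc hy hm z ex|q y pt hy u _ _].
- exact: progress_step st O C I V hy d hg (J _ _ _ _ _ hy d hg).
- by move: d; rewrite ex.
- by move: d; rewrite ex /decided /= eq_sym; move: z; case: size.
- by left; exact: decision_prepared st O R' hx d hy u hg.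
Qed.

(** * Stable times *)

Record inv s : Prop := Inv {
  inv_owner : owner_inv s;
  inv_start : start_inv s;
  inv_commit : commit_inv s;
  inv_prep : prep_inv s;
  inv_hwt : hwt_inv s;
  inv_content : content_inv s;
  inv_clock : clock_inv s;
  inv_repl : repl_inv s }.

Lemma inv_init : inv (init P).
Proof.
split; [exact: owner_init | exact: start_init | exact: commit_init | exact: prep_init
  | exact: hwt_init | exact: content_init | exact: clock_init | exact: repl_init].
Qed.

Lemma inv_step s l s' : cstep s l s' -> inv s -> inv s'.
Proof.
move=> st [O S C R H I V J].
have O' := owner_step st O; have C' := commit_step st O O' S C.
have R' := prep_step st O O' C C' R.
split=> //.
- exact: start_step st O S.
- exact: hwt_inv_step st O O' C H.
- exact: content_step st O O' C R H I.
- exact: clock_step st O C I V.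
- exact: repl_step st O C R' I V J.
Qed.

Lemma created_prepared s g e p x d ups :
  inv s -> coord (srv s p) (v_tx d) = Some x -> decided x ->
  In e (prepared (srv s g)) -> pd_tx e = v_tx d ->
  d \in versions_of g (v_tx d) (ctime x) ups ->
  own_vv g (srv s g) < v_ut d.
Proof.
move=> [O _ C _ _ I V _] hx dx he et hd; have [_ -> _] := versions_ofP hd.
have [lt _] := clock_prepared (clock_server V g) he.
by apply: leq_trans lt _; apply: (prepared_le O C I he _ dx); rewrite et; exact: hx.
Qed.

(** A version comes into existence while its cohort still holds the transaction in Prepared, hence
    with a proposal, and so a commit time, above the cohort's own entry. *)
Lemma created_new s l s' g d :
  cstep s l s' -> inv s -> created s' g d ->
  created s g d \/ own_vv g (srv s' g) < v_ut d.
Proof.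
move=> st J [p [x [ups [hx dx hg hd]]]]; have J' := inv_step st J.
case: (tx_step st (inv_owner J) hx) => [hy|c sn u ex|y h us rc hy hm z ex|q y pt hy u _ _].
- by left; exists p, x, ups.
- by move: dx; rewrite ex.
- by move: dx; rewrite ex /decided /= eq_sym; move: z; case: size.
- right; have [e he et] := decision_prepared st (inv_owner J) (inv_prep J') hx dx hy u hg.
  exact: created_prepared J' hx dx he et hd.
Qed.

(** At the stations Prepared and Committed the version would lie above the cohort's own entry, which
    bounds [vv (srv s q) r]. So it is replicated, and in transit to [q] it would lie above that very
    entry. *)
Lemma vv_complete s q r d :
  inv s -> created s (q.1, r) d -> v_ut d <= vv (srv s q) r -> d \in store (srv s q).
Proof.
move=> J [p [x [ups [hx dx hg hd]]]] le; have [O S C R H I V K] := J.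
have [_ eu _] := versions_ofP hd.
have le' : v_ut d <= own_vv (q.1, r) (srv s (q.1, r)) := leq_trans le (clock_vv V q r).
case: (K _ _ _ _ _ hx dx hg) => [[e he et]|[hc|hr]].
- by have := created_prepared J hx dx he et hd; lia.
- by have := clock_committed (clock_server V _) hc; rewrite /= -eu; lia.
have [h1 h2] := hr _ hd; case: (q.2 =P r) => [e|/eqP n].
  by move: h1; rewrite -e -surjective_pairing.
have := h2 _ n; rewrite /= -surjective_pairing => -[//|[lt _]].
by move: lt => /=; lia.
Qed.

(* From state [s] on, [q] has every version of timestamp at most [v] whose cohort
   is the [r]-th replica, including those that are still to be created. *)
Definition covered s (q : server) (r : 'I_(nreps P)) (v : nat) : Prop :=
  v <= own_vv (q.1, r) (srv s (q.1, r)) /\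
  forall d, created s (q.1, r) d -> v_ut d <= v -> d \in store (srv s q).

Lemma covered_vv s q r : inv s -> covered s q r (vv (srv s q) r).
Proof.
move=> J; split; first exact: (clock_vv (inv_clock J)).
by move=> d; exact: vv_complete.
Qed.

Lemma covered_le s q r v v' : v' <= v -> covered s q r v -> covered s q r v'.
Proof.
move=> le [h1 h2]; split; first exact: leq_trans h1.
by move=> d hd le'; apply: h2 hd (leq_trans le' le).
Qed.

Lemma covered_step s l s' q r v :
  cstep s l s' -> inv s -> covered s q r v -> covered s' q r v.
Proof.
move=> st J [h1 h2]; have [O _ C _ _ I V _] := J.
have h1' := leq_trans h1 (own_vv_mono (q.1, r) st O C I V).
split=> // d hd le; case: (created_new st J hd) => [hc|lt]; last by lia.
exact: store_mono st (h2 d hc le).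
Qed.

Definition stable s (u : nat) : Prop := forall q r, covered s q r u.

Lemma stable_max s u v : stable s u -> stable s v -> stable s (maxn u v).
Proof. by rewrite /maxn; case: ifP. Qed.

(** Since [covered] persists, values reported or computed long ago remain sound; this is why
    stabilization may work with old data. *)
Record ust_inv s : Prop := UstInv {
  ust_reported : forall q w r, In w (reported s q) -> covered s q r (w r);
  ust_gst : forall m g q r, g \in gsts s m -> dc q = m -> covered s q r g;
  ust_server : forall p, stable s (ust (srv s p));
  ust_client : forall c, stable s (ust_c (cli s c));
  ust_own : forall p id c sn, own s p id c sn -> stable s sn }.

Lemma ust_init : ust_inv (init P).
Proof.
have K q r : covered (init P) q r 0.
  by split=> // d [p [x [ups []]]].
by split=> //= [q w r [<-|//]|m g q r]; rewrite ?ffunE // inE => /eqP ->.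
Qed.

Lemma is_min_le (s0 : seq nat) x y : is_min s0 x -> y \in s0 -> x <= y.
Proof. by case/andP => _ /allP; apply. Qed.

Lemma new_own s l s' p id c sn :
  cstep s l s' -> owner_inv s -> own s' p id c sn -> own s p id c sn \/ unused s id.
Proof.
move=> st O /ownP [x [hx <- <-]].
case: (tx_step st O hx) => [hy|c1 sn1 u _|y h us rc hy _ _ ->|q y pt hy _ _ ->] /=.
- by left; exact: coord_own.
- by right.
- by left; exact: coord_own hy.
- by left; exact: coord_own hy.
Qed.

Lemma ust_step s l s' : step s l s' -> inv s -> ust_inv s -> ust_inv s'.
Proof.
move=> st0 J U; have st := stepW st0; have O := inv_owner J.
have M q r v := @covered_step s l s' q r v st J.
have Ms v : stable s v -> stable s' v by move=> h q r; apply: M.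
have msg_sn a b m : In m (net s a b) -> match m with
    | StartReq u | StartResp _ u | SliceReq _ _ u | Prepare _ u _ _ => stable s' u
    | _ => True end.
  move=> hm; have := own_msg O hm; case: m hm => //=.
  + move=> u hm [c [p [ea eb]]]; subst a b.
    by rewrite (start_req (inv_start J) hm); apply: Ms; exact: ust_client.
  + by move=> id sn hm [p [c [_ _ o]]]; apply: Ms; exact: ust_own o.
  + by move=> id k sn hm [p [c [_ o]]]; apply: Ms; exact: ust_own o.
  + by move=> id sn ht ups hm [p [g [c [_ _ o _]]]]; apply: Ms; exact: ust_own o.
have h1 q w r : In w (reported s q) -> covered s' q r (w r).
  by move=> hw; apply: M; exact: ust_reported.
have h2 m g q r : g \in gsts s m -> dc q = m -> covered s' q r g.
  by move=> hg e; apply: M; exact: ust_gst hg e.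
have h3 p : stable s' (ust (srv s p)) by apply: Ms; exact: ust_server.
have h4 c : stable s' (ust_c (cli s c)) by apply: Ms; exact: ust_client.
have h5 p id c sn : own s p id c sn -> stable s' sn.
  by move=> o; apply: Ms; exact: ust_own o.
have cov q r : covered s' q r (vv (srv s q) r) by apply: M; exact: covered_vv.
have O' := owner_step st O.
split.
- move=> q w r; case: st0 {st M Ms h5 O' msg_sn} h1 cov; try (solve [intros; eauto]).
  move=> /= p h1 cov.
  rewrite /upd; case: (q =P p) => [->|_]; last exact: h1.
  by case=> [<-|hw]; [exact: cov | exact: h1].
- move=> m g q r; case: st0 {st M Ms h5 O' msg_sn} h1 h2 cov; try (solve [intros; eauto]).
  move=> /= m0 w g0 hw hmin h1 h2 cov.
  rewrite /upd; case: (m =P m0) => [->|_]; last exact: h2.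
  rewrite inE => /orP [/eqP ->|hg] eq; last exact: h2 hg eq.
  have hq : In (w q) (reported s q) by apply/In_mem; exact: hw.
  apply: covered_le (h1 _ _ r hq); apply: (is_min_le hmin); apply/allpairsP.
  exists (q, r); split=> //=; last by rewrite mem_enum.
  by rewrite mem_filter eq eqxx mem_enum inE.
- move=> p; case: st0 {st M Ms h5 O' h1 cov} msg_sn h2 h3 h4; try (solve [intros; apply: h3 | intros; eauto]).
  + move=> p0 a m ms l0 s1 out wa hr msg_sn h2 h3 h4.
    have hm : In m (net s a (inl p0)) by rewrite wa; left.
    move: (msg_sn _ _ _ hm) (h3 p0) (h3 p) => {wa hm}; rewrite /=  /upd; case: (p =P p0) => [_|//].
    by case: hr => //= *; exact: stable_max.
  + move=> p0 s1 out ha _ _ h3 _; rewrite /= [upd _ _ _ p]/upd /=; case: (p =P p0) => [_|_]; last exact: h3.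
    by case: ha h3 => [ub s2 [x _|t _ _] _ cts|ub s2 [x _|t _ _] _] h3 /=; exact: h3.
  + move=> p0 g u hg hmin msg_sn h2 h3 _; rewrite /= [upd _ _ _ p]/upd /=; case: (p =P p0) => [_|_]; last exact: h3.
    apply: stable_max; first exact: h3.
    (* For each [q] the bound comes from the stable time of the data center that contains [q]. *)
    move=> q r; apply: covered_le (h2 _ _ q r (hg (dc q)) erefl).
    by apply: (is_min_le hmin); apply/mapP; exists (dc q); rewrite ?mem_enum.
- move=> c; case: st0 {st M Ms h1 h2 h3 cov O'} msg_sn h4; try (solve [intros; eauto]).
  + move=> c0 l0 s1 out ha _ h4; rewrite /= [upd _ _ _ c]/upd /=; case: (c =P c0) => [_|_]; last exact: h4.
    by case: ha h4 => /= *; match goal with h : _ |- _ => exact: h end.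
  + move=> c0 a m ms l0 s1 wa hr msg_sn h4.
    have hm : In m (net s a (inr c0)) by rewrite wa; left.
    move: (msg_sn _ _ _ hm) (h4 c0) (h4 c) => {wa hm}; rewrite /=  /upd; case: (c =P c0) => [_|//].
    by case: hr.
- move=> p id c sn o'; have [/h5 //|u] := new_own st O o'.
  case: st0 o' {st M Ms h1 h2 cov O'} msg_sn h3 h5 =>
    [|p0 a m ms l0 s1 out wa hr|p0 s1 out ha|c0 l0 s1 out ha|c0 a m ms l0 s1 wa hr
     |p0|m w g _ _|p0 g v _ _] o' msg_sn h3 h5; move: o'; rewrite /own /= ?u //.
  + have hm : In m (net s a (inl p0)) by rewrite wa; left.
    move: (msg_sn _ _ _ hm) (h3 p0) => {wa hm h5 h3 msg_sn}.
    rewrite [upd _ _ _ p]/upd; case: (p =P p0) => [ep|_]; last by rewrite u.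
    case: hr => /=; try (by intros; match goal with H : omap _ _ = _ |- _ => rewrite u in H end).
    * move=> c1 u1 id1 fr k1 k2; rewrite [upd _ _ _ id]/upd.
      by case: (id =P id1) => [_ [_ <-]|_]; [exact: stable_max | rewrite u].
    * move=> c1 id1 h0 ups y rc hy _ _; rewrite [upd _ _ _ id]/upd.
      by case: (id =P id1) => [e|_]; [move: hy; rewrite -e u | rewrite u].
    * move=> q id1 pt y hy _ _ _; rewrite [upd _ _ _ id]/upd.
      by case: (id =P id1) => [e|_]; [move: hy; rewrite -e u | rewrite u].
    * move=> q id1 pt y hy _ _ _; rewrite [upd _ _ _ id]/upd.
      by case: (id =P id1) => [e|_]; [move: hy; rewrite -e u | rewrite u].
  + rewrite [upd _ _ _ p]/upd; case: (p =P p0) => [ep|_]; last by rewrite u.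
    by rewrite (coord_apply ha) u.
  + by rewrite [upd _ _ _ p]/upd; case: (p =P p0) => [ep|_] /=; rewrite u.
Qed.

(** * Executions and causality *)

Lemma op_phase s l s' id c :
  cstep s l s' ->
  (exists k v, l = Write id c k v) \/ (exists k res, l = Read id c k res) ->
  exists p ks, ph (cli s c) = Active p id ks.
Proof.
case=> [p0 r l0 s1 out w ev ne|c0 r l0 s1 out w ev ne|sv rp gs h] [[k [v e]]|[k [v e]]] //; subst.
- by inversion ev as [a m l1 s2 out1 hr|]; subst; inversion hr.
- by inversion ev as [a m l1 s2 out1 hr|]; subst; inversion hr.
- by inversion ev as [l1 s2 out1 hr|a m l1 s2 hr]; subst; inversion hr; subst; eexists; eexists; eassumption.
- by inversion ev as [l1 s2 out1 hr|a m l1 s2 hr]; subst; inversion hr; subst; eexists; eexists; eassumption.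
Qed.

Lemma assign_label s s' id c sn :
  cstep s (Assign id c sn) s' -> start_inv s ->
  (exists p, own s' p id c sn) /\ ust_c (cli s c) <= sn.
Proof.
move=> st S; inversion st as [p0 r l0 s1 out w ev ne|c0 r l0 s1 out w ev ne|]; subst.
  inversion ev as [a m l1 s2 out1 hr|]; subst; inversion hr; subst.
  split; last by rewrite -(start_req S (net_in_head ne)) leq_maxr.
  by exists p0; rewrite /own /upd /= eqxx /= /upd eqxx.
by inversion ev as [l1 s2 out1 hr|a m l1 s2 hr]; subst; inversion hr.
Qed.

Lemma decide_label s s' id c ds d :
  cstep s (Decide id c ds) s' -> d \in ds ->
  [/\ v_tx d = id, exists g, created s' g d &
      exists p x, [/\ coord (srv s p) id = Some x, tx_client x = c & undecided x]].
Proof.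
move=> st hd; inversion st as [p0 r l0 s1 out w ev ne|c0 r l0 s1 out w ev ne|]; subst.
  inversion ev as [a m l1 s2 out1 hr|]; subst.
  inversion hr as [| | | | | | |q id0 pt x hx hs| | |]; subst.
  have [_ /In_map [[g ups] hg <-] /In_mem hd'] : exists2 l, In l
      [seq versions_of g.1 id (\max_(t <- pt :: tx_votes x) t) g.2 | g <- tx_cohorts x] &
      In d l by apply/In_flatten; exact/In_mem.
  have [et eu _] := versions_ofP hd'; split=> //.
    exists g, p0, (TxRec (tx_client x) (tx_snap x) (tx_cohorts x) (pt :: tx_votes x)), ups.
    split=> /=; last by rewrite et.
    + by rewrite /upd eqxx /= et /upd eqxx.
    + by rewrite /decided /= -hs eqxx.
    + exact/In_mem.
  by exists p0, x; split=> //; rewrite /undecided -hs.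
by inversion ev as [l1 s2 out1 hr|a m l1 s2 hr]; subst; inversion hr.
Qed.

Lemma created_inj s g d g' d' :
  owner_inv s -> created s g d -> created s g' d' -> v_tx d = v_tx d' -> v_ut d = v_ut d'.
Proof.
move=> O [p [x [ups [hx _ _ hd]]]] [p' [x' [ups' [hx' _ _ hd']]]] e.
have [_ -> _] := versions_ofP hd; have [_ -> _] := versions_ofP hd'.
rewrite e in hx; have [ep _ _] := owner_client O (coord_own hx) hx'; subst p'.
by move: hx; rewrite hx' => -[->].
Qed.

Lemma created_partition s g d : owner_inv s -> created s g d -> partition (v_key d) = g.1.
Proof.
move=> O [p [x [ups [hx _ hg hd]]]]; have [_ _ _ hp] := own_coord O hx.
by have [_ _ hk] := versions_ofP hd; exact: hp hg hk.
Qed.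

Lemma snap_lt_ctime (x : txrec) : coord_ok x -> decided x -> tx_snap x < ctime x.
Proof.
case=> hv _ _ _ /andP [z /eqP e]; move: z; rewrite -e.
case E: (tx_votes x) => [|v vs] // _.
have h : v \in tx_votes x by rewrite E mem_head.
exact: leq_trans (hv v h) (ctime_ge h).
Qed.

Lemma created_snap s g d p c sn :
  owner_inv s -> created s g d -> own s p (v_tx d) c sn -> sn < v_ut d.
Proof.
move=> O [p' [x [ups [hx dx _ hd]]]] o; have [_ -> _] := versions_ofP hd.
have [_ _ ->] := owner_client O o hx; exact: snap_lt_ctime (own_coord O hx) dx.
Qed.

(* The client has moved on without committing the transaction. *)
Definition dead s p id c : Prop :=
  [/\ exists2 x, coord (srv s p) id = Some x & tx_client x = c /\ tx_cohorts x = [::],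
      forall ks, ph (cli s c) <> Active p id ks,
      committing (ph (cli s c)) p id = false &
      forall a b sn, ~ In (StartResp P id sn) (net s a b)].

Lemma dead_step s l s' p id c :
  cstep s l s' -> inv s -> dead s p id c -> dead s' p id c.
Proof.
move=> st J [[x hx [ec co]] hA hC hS]; have [O S C R H I V K] := J.
have hS' a b sn : ~ In (StartResp P id sn) (net s' a b).
  case: st => [p0 r l0 s1 out w ev ne|c0 r l0 s1 out w ev ne|sv rp gs h] /=; last exact: hS.
  - move/(net_in ne) => [/hS //|[_ hm]].
    have k := In_cnt (f := is_start_resp) hm isT; move: k hm.
    case: ev ne => [a0 m l1 s2 out1 []|s2 out1 ha] /=; try by counts.
    by move=> c1 u id1 fr ne _ [] // [_ e _]; subst id1; move: hx; rewrite fr.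
  - move/(net_in ne) => [/hS //|[_ hm]].
    have k := In_cnt (f := is_start_resp) hm isT; move: k hm.
    by case: ev ne => [l1 s2 out1 []|a0 m l1 s2 []] /=; counts.
split=> //.
- have [x' hx'] := coord_mono st hx; exists x' => //.
  case: (tx_step st O hx') => [hy|c1 sn u _|y h us rc hy hm _ _|q y pt hy u _ _].
  + by move: hy; rewrite hx => -[<-].
  + by move: hx; rewrite u.
  (* A commit request could reach the coordinator only if the client were waiting for the commit. *)
  + move: hy; rewrite hx => -[e]; subst y.
    by have := commit_req_committing C hx hm; rewrite ec hC.
  + by move: hy u; rewrite hx => -[<-]; rewrite undecided_nil.
- move=> ks; case: st {hS'} => [p0 r l0 s1 out w ev ne|c0 r l0 s1 out w ev ne|sv rp gs h] //=.
  rewrite /upd; case: (c =P c0) => [e|//]; subst c0.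
  case: ev ne => [l1 s2 out1 []|a m l1 s2 []] //= p1 id1.
  + by move=> ks1 hp _ _ _ [e1 e2 _]; subst p1 id1; exact: hA hp.
  + by move=> sn hp ne [e1 e2 _]; subst p1 id1; exact: hS (net_in_head ne).
  + by move=> ks1 k res hp _ _ [e1 e2 _]; subst p1 id1; exact: hA hp.
- case: st {hS'} => [p0 r l0 s1 out w ev ne|c0 r l0 s1 out w ev ne|sv rp gs h] //=.
  rewrite /upd; case: (c =P c0) => [e|//]; subst c0.
  case: ev ne => [l1 s2 out1 []|a m l1 s2 []] //= p1 id1 hp _ _.
  by apply/negP => /andP [/eqP e1 /eqP e2]; subst p1 id1; exact: hA hp.
Qed.

(** * The invariants along an execution *)

Section Executions.
Context (e : execution P).

Lemma cstep_at t : cstep (st e t) (lb e t) (st e t.+1).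
Proof. exact/stepW/st_step. Qed.

Lemma inv_at t : inv (st e t).
Proof. by elim: t => [|t]; [rewrite st_init; exact: inv_init | exact: inv_step (cstep_at t)]. Qed.

Lemma ust_at t : ust_inv (st e t).
Proof.
elim: t => [|t]; first by rewrite st_init; exact: ust_init.
exact: ust_step (st_step e t) (inv_at t).
Qed.

Lemma own_le t t' p id c sn : t <= t' -> own (st e t) p id c sn -> own (st e t') p id c sn.
Proof.
move=> /subnKC <-; elim: (t' - t) => [|n IH]; first by rewrite addn0.
by move=> /IH; rewrite addnS; exact: own_mono (cstep_at _).
Qed.

Lemma decided_le t t' p id x : t <= t' ->
  coord (srv (st e t) p) id = Some x -> decided x -> coord (srv (st e t') p) id = Some x.
Proof.
move=> /subnKC <- hx d; elim: (t' - t) => [|n IH]; first by rewrite addn0.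
by rewrite addnS; apply: decided_mono (cstep_at _) _ _ IH d; case: (inv_at (t + n)).
Qed.

Lemma created_le t t' g d : t <= t' -> created (st e t) g d -> created (st e t') g d.
Proof.
move=> le [p [x [ups [hx dx hg hd]]]]; exists p, x, ups; split=> //; exact: decided_le hx dx.
Qed.

Lemma stable_le t t' u : t <= t' -> stable (st e t) u -> stable (st e t') u.
Proof.
move=> /subnKC <- h; elim: (t' - t) => [|n IH]; first by rewrite addn0.
by rewrite addnS => q r; exact: covered_step (cstep_at _) (inv_at _) (IH q r).
Qed.

Lemma ust_c_le t t' c : t <= t' -> ust_c (cli (st e t) c) <= ust_c (cli (st e t') c).
Proof.
move=> /subnKC <-; elim: (t' - t) => [|n IH]; first by rewrite addn0.
by rewrite addnS; apply: leq_trans IH (ust_c_mono c (cstep_at _) (inv_start (inv_at _))).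
Qed.

Lemma hwt_le t t' c : t <= t' -> hwt_c (cli (st e t) c) <= hwt_c (cli (st e t') c).
Proof.
move=> /subnKC <-; elim: (t' - t) => [|n IH]; first by rewrite addn0.
rewrite addnS; apply: leq_trans IH _.
by apply: hwt_mono (cstep_at _) _ _ _; case: (inv_at (t + n)).
Qed.

Lemma dead_le t t' p id c : t <= t' -> dead (st e t) p id c -> dead (st e t') p id c.
Proof.
move=> /subnKC <- h; elim: (t' - t) => [|n IH]; first by rewrite addn0.
by rewrite addnS; exact: dead_step (cstep_at _) (inv_at _) IH.
Qed.

Lemma created_ut t t' g g' d d' :
  created (st e t) g d -> created (st e t') g' d' -> v_tx d = v_tx d' -> v_ut d = v_ut d'.
Proof.
move=> h h'; apply: (created_inj (inv_owner (inv_at (maxn t t')))).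
  exact: created_le (leq_maxl _ _) h.
exact: created_le (leq_maxr _ _) h'.
Qed.

Lemma active_own t c p id ks : ph (cli (st e t) c) = Active p id ks ->
  own (st e t) p id c (ust_c (cli (st e t) c)).
Proof. by move=> h; have := own_phase (inv_owner (inv_at t)) c; rewrite /phase_owner h. Qed.

(** Being active in another transaction, the client does not wait for [id1]. So [id1] is decided and
    its commit time has entered [hwt_c], or it has no cohorts. In the second case it is [dead] and
    no version of it can exist at any time [t], even after [j]. *)
Lemma earlier_tx i j t c p1 id1 ks1 p2 id2 ks2 g d :
  i <= j -> ph (cli (st e i) c) = Active p1 id1 ks1 ->
  ph (cli (st e j) c) = Active p2 id2 ks2 -> id1 <> id2 ->
  created (st e t) g d -> v_tx d = id1 ->
  (exists2 x, coord (srv (st e j) p1) id1 = Some x & decided x) /\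
  v_ut d <= hwt_c (cli (st e j) c).
Proof.
move=> le h1 h2 ne hd et; have J := inv_at j.
have [x [hx ec _]] := (ownP _ _ _ _ _).1 (own_le le (active_own h1)).
have nc : committing (ph (cli (st e j) c)) p1 id1 = false by rewrite h2.
case dx: (decided x).
  split; first by exists x.
  have [p [y [ups [hy dy _ hv]]]] := hd; have [_ -> _] := versions_ofP hv.
  have hx' := decided_le (leq_maxl j t) hx dx.
  have hy' := decided_le (leq_maxr j t) hy dy; rewrite et in hy'.
  have [ep _ _] := owner_client (inv_owner (inv_at _)) (coord_own hx') hy'; subst p.
  move: hy'; rewrite hx' => -[<-].
  by case: (hwt_decided (inv_hwt J) hx dx); rewrite ec // nc.
have [_ _ sz _] := own_coord (inv_owner J) hx.
have und : undecided x = false.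
  by have := commit_count (inv_commit J) hx; rewrite ec nc; case: undecided => //; lia.
have co : tx_cohorts x = [::].
  apply/eqP; rewrite -size_eq0; move: und dx sz; rewrite /undecided /decided.
  by case: (size (tx_cohorts x)) => // n; lia.
have dd : dead (st e j) p1 id1 c.
  split=> //; [by exists x | by move=> ks; rewrite h2 => -[_ e1 _]; case: ne |].
  move=> a b sn hm; have /= [q [c' [ea eb o]]] := own_msg (inv_owner J) hm; subst a b.
  have [eq ec' _] := owner_client (inv_owner J) o hx; subst q c'.
  have := start_count (inv_start J) (tx_client x) p1; rewrite ec h2 /=.
  by have := In_count (a := is_start_resp) hm isT; rewrite ec; lia.
have [[y hy [_ cy]] _ _ _] := dead_le (leq_maxl j t) dd.
have [p [z [ups [hz dz _ _]]]] := created_le (leq_maxr j t) hd; rewrite et in hz.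
have [ep _ _] := owner_client (inv_owner (inv_at _)) (coord_own hy) hz; subst p.
by move: hz dz; rewrite hy /decided => -[<-]; rewrite cy.
Qed.

Lemma active_undecided j c p id ks x :
  ph (cli (st e j) c) = Active p id ks -> coord (srv (st e j) p) id = Some x ->
  decided x = false.
Proof. by move=> h hx; rewrite /decided (active_tx (inv_commit (inv_at j)) hx h). Qed.

Lemma later_tx j t c p id ks g d :
  ph (cli (st e j) c) = Active p id ks -> created (st e t) g d -> v_tx d = id ->
  j < t /\ hwt_c (cli (st e j) c) < v_ut d.
Proof.
move=> h [q [x [ups [hx dx _ hv]]]] et; have [_ -> _] := versions_ofP hv.
rewrite et in hx; have o := active_own h; have [y [hy ec _]] := (ownP _ _ _ _ _).1 o.
have eq : p = q.
  have o1 := own_le (leq_maxl j t) o.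
  have o2 := own_le (leq_maxr j t) (coord_own hx).
  exact: (own_uniq (inv_owner (inv_at _)) o1 o2).
subst q; have lt : j < t.
  rewrite ltnNge; apply/negP => le; have hx' := decided_le le hx dx.
  by rewrite (active_undecided h hx') in dx.
split=> //; have le := ltnW lt; clear hv lt; move: le x hx dx => /subnKC <-.
(* The induction goes back to the step that counts the last vote. That vote exceeds the [hwt_c] of
   its moment, which is at least the one at [j]. *)
elim: (t - j) => [|n IH] x; first by rewrite addn0 => /(active_undecided h) ->.
rewrite addnS => hx dx; have J := inv_at (j + n).
case: (tx_step (cstep_at _) (inv_owner J) hx) => [hz|c1 sn u ex|z h1 us rc hz hm k ex|q z pt hz u hm ex].
- exact: IH hz dx.
- by move: dx; rewrite ex.
- by move: dx; rewrite ex /decided /= eq_sym; move: k; case: size.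
- have o1 := own_le (leq_addr n j) o; have [_ ez _] := owner_client (inv_owner J) o1 hz.
  have lt := hwt_resp (inv_hwt J) hz hm; rewrite -ez in lt.
  apply: leq_ltn_trans (hwt_le c (leq_addr n j)) _; apply: leq_trans lt _.
  by apply: ctime_ge; rewrite ex mem_head.
Qed.

(** * Timestamps along causal paths *)

Lemma op_of_inj i c c' : op_of e i c -> op_of e i c' -> c = c'.
Proof.
case=> [[id [k [v h]]]|[id [k [v h]]]] [[id' [k' [v' h']]]|[id' [k' [v' h']]]];
  by move: h'; rewrite h => -[].
Qed.

Lemma leadsto_lt i j : leadsto e i j -> i < j.
Proof.
elim=> {i j} [i j c _ _ //|i j [id [c [k [v [id' [c' [_ _ lt _]]]]]]] //|i l j _ h1 _ h2].
exact: ltn_trans h1 h2.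
Qed.

(* For the write [i] of client [c1] of a version with timestamp [ut]: operation [l]
   is in the same thread, or its snapshot contains the version. The alternative
   is preserved by [leadsto]. *)
Definition known (i : nat) (c1 : client) (ut l : nat) : Prop :=
  forall c, op_of e l c -> c1 = c /\ i <= l \/ ut <= ust_c (cli (st e l) c).

Lemma write_phase i id c k v : lb e i = Write id c k v ->
  exists p ks, ph (cli (st e i) c) = Active p id ks.
Proof. by move=> h; apply: (op_phase (cstep_at i)); left; exists k, v. Qed.

(** Along a thread the property persists because [ust_c] grows. Only a read from another client's
    transaction has content: the version read lies within the reader's snapshot time, and its
    timestamp turns out to be at least that of [d]. *)
Lemma known_leadsto i c1 k v t g d l j :
  lb e i = Write (v_tx d) c1 k v -> created (st e t) g d ->
  leadsto e l j -> known i c1 (v_ut d) l -> known i c1 (v_ut d) j.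
Proof.
move=> hi hd; elim=> {l j} [l j c ol oj lt K c' oj'|l j [id [c [k' [v' [id' [c' [hl hj lt _]]]]]]] K c'' oj|l m j _ h1 _ h2 K];
  last by apply: h2; exact: h1.
  rewrite -(op_of_inj oj oj') {c' oj'}; case: (K c ol) => [[-> le]|le].
    by left; split=> //; exact: leq_trans le (ltnW lt).
  by right; exact: leq_trans le (ust_c_le c (ltnW lt)).
have oj' : op_of e j c' by left; exists id', k', (Some (v', id)).
rewrite -(op_of_inj oj' oj) {c'' oj}.
have ol : op_of e l c by right; exists id, k', v'.
have [p [ks hp]] := write_phase hl.
have J := inv_at j.
have thread : c = c' -> c1 = c' /\ i <= j \/ v_ut d <= ust_c (cli (st e j) c').
  move=> ec; subst c'; case: (K c ol) => [[-> le]|le].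
    by left; split=> //; exact: leq_trans le (ltnW lt).
  by right; exact: leq_trans le (ust_c_le c (ltnW lt)).
case: (read_label (cstep_at j) (inv_owner J) (inv_content J) hj) => /=.
  move=> [q [sn o]]; apply: thread; have o' := own_le (ltnW lt) (active_own hp).
  have eq := own_uniq (inv_owner J) o' o; subst q.
  by have [] := own_inj o' o.
move=> [g2 [d2 [hd2 et2 le2]]]; right; apply: leq_trans le2.
(* If the writing transaction had [d] within its snapshot time, its commit time, the timestamp of
   [d2], is larger still. *)
case: (K c ol) => [[ec le]|le]; last first.
  apply: ltnW; apply: leq_ltn_trans le _.
  apply: created_snap (inv_owner J) hd2 _; rewrite et2.
  exact: own_le (ltnW lt) (active_own hp).
subst c1; have [p1 [ks1 hp1]] := write_phase hi.
(* Now one client wrote both [d] and [d2]: in one transaction, with one timestamp, or [d] in an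
   earlier one, whose commit time [hwt_c] had absorbed before [d2] got its own. *)
case: (v_tx d =P v_tx d2) => [ee|ne]; first by rewrite (created_ut hd hd2 ee).
rewrite et2 in ne; have [_ le1] := earlier_tx le hp1 hp ne hd erefl.
have [_ lt2] := later_tx hp hd2 et2.
by apply: ltnW; exact: leq_ltn_trans le1 lt2.
Qed.

Lemma version_created d : is_version e d -> exists t g, created (st e t) g d.
Proof.
case=> i [c [id [ds [h hd]]]]; have st := cstep_at i; rewrite h in st.
by have [_ [g hg] _] := decide_label st hd; exists i.+1, g.
Qed.

Lemma depends_known X Y : depends e X Y ->
  exists i j c1 c2, [/\ (exists k v, lb e i = Write (v_tx X) c1 k v),
    (exists k v, lb e j = Write (v_tx Y) c2 k v), i < j &
    c1 = c2 \/ v_ut X <= ust_c (cli (st e j) c2)].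
Proof.
case=> vX vY ne [i [j [[[c1 hi] _] [[c2 hj] _] lij]]].
exists i, j, c1, c2; split; [by eexists; eexists; eassumption | by eexists; eexists; eassumption
  | exact: leadsto_lt lij |].
have [t [g hX]] := version_created vX.
have oj : op_of e j c2 by right; exists (v_tx Y), (v_key Y), (v_val Y).
have oi : op_of e i c1 by right; exists (v_tx X), (v_key X), (v_val X).
have Ki : known i c1 (v_ut X) i by move=> c /(op_of_inj oi) <-; left.
by case: (known_leadsto hi hX lij Ki oj) => [[]|]; [left|right].
Qed.

Lemma depends_ut X Y : depends e X Y -> v_ut X < v_ut Y.
Proof.
move=> D; have [vX vY ne _] := D.
have [i [j [c1 [c2 [[k1 [v1 hi]] [k2 [v2 hj]] lt K]]]]] := depends_known D.
have [t [g hX]] := version_created vX; have [t' [g' hY]] := version_created vY.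
have [p2 [ks2 h2]] := write_phase hj.
have [lt' hw] := later_tx h2 hY erefl.
case: K => [ec|le].
  subst c1; have [p1 [ks1 h1]] := write_phase hi.
  have [_ le1] := earlier_tx (ltnW lt) h1 h2 ne hX erefl.
  exact: leq_ltn_trans le1 hw.
apply: leq_ltn_trans le _; apply: created_snap (inv_owner (inv_at t')) hY _.
exact: own_le (ltnW lt') (active_own h2).
Qed.

Lemma stable_store t t' g d u q :
  stable (st e t) u -> created (st e t') g d -> v_ut d <= u -> q.1 = partition (v_key d) ->
  d \in store (srv (st e t) q).
Proof.
move=> S hd le eq; have [r er] : exists r, g = (q.1, r).
  exists g.2; rewrite eq (created_partition (inv_owner (inv_at t')) hd).
  exact: surjective_pairing.
subst g; suff hd' : created (st e t) (q.1, r) d by have [_] := S q r; apply.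
case: (leqP t' t) => [|/ltnW/subnKC lt]; first by move=> le'; exact: created_le hd.
move: hd; rewrite -lt; elim: (t' - t) => [|n IH]; first by rewrite addn0.
rewrite addnS => hd; apply: IH.
case: (created_new (cstep_at _) (inv_at _) hd) => // lt'.
have [le' _] := stable_le (leqW (leq_addr n t)) S q r.
by lia.
Qed.

End Executions.

End Model.

Theorem proposition3 (P : system) (e : execution P) (T : txid) (c : client P)
    (sn t0 : nat) (rep : 'I_(nparts P) -> 'I_(nreps P))
    (tm : 'I_(nparts P) -> nat) :
  lb e t0 = Assign T c sn ->
  (forall n, t0 < tm n) ->
  causally_consistent e (snapshot e c sn t0 rep tm).
Proof.
move=> h0 htm; have st0 := cstep_at e t0; rewrite h0 in st0.
have [[p0 o0] le0] := assign_label st0 (inv_start (inv_at e t0)).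
(* The state after event [t0] is the first in which [sn] is recorded, and [t0 < tm n] places every
   serving time at or after it. *)
have S0 : stable (st e t0.+1) sn := ust_own (ust_at e t0.+1) o0.
have closed X Y : snapshot e c sn t0 rep tm Y -> depends e X Y -> snapshot e c sn t0 rep tm X.
  move=> SY D; have [vX vY ne _] := D.
  case: (leqP (v_ut X) sn) => [le|gt].
    have [t [g hX]] := version_created vX; left; split=> //.
    exact: stable_store (stable_le (htm _) S0) hX le _.
  right; split=> //.
  (* A version [Y] within [sn] would give [v_ut Y <= sn < v_ut X < v_ut Y]; so [Y] is one of the
     client's own earlier writes. *)
  case: SY => [[le _]|[_ [iY ltY [id [ds [hl hd]]]]]]; first by have := depends_ut D; lia.
  have stY := cstep_at e iY; rewrite hl in stY.
  have [et [g hY] [p [x [hx ec _]]]] := decide_label stY hd; subst id.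
  have [i [j [c1 [c2 [[k1 [v1 hi]] [k2 [v2 hj]] lt K]]]]] := depends_known D.
  have [p2 [ks2 h2]] := write_phase hj.
  have [ltj _] := later_tx h2 hY erefl.
  have ej : c2 = c.
    have lej : j <= iY by [].
    by have [_ -> _] := owner_client (inv_owner (inv_at e iY)) (own_le lej (active_own h2)) hx.
  subst c2; have ltj0 : j < t0 := leq_trans ltj ltY.
  (* [X] cannot have been within the snapshot time at [j]: [ust_c] only grows and is at most [sn] at
     [t0], while [v_ut X] exceeds [sn]. So the client wrote [X] itself. *)
  case: K => [e1|le]; last by have := ust_c_le e c (ltnW ltj0); lia.
  subst c1; have [p1 [ks1 h1]] := write_phase hi.
  have [iX [cX [idX [dsX [hlX hdX]]]]] := vX.
  have stX := cstep_at e iX; rewrite hlX in stX.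
  have [etX [gX hX] [p' [x' [hx' ecX und]]]] := decide_label stX hdX; subst idX.
  have [[y hy dy] _] := earlier_tx (ltnW lt) h1 h2 ne hX erefl.
  (* At [iX] the transaction of [X] is still undecided, whereas at [j] it is decided for good. *)
  have lX : iX < j.
    rewrite ltnNge; apply/negP => le; have hy' := decided_le le hy dy.
    have [ep _ _] := owner_client (inv_owner (inv_at e iX)) (coord_own hy') hx'; subst p'.
    by move: hx' und; rewrite hy' => -[<-]; rewrite decided_undecided.
  exists iX; first exact: ltn_trans lX ltj0.
  have -> : c = cX; last by exists (v_tx X), dsX.
  have o1 := own_le (leq_maxl i iX) (active_own h1).
  have o2 := own_le (leq_maxr i iX) (coord_own hx').
  have ep := own_uniq (inv_owner (inv_at e _)) o1 o2; subst p'.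
  by have [-> _] := own_inj o1 o2.
split=> // X Y [SX mX] [SY mY] D [X' [ek nX D1 D2]].
(* By [closed] the intermediate version is in the snapshot as well, with a timestamp above that of
   [X], so [X] would not be the freshest. *)
have lt := depends_ut D1; have := mX X' (closed _ _ SY D2) ek.
by rewrite /version_le; lia.
Qed.
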